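(* Let $G=(V^l\cup V^r\cup\{s,t\},E)$ be an outerplanar $st$-digraph and let $\mathcal{D}(G)=\{o_1,\ldots,o_\lambda\}$ be its $st$-polygon decomposition. Then there exists a crossing-optimal acyclic HP-completion set $P_{\mathrm{opt}}$ for $G$ (together with a crossing-minimal drawing) such that: (a) each edge of $E$ is crossed by at most two edges of $P_{\mathrm{opt}}$; (b) for each maximal $st$-polygon $o_i$, $i\le\lambda$, its upper limiting edge $e_i$ is crossed by at most one edge of $P_{\mathrm{opt}}$, and the edge crossing $e_i$, if any, enters $G_i$ (its head is a vertex of $G_i$ and its tail is not).
   Context: An $st$-digraph is a finite acyclic digraph with exactly one source $s$ and one sink $t$. An outerplanar $st$-digraph is an $st$-digraph with a fixed upward planar embedding with all vertices on the external face; its external boundary consists of two directed paths from $s$ to $t$, the left side (inner vertices $V^l$) and the right side (inner vertices $V^r$); $s,t$ count as lying on both sides. An $st$-polygon is an outerplanar $st$-digraph in which each side has at least one inner vertex and no edge joins an inner left vertex to an inner right vertex. An $st$-polygon of $G$ is a subgraph of $G$ which, with the inherited embedding, is an $st$-polygon and contains every vertex and edge of $G$ in the region bounded by its external boundary; it is maximal if not properly contained in another $st$-polygon of $G$. A maximal $st$-polygon $R$ with source $s_R$ and sink $t_R$ occupies a strip of the drawing of $G$ bounded by two boundary edges of $R$, each joining a vertex of the left side of $G$ to a vertex of the right side of $G$: the lower limiting edge (incident to $s_R$) and the upper limiting edge (incident to $t_R$). Free vertices are the vertices of $G$ in no maximal $st$-polygon. The representative of a maximal $st$-polygon is its source, and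 of a free vertex is itself; the $st$-polygon decomposition $\mathcal{D}(G)=\{o_1,\dots,o_\lambda\}$ lists all maximal $st$-polygons and free vertices ordered so that $o_i$ precedes $o_j$ iff there is a directed path in $G$ from the representative of $o_i$ to that of $o_j$. $G_i$ denotes the subgraph of $G$ induced by the vertices of $o_1,\ldots,o_i$. An acyclic HP-completion set of $G$ is a set $E_c$ of new edges such that $(V,E\cup E_c)$ is acyclic and has a hamiltonian path from $s$ to $t$ using all edges of $E_c$; its number of crossings is the minimum number of edge crossings over drawings of $(V,E\cup E_c)$ preserving the embedding of $G$; it is crossing-optimal if this number is minimum among all acyclic HP-completion sets of $G$. ''Crossed by'' refers to a drawing attaining this minimum. *)

(* Defs.v *)
(* MathComp-Analysis: drawings live in the plane over an arbitrary realType. *)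
From mathcomp Require Import all_boot all_order all_algebra finmap.
From mathcomp Require Import all_classical all_reals all_analysis.
Import numFieldNormedType.Exports.
Import Order.TTheory GRing.Theory Num.Theory.

Set Implicit Arguments.
Unset Strict Implicit.
Unset Printing Implicit Defensive.

Local Open Scope ring_scope.

Record digraph (T : finType) := Digraph {
  verts : {set T};
  arcs : {set T * T}
}.

Section Digraphs.
Variable T : finType.
Implicit Types (H G : digraph T) (s t u v : T) (p : seq T) (P : {set T * T}).

Definition adj H : rel T := fun u v => (u, v) \in arcs H.

Definition subdigraph H G : Prop :=
  verts H \subset verts G /\ arcs H \subset arcs G.

Definition acyclic H : Prop := forall c, cycle (adj H) c -> c = [::].

Definition is_source H v : Prop :=
  v \in verts H /\ forall u, ~~ adj H u v.

Definition is_sink H v : Prop :=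
  v \in verts H /\ forall u, ~~ adj H v u.

Definition st_digraph H s t : Prop :=
  [/\ forall e, e \in arcs H -> (e.1 \in verts H) && (e.2 \in verts H),
      acyclic H,
      forall v, is_source H v <-> v = s
    & forall v, is_sink H v <-> v = t].

(* A directed path is given by its first vertex s and the sequence p of its
   remaining vertices. *)
Definition dipath H s p t : Prop := path (adj H) s p /\ last s p = t.

Definition path_arcs s p : seq (T * T) := zip (s :: p) p.

Definition inner_verts s t p : {set T} :=
  [set v in s :: p | (v != s) && (v != t)]%SET.

Definition hamiltonian H s p t : Prop :=
  [/\ dipath H s p t, uniq (s :: p) & s :: p =i verts H].

Definition add_arcs G P : digraph T := Digraph (verts G) (arcs G :|: P).

Definition acyclic_HP_completion G s t P : Prop :=
  [/\ [disjoint P & arcs G],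
      acyclic (add_arcs G P)
    & exists p, hamiltonian (add_arcs G P) s p t /\
                {subset P <= path_arcs s p}].

End Digraphs.

(* Every arc is drawn as a curve that is strictly increasing in y, hence as the
   graph of a function giving the abscissa at each height: curve e y is
   meaningful only for y between the heights of the ends of e. *)
Record drawing (R : realType) (T : finType) := Drawing {
  vx : T -> R;
  vy : T -> R;
  curve : T * T -> R -> R
}.

Section Drawings.
Variables (R : realType) (T : finType).
Implicit Types (D : drawing R T) (H G : digraph T) (e f : T * T).
Implicit Types (s t u v w : T) (p pl pr : seq T) (P : {set T * T}) (y : R).

(* e and f have a common interior point at height y. *)
Definition meet_at D e f y : Prop :=
  [/\ vy D e.1 < y < vy D e.2,
      vy D f.1 < y < vy D f.2
    & curve D e y = curve D f y].

Definition crosses D e f : Prop := exists y, meet_at D e f y.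

(* A crossing is an unordered pair of distinct arcs together with the height of
   a common interior point; a point of tangency is counted as a crossing. *)
Definition crossings D H : set ({set T * T} * R) :=
  [set c | exists e f, [/\ e \in arcs H, f \in arcs H, e != f,
     c.1 = [set e; f]%SET & meet_at D e f c.2]]%classic.

Definition num_crossings D H : nat := #|` fset_set (crossings D H)|%fset.

Definition upward_drawing D H : Prop :=
  [/\ {in verts H &, injective (fun v => (vx D v, vy D v))},
      forall u v, (u, v) \in arcs H ->
        [/\ vy D u < vy D v,
            {within `[vy D u, vy D v], continuous (curve D (u, v))}%classic,
            curve D (u, v) (vy D u) = vx D u
          & curve D (u, v) (vy D v) = vx D v],
      forall e w, e \in arcs H -> w \in verts H ->
        vy D e.1 < vy D w < vy D e.2 -> curve D e (vy D w) != vx D w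
    & finite_set (crossings D H)].

Definition upward_planar D H : Prop :=
  upward_drawing D H /\ forall e f,
    e \in arcs H -> f \in arcs H -> e != f -> ~ crosses D e f.

Definition vertex_point D v : R * R := (vx D v, vy D v).

Definition arc_points D e : set (R * R) :=
  [set z | vy D e.1 <= z.2 <= vy D e.2 /\ z.1 = curve D e z.2]%classic.

Definition drawn_points D H : set (R * R) :=
  [set z | (exists2 v, v \in verts H & z = vertex_point D v) \/
           (exists2 e, e \in arcs H & arc_points D e z)]%classic.

(* The external boundary of an upward planar drawing of an st-digraph consists
   of the s-t paths to the left, respectively to the right, of which nothing
   is drawn. *)
Definition right_of_path D s p (z : R * R) : Prop :=
  forall e, e \in path_arcs s p ->
    vy D e.1 <= z.2 <= vy D e.2 -> curve D e z.2 <= z.1.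

Definition left_of_path D s p (z : R * R) : Prop :=
  forall e, e \in path_arcs s p ->
    vy D e.1 <= z.2 <= vy D e.2 -> z.1 <= curve D e z.2.

Definition left_side D H s t p : Prop :=
  dipath H s p t /\ forall z, drawn_points D H z -> right_of_path D s p z.

Definition right_side D H s t p : Prop :=
  dipath H s p t /\ forall z, drawn_points D H z -> left_of_path D s p z.

(* The sides may share inner vertices: these are the cut vertices of H. *)
Definition outerplanar_st D H s t pl pr : Prop :=
  [/\ st_digraph H s t, upward_planar D H,
      left_side D H s t pl, right_side D H s t pr
    & forall v, v \in verts H -> (v \in s :: pl) || (v \in s :: pr)].

(* Disjointness of the inner vertices says that the external boundary is a
   simple cycle. *)
Definition st_polygon D H s t pl pr : Prop :=
  [/\ outerplanar_st D H s t pl pr,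
      (0 < #|inner_verts s t pl|)%N, (0 < #|inner_verts s t pr|)%N,
      [disjoint inner_verts s t pl & inner_verts s t pr]
    & forall u v, u \in inner_verts s t pl -> v \in inner_verts s t pr ->
        ~~ adj H u v && ~~ adj H v u].

Definition region D s t pl pr : set (R * R) :=
  [set z | [/\ vy D s <= z.2 <= vy D t,
     right_of_path D s pl z & left_of_path D s pr z]]%classic.

Definition st_polygon_of D G H : Prop :=
  subdigraph H G /\ exists s t pl pr,
    [/\ st_polygon D H s t pl pr,
        forall v, v \in verts G ->
          region D s t pl pr (vertex_point D v) -> v \in verts H
      & forall e, e \in arcs G ->
          (arc_points D e `<=` region D s t pl pr)%classic -> e \in arcs H].

Definition maximal_st_polygon D G H : Prop :=
  st_polygon_of D G H /\
  forall H', st_polygon_of D G H' -> subdigraph H H' -> H' = H.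

Definition free_vertex D G v : Prop :=
  v \in verts G /\ forall H, maximal_st_polygon D G H -> v \notin verts H.

(* pl and pr are the sides of G, whose source is s; e is the upper limiting arc
   of the st-polygon H.  When the sink of H lies on both sides of G (for
   instance when it is the sink of G), both boundary arcs entering it
   qualify. *)
Definition upper_limiting D s pl pr H e : Prop :=
  exists sH tH plH prH,
    [/\ st_polygon D H sH tH plH prH,
        (e \in path_arcs sH plH) || (e \in path_arcs sH prH),
        e.2 = tH
      & ((e.1 \in s :: pl) && (e.2 \in s :: pr)) ||
        ((e.1 \in s :: pr) && (e.2 \in s :: pl))].

(* Members of the decomposition: inl for st-polygons, inr for free vertices. *)
Definition element : Type := (digraph T + T)%type.

Definition element_verts (o : element) : {set T} :=
  match o with inl H => verts H | inr v => [set v]%SET end.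

Definition representative (o : element) v : Prop :=
  match o with inl H => is_source H v | inr w => v = w end.

Definition polygon_decomposition D G n (o : n.-tuple element) : Prop :=
  [/\ injective (tnth o),
      forall H, (exists i, tnth o i = inl H) <-> maximal_st_polygon D G H,
      forall v, (exists i, tnth o i = inr v) <-> free_vertex D G v
    & forall (i j : 'I_n) u v, i != j ->
        representative (tnth o i) u -> representative (tnth o j) v ->
        (i < j)%N = connect (adj G) u v].

Definition prefix_verts n (o : n.-tuple element) (i : 'I_n) : {set T} :=
  (\bigcup_(j < n | (j <= i)%N) element_verts (tnth o j))%SET.

(* e runs to the left of f, at all heights reached by both. *)
Definition left_of D e f : Prop :=
  forall y, vy D e.1 < y < vy D e.2 -> vy D f.1 < y < vy D f.2 ->
    curve D e y < curve D f y.

(* For upward planar drawings of an st-digraph the embedding is determined by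
   the left-to-right orders of the outgoing and of the incoming arcs at each
   vertex. *)
Definition same_embedding D D' G : Prop :=
  forall e f, e \in arcs G -> f \in arcs G -> e.1 = f.1 \/ e.2 = f.2 ->
    (left_of D e f <-> left_of D' e f).

(* Drawings of G + P that preserve the upward planar embedding of G given by D.
   They are upward as well: the new arcs may not be led around s or t through
   the external face, where they would never cross anything. *)
Definition preserving_drawing D G P D' : Prop :=
  [/\ upward_drawing D' (add_arcs G P), upward_planar D' G
    & same_embedding D D' G].

Definition crossing_minimal D G P D' : Prop :=
  preserving_drawing D G P D' /\
  forall D'', preserving_drawing D G P D'' ->
    (num_crossings D' (add_arcs G P) <= num_crossings D'' (add_arcs G P))%N.

Definition crossing_number D G P (k : nat) : Prop :=
  exists2 D', crossing_minimal D G P D' & num_crossings D' (add_arcs G P) = k.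

Definition crossing_optimal D G s t P : Prop :=
  acyclic_HP_completion G s t P /\
  exists2 k, crossing_number D G P k &
    forall Q m, acyclic_HP_completion G s t Q -> crossing_number D G Q m ->
      (k <= m)%N.

Definition crossing_arcs D P e : {set T * T} :=
  [set f in P | `[< crosses D e f >]]%SET.

End Drawings.

(* Main.v *)
(* An acyclic HP-completion of G is the set of consecutive non-arcs of a linear
   extension n of G. In a drawing preserving the embedding, the two sides of G
   stay leftmost and rightmost, and consecutive vertices joined by a new arc f
   lie on different sides; so f crosses at least every arc e of G whose ends lie
   strictly below and strictly above those of f. The drawing with straight
   arcs, vertices being placed in convex position at the heights given by n, has
   no other crossing. Hence the crossing number is the number of pairs (f, e)
   where e passes over f.

   Let u, R1, L2, v be consecutive blocks of n, with u and L2 on one side and R1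
   and v on the other one, such that no arc other than possibly (u, v) joins
   both sides inside them. Swapping R1 and L2 replaces three new arcs by a single
   one and does not increase the number of crossings, so an extension that is
   minimal, for the crossings and then for the number of new arcs, has no such
   pattern. Three new arcs below the same arc would give one, whence (a).

   A maximal st-polygon with source a and sink b is induced by the vertices lying
   on paths from a to b. Therefore its upper limiting arc (x, b) is bypassed by
   no longer path, which leaves (x, b) as the only arc joining both sides among
   the vertices from x to b in n. Absence of the pattern then forces the vertices
   between x and b on the side of x to precede the ones on the side of b, and
   there is at most one new arc below (x, b), directed as in (b). *)

Require Import Defs.
From mathcomp Require Import all_boot all_order all_algebra finmap.
From mathcomp Require Import all_classical all_reals all_analysis.
From mathcomp Require Import ring lra zify.
Import numFieldNormedType.Exports.
Import Order.TTheory GRing.Theory Num.Theory.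

Set Implicit Arguments.
Unset Strict Implicit.
Unset Printing Implicit Defensive.

(** The heights of [D] follow some linear extensions only, whereas the optimal order [n] may be any
    of them, so planarity of [D] has to be restated without its heights. This is possible because
    two vertices on one side of G are comparable in G: every monotone numbering orders each side
    alike. Hence two arcs that, as read off such a numbering, start in one left-to-right order and
    end in the other must already cross in [D] ([no_interleaving]). This comparison underlies the
    planarity and the embedding of the straight drawing, and it excludes arcs joining both sides
    strictly under another arc, which is what makes the exchange of blocks legal. For (b), a maximal
    polygon is known only through its drawing, and its maximality becomes usable once the interval
    between its source and sink is itself shown to be an st-polygon of G. That the tail of the
    crossing edge lies in no earlier polygon is then a cut argument: such a polygon would have both
    ends of the upper limiting arc as inner vertices on opposite sides. *)

Section Paths.
Variable T : finType.
Implicit Types (e : rel T) (p : seq T) (f : T * T).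

Lemma path_arcs_cons x y p : path_arcs x (y :: p) = (x, y) :: path_arcs y p.
Proof. by []. Qed.

Lemma path_arcs_adj e x p f : path e x p -> f \in path_arcs x p -> e f.1 f.2.
Proof.
elim: p x => [|y p IH] x //= /andP[exy pth].
by rewrite path_arcs_cons inE => /orP[/eqP->|/IH]//; apply.
Qed.

Lemma path_arcs_mem x p f : f \in path_arcs x p -> f.1 \in x :: p /\ f.2 \in p.
Proof.
elim: p x => [|y p IH] x //; rewrite path_arcs_cons inE => /orP[/eqP->/=|/IH[h1 h2]].
  by rewrite !mem_head.
by rewrite in_cons h1 orbT in_cons h2 orbT.
Qed.

Lemma path_arcs_pred x p v : v \in p -> exists u, (u, v) \in path_arcs x p.
Proof.
elim: p x => [|y p IH] x //; rewrite path_arcs_cons inE => /orP[/eqP->|/(IH y)[u hu]].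
  by exists x; rewrite mem_head.
by exists u; rewrite inE hu orbT.
Qed.

Lemma path_arcs_succ x p u : u \in x :: p -> u != last x p ->
  exists v, (u, v) \in path_arcs x p.
Proof.
elim: p x => [|y p IH] x /=; first by rewrite inE => /eqP->; rewrite eqxx.
rewrite in_cons path_arcs_cons => /orP[/eqP->|up] ul; first by exists y; rewrite mem_head.
by have [v hv] := IH y up ul; exists v; rewrite inE hv orbT.
Qed.

Lemma path_arcs_cmp e x p f w : path e x p -> f \in path_arcs x p ->
  w \in x :: p -> connect e w f.1 \/ connect e f.2 w.
Proof.
elim: p x => [|y p IH] x //= /andP[exy pth].
rewrite path_arcs_cons inE in_cons => /orP[/eqP->/=|fp] /orP[/eqP->|wp].
- by left; rewrite connect0.
- by right; exact: (path_connect pth).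
- left; apply: connect_trans (connect1 exy) _.
  by apply: (path_connect pth); have [] := path_arcs_mem fp.
- exact: IH pth fp wp.
Qed.

Lemma path_total e x p u v : path e x p -> u \in x :: p -> v \in x :: p ->
  connect e u v \/ connect e v u.
Proof.
elim: p x => [|y p IH] x /=.
  by move=> _; rewrite !inE => /eqP-> /eqP->; left; rewrite connect0.
move=> /andP[exy pth]; rewrite ![in X in X -> _](in_cons x).
have hx w : w \in y :: p -> connect e x w.
  by move=> /(path_connect pth); apply: connect_trans (connect1 exy).
move=> /orP[/eqP->|hu]; first by move=> /orP[/eqP->|/hx]; left; rewrite ?connect0.
by move=> /orP[/eqP->|hv]; [right; exact: hx|exact: IH pth hu hv].
Qed.

Lemma path_last_connect e x p u : path e x p -> u \in x :: p ->
  connect e u (last x p).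
Proof.
elim: p x => [|y p IH] x /=; first by rewrite inE => _ /eqP->.
move=> /andP[exy pth]; rewrite in_cons => /orP[/eqP->|]; last exact: IH.
by apply: connect_trans (connect1 exy) _; apply: (path_connect pth); exact: mem_last.
Qed.

Lemma connect_lt e d (O : porderType d) (h : T -> O) u v :
  (forall x y, e x y -> (h x < h y)%O) -> connect e u v -> u = v \/ (h u < h v)%O.
Proof.
move=> eh /connectP[p pth ->] {v}.
elim: p u pth => [|y p IH] u /=; first by left.
move=> /andP[/eh huy /IH[<-|]]; first by right.
by move=> hy; right; exact: lt_trans hy.
Qed.

Lemma connect_last e u v : connect e u v -> u != v ->
  exists2 w, connect e u w & e w v.
Proof.
move=> /connectP[p]; case/lastP: p => [|p w] /=; first by move=> _ ->; rewrite eqxx.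
rewrite rcons_path last_rcons => /andP[pth ew] -> _; exists (last u p) => //.
by apply/connectP; exists p.
Qed.

Lemma connect_first e u v : connect e u v -> u != v ->
  exists2 w, e u w & connect e w v.
Proof.
move=> /connectP[[|w p]] /=; first by move=> _ ->; rewrite eqxx.
move=> /andP[ew pth] -> _; exists w => //.
by apply/connectP; exists p.
Qed.

End Paths.

(** * Upward drawings *)

Section Geometry.
Variables (R : realType) (T : finType).
Implicit Types (D : drawing R T) (G H : digraph T) (e f g : T * T).
Implicit Types (s t u v w : T) (p : seq T) (y : R) (z : R * R).
Local Open Scope classical_set_scope.
Local Open Scope ring_scope.

Definition arc_span D e y := vy D e.1 <= y <= vy D e.2.

Lemma arc_increasing D H u v : upward_drawing D H -> adj H u v -> vy D u < vy D v.
Proof. by case=> _ + _ _ uv => /(_ _ _ uv)[]. Qed.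

Lemma curve_start D H e : upward_drawing D H -> e \in arcs H ->
  curve D e (vy D e.1) = vx D e.1.
Proof. by case: e => u v [_ + _ _] uv => /(_ _ _ uv)[]. Qed.

Lemma curve_end D H e : upward_drawing D H -> e \in arcs H ->
  curve D e (vy D e.2) = vx D e.2.
Proof. by case: e => u v [_ + _ _] uv => /(_ _ _ uv)[]. Qed.

Lemma span_start D H e : upward_drawing D H -> e \in arcs H -> arc_span D e (vy D e.1).
Proof.
by case: e => u v ud uv; rewrite /arc_span lexx /=; exact/ltW/(arc_increasing ud uv).
Qed.

Lemma span_end D H e : upward_drawing D H -> e \in arcs H -> arc_span D e (vy D e.2).
Proof.
by case: e => u v ud uv; rewrite /arc_span lexx andbT; exact/ltW/(arc_increasing ud uv).
Qed.

(** The intermediate value theorem for the difference of the curves; strict signs at both ends keep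
    [c] in the interior of both arcs. Only upwardness is assumed, so this also finds crossings with
    new arcs. *)
Lemma meet_between D H e f y y' : upward_drawing D H ->
  e \in arcs H -> f \in arcs H ->
  arc_span D e y -> arc_span D f y -> arc_span D e y' -> arc_span D f y' ->
  curve D e y < curve D f y -> curve D f y' < curve D e y' ->
  exists2 c, Num.min y y' < c < Num.max y y' & meet_at D e f c.
Proof.
move=> ud eH fH ey fy ey' fy' lt1 lt2.
have main a b : a <= b -> arc_span D e a -> arc_span D f a -> arc_span D e b -> arc_span D f b ->
    (curve D e a - curve D f a) * (curve D e b - curve D f b) < 0 ->
    exists2 c, a < c < b & meet_at D e f c.
  move=> ab ea fa eb fb prod.
  have cts g : g \in arcs H -> arc_span D g a -> arc_span D g b ->
      {within `[a, b], continuous (curve D g)}.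
    case: g => u v gH /andP[/= h1 h2] /andP[/= h3 h4].
    case: ud => _ + _ _ => /(_ _ _ gH)[_ + _ _]; apply: continuous_subspaceW.
    by apply: subset_itv; rewrite bnd_simp.
  have ctd : {within `[a, b], continuous (fun y => curve D e y - curve D f y)}.
    by move=> x; apply: cvgB; [exact: (cts e)|exact: (cts f)].
  have [|c] := @IVT R (fun y => curve D e y - curve D f y) a b 0 ab ctd.
    rewrite ge_min le_max; case: (ltgtP (curve D e a - curve D f a) 0) prod => [h|h|->] /=.
    - by rewrite nmulr_rlt0// => /ltW.
    - by rewrite pmulr_rlt0// => /ltW ->; rewrite ?orbT.
    - by rewrite mul0r ltxx.
  rewrite in_itv /= => /andP[ac cb] /eqP; rewrite subr_eq0 => /eqP efc.
  have ca : a < c.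
    rewrite lt_neqAle ac andbT; apply/eqP => ac'; move: prod.
    by rewrite ac' efc subrr mul0r ltxx.
  have cb' : c < b.
    rewrite lt_neqAle cb andbT; apply/eqP => ac'; move: prod.
    by rewrite -ac' efc subrr mulr0 ltxx.
  exists c; first by rewrite ca.
  move: ea fa eb fb => /andP[ea _] /andP[fa _] /andP[_ eb] /andP[_ fb].
  by split=> //; rewrite (le_lt_trans _ ca)// (lt_le_trans cb').
case: (leP y y') => yy'.
- by apply: main => //; rewrite nmulr_rlt0 ?subr_lt0 ?subr_gt0.
- by apply: main => //; rewrite ?(ltW yy')// pmulr_rlt0 ?subr_lt0 ?subr_gt0.
Qed.

(** A strict change of sign would produce a crossing. The conclusion is weak because the arcs may
    share an end at height [y']. *)
Lemma planar_sign D G e f y y' : upward_planar D G ->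
  e \in arcs G -> f \in arcs G ->
  arc_span D e y -> arc_span D f y -> arc_span D e y' -> arc_span D f y' ->
  curve D e y < curve D f y -> curve D e y' <= curve D f y'.
Proof.
move=> [ud pl] eG fG ey fy ey' fy' lt; rewrite leNgt; apply/negP => lt'.
have [c _ mc] := meet_between ud eG fG ey fy ey' fy' lt lt'.
apply: (pl e f) => //; last by exists c.
by apply/eqP => ef; move: lt; rewrite ef ltxx.
Qed.

Lemma off_arc D H e w : upward_drawing D H -> e \in arcs H -> w \in verts H ->
  vy D e.1 < vy D w < vy D e.2 -> curve D e (vy D w) != vx D w.
Proof. by case=> _ _ + _; apply. Qed.

Lemma vertex_neq D H v w : upward_drawing D H -> v \in verts H -> w \in verts H ->
  v != w -> vy D v = vy D w -> vx D v != vx D w.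
Proof.
move=> [inj _ _ _] vH wH vw yy; apply: contra vw => /eqP xx.
by apply/eqP/inj => //=; rewrite xx yy.
Qed.

(** Reflection in the vertical axis: each fact about one side yields the one about the other
    side. *)
Definition mirror D : drawing R T :=
  Drawing (fun v => - vx D v) (vy D) (fun e y => - curve D e y).

Lemma mirrorK D : mirror (mirror D) = D.
Proof.
case: D => X Y C; rewrite /mirror /=; f_equal; apply: funext => v.
  by rewrite opprK.
by apply: funext => y; rewrite opprK.
Qed.

Lemma meet_mirror D e f y : meet_at (mirror D) e f y <-> meet_at D e f y.
Proof. by split=> -[? ? h]; split=> //=; [move/oppr_inj: h|rewrite h]. Qed.

Lemma crossings_mirror D H : crossings (mirror D) H = crossings D H.
Proof.
apply/seteqP; split=> c [e [f [eH fH ef c1 m]]]; exists e, f; split=> //;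
  exact/(meet_mirror D).
Qed.

Lemma upward_mirror D H : upward_drawing D H -> upward_drawing (mirror D) H.
Proof.
move=> [inj arcsP off fin]; split.
- by move=> u v uH vH /= [/oppr_inj ? ?]; apply: inj => //; congr pair.
- move=> u v uv; have [h1 h2 h3 h4] := arcsP _ _ uv; split=> //=; rewrite ?h3 ?h4//.
  by move=> x; apply: cvgN; exact: h2.
- by move=> e w eH wH /= h; rewrite eqr_opp; exact: off.
- by rewrite crossings_mirror.
Qed.

Lemma planar_mirror D H : upward_planar D H -> upward_planar (mirror D) H.
Proof.
move=> [/upward_mirror ud pl]; split=> // e f eH fH ef [y /(meet_mirror D) m].
by apply: (pl e f) => //; exists y.
Qed.

Definition flipx z : R * R := (- z.1, z.2).

Lemma drawn_mirror D H z : drawn_points (mirror D) H z <-> drawn_points D H (flipx z).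
Proof.
have E (x x' : R) : x = - x' <-> - x = x' by split=> [->|<-]; rewrite opprK.
case: z => x y; rewrite /drawn_points /flipx /vertex_point /arc_points /=.
split=> -[[v vH]|[e eH]].
- by move=> [-> ->]; left; exists v => //; rewrite opprK.
- by move=> [? /= ->]; right; exists e => //; rewrite opprK.
- by move=> [/E -> ->]; left; exists v.
- by move=> [? /= /E->]; right; exists e.
Qed.

Lemma right_of_mirror D s p z : right_of_path (mirror D) s p z <->
  left_of_path D s p (flipx z).
Proof. by split=> h e ep /(h e ep) /=; rewrite lerNl. Qed.

Lemma left_of_mirror D s p z : left_of_path (mirror D) s p z <->
  right_of_path D s p (flipx z).
Proof. by split=> h e ep /(h e ep) /=; rewrite lerNr. Qed.

Lemma flipxK z : flipx (flipx z) = z.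
Proof. by case: z => x y; rewrite /flipx /= opprK. Qed.

Lemma left_side_mirror D H s t p : left_side (mirror D) H s t p <-> right_side D H s t p.
Proof.
split=> -[dp h]; split=> // z dz.
  by rewrite -[z]flipxK; apply/right_of_mirror/h/drawn_mirror; rewrite flipxK.
by apply/right_of_mirror/h/drawn_mirror.
Qed.

Lemma right_side_mirror D H s t p : right_side (mirror D) H s t p <-> left_side D H s t p.
Proof. by rewrite -[D in left_side D](mirrorK D) left_side_mirror. Qed.

Lemma outerplanar_mirror D H s t pl pr :
  outerplanar_st D H s t pl pr -> outerplanar_st (mirror D) H s t pr pl.
Proof.
move=> [st up ls rs cov]; split=> //.
- exact: planar_mirror.
- exact/left_side_mirror.
- exact/right_side_mirror.
- by move=> v /cov; rewrite orbC.
Qed.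

Lemma st_polygon_mirror D H s t pl pr :
  st_polygon D H s t pl pr -> st_polygon (mirror D) H s t pr pl.
Proof.
move=> [op cl cr dis noe]; split=> //.
- exact: outerplanar_mirror.
- by rewrite disjoint_sym.
- by move=> u v ul vr; rewrite andbC; exact: noe.
Qed.

Lemma left_of_mirror_arcs D e f : left_of (mirror D) e f <-> left_of D f e.
Proof. by split=> h y y1 y2; have := h y y2 y1; rewrite /= ltrN2. Qed.

Lemma same_embedding_mirror D D' G :
  same_embedding D D' G -> same_embedding (mirror D) (mirror D') G.
Proof.
move=> emb e f eG fG ef; rewrite !left_of_mirror_arcs; apply: emb => //.
by case: ef => ->; [left|right].
Qed.

Definition leftmost D G v := forall z, drawn_points D G z -> z.2 = vy D v ->
  vx D v <= z.1.
Definition rightmost D G v := forall z, drawn_points D G z -> z.2 = vy D v ->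
  z.1 <= vx D v.

Lemma leftmost_mirror D G v : leftmost (mirror D) G v <-> rightmost D G v.
Proof.
split=> h z dz zv.
  rewrite -lerN2; have := h (flipx z); apply=> //.
  by apply/drawn_mirror; rewrite flipxK.
by rewrite /= lerNl; apply: (h (flipx z)) => //; exact/drawn_mirror.
Qed.

Lemma rightmost_mirror D G v : rightmost (mirror D) G v <-> leftmost D G v.
Proof. by rewrite -[D in leftmost D](mirrorK D) leftmost_mirror. Qed.

Lemma leftmost_span D G v e : leftmost D G v -> e \in arcs G -> arc_span D e (vy D v) ->
  vx D v <= curve D e (vy D v).
Proof.
by move=> lv eG ev; apply: (lv (curve D e (vy D v), vy D v)) => //; right; exists e.
Qed.

Lemma leftmost_lt D G v e : upward_drawing D G -> v \in verts G ->
  leftmost D G v -> e \in arcs G ->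
  vy D e.1 < vy D v < vy D e.2 -> vx D v < curve D e (vy D v).
Proof.
move=> ud vG lv eG h; rewrite lt_neqAle eq_sym (off_arc ud)//=.
by apply: leftmost_span lv eG _; move: h => /andP[/ltW h1 /ltW h2]; rewrite /arc_span h1.
Qed.

Lemma leftmost_vertex D G v w : upward_drawing D G -> v \in verts G -> w \in verts G ->
  leftmost D G v -> v != w -> vy D v = vy D w -> vx D v < vx D w.
Proof.
move=> ud vG wG lv vw yy; rewrite lt_neqAle (vertex_neq ud)//=.
by apply: (lv (vertex_point D w)) => //; left; exists w.
Qed.

Lemma rightmost_span D G v e : rightmost D G v -> e \in arcs G -> arc_span D e (vy D v) ->
  curve D e (vy D v) <= vx D v.
Proof.
move=> /leftmost_mirror lv eG ev; rewrite -lerN2.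
exact: (leftmost_span lv eG ev).
Qed.

Lemma rightmost_lt D G v e : upward_drawing D G -> v \in verts G ->
  rightmost D G v -> e \in arcs G ->
  vy D e.1 < vy D v < vy D e.2 -> curve D e (vy D v) < vx D v.
Proof.
move=> /upward_mirror ud vG /leftmost_mirror lv eG h; rewrite -ltrN2.
exact: (leftmost_lt ud vG lv eG h).
Qed.

Lemma connect_vy D G u v : upward_drawing D G -> connect (adj G) u v ->
  u = v \/ vy D u < vy D v.
Proof. by move=> ud; apply: connect_lt => x y; exact: arc_increasing. Qed.

Lemma connect_vy_le D G u v : upward_drawing D G -> connect (adj G) u v ->
  vy D u <= vy D v.
Proof. by move=> ud /(connect_vy ud)[->|/ltW]. Qed.

Lemma source_connect D H s t v : upward_drawing D H -> st_digraph H s t ->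
  v \in verts H -> connect (adj H) s v.
Proof.
move=> ud [ends _ src _].
have [n] := ubnP #|[set u | vy D u < vy D v]|%SET.
elim: n v => // n IH v; rewrite ltnS => le vH.
have [->|vs] := eqVneq v s; first exact: connect0.
have [u uv] : exists u, adj H u v.
  apply/existsP; rewrite -[X in is_true X]negbK negb_exists; apply/negP => /forallP h.
  by move/eqP: vs; apply; apply/src; split.
apply: connect_trans (connect1 uv); apply: IH; last by have /andP[] := ends _ uv.
apply: leq_trans le; apply: proper_card; apply/properP; split.
  apply/fintype.subsetP => w; rewrite !inE => /lt_trans; apply.
  exact: arc_increasing uv.
by exists u; rewrite inE ?ltxx//; exact: arc_increasing uv.
Qed.

Lemma sink_connect D H s t v : upward_drawing D H -> st_digraph H s t ->
  v \in verts H -> connect (adj H) v t.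
Proof.
move=> ud [ends _ _ snk].
have [n] := ubnP #|[set u | vy D v < vy D u]|%SET.
elim: n v => // n IH v; rewrite ltnS => le vH.
have [->|vt] := eqVneq v t; first exact: connect0.
have [u vu] : exists u, adj H v u.
  apply/existsP; rewrite -[X in is_true X]negbK negb_exists; apply/negP => /forallP h.
  by move/eqP: vt; apply; apply/snk; split.
apply: connect_trans (connect1 vu) _; apply: IH; last by have /andP[] := ends _ vu.
apply: leq_trans le; apply: proper_card; apply/properP; split.
  apply/fintype.subsetP => w; rewrite !inE; apply: lt_trans.
  exact: arc_increasing vu.
by exists u; rewrite inE ?ltxx//; exact: arc_increasing vu.
Qed.

(** Every other vertex is reachable from [s], hence strictly higher, so only [s] and the lower ends
    of arcs leaving it are drawn at its height. *)
Lemma leftmost_source D G s t : upward_drawing D G -> st_digraph G s t ->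
  leftmost D G s.
Proof.
move=> ud st; have [ends _ _ _] := st.
have low w : w \in verts G -> vy D w <= vy D s -> w = s.
  move=> wG; rewrite leNgt => h.
  by have [->//|h'] := connect_vy ud (source_connect ud st wG); rewrite h' in h.
move=> z [[v vG ->]|[e eG [h zc]]] /= zs; first by rewrite (low v)// zs.
have e1 : e.1 = s.
  have /andP[? _] := ends _ eG; apply: low => //.
  by rewrite -zs; case/andP: h.
by rewrite zc zs -e1 (curve_start ud).
Qed.

Lemma path_arcs_arcs G s p f : path (adj G) s p -> f \in path_arcs s p -> f \in arcs G.
Proof. by case: f => u v pth /(path_arcs_adj pth). Qed.

Lemma outerplanar_leftmost D G s t pl pr v : outerplanar_st D G s t pl pr ->
  v \in s :: pl -> leftmost D G v.
Proof.
move=> [st [ud pln] [[pth _] ls] _ _]; rewrite in_cons => /orP[/eqP->|].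
  exact: leftmost_source st.
move=> /(path_arcs_pred s)[u uv] z dz zv.
have uvG : (u, v) \in arcs G by exact: (path_arcs_arcs pth).
have := ls z dz _ uv; rewrite zv (curve_end ud uvG); apply.
exact: (span_end ud uvG).
Qed.

Lemma outerplanar_rightmost D G s t pl pr v : outerplanar_st D G s t pl pr ->
  v \in s :: pr -> rightmost D G v.
Proof.
by move=> /outerplanar_mirror op vr; apply/leftmost_mirror/(outerplanar_leftmost op).
Qed.

Lemma path_span D G s p y : upward_drawing D G -> path (adj G) s p ->
  vy D s <= y <= vy D (last s p) -> p != [::] ->
  exists2 g, g \in path_arcs s p & arc_span D g y.
Proof.
move=> ud; elim: p s => [|x p IH] s //= /andP[sx pth] /andP[sy yt] _.
have [yx|xy] := leP y (vy D x).
  by exists (s, x); rewrite ?mem_head// /arc_span sy.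
case: p IH pth yt => [|x' p] IH pth yt; first by move: yt; rewrite leNgt xy.
have [||g gp gy] := IH x pth; rewrite ?(ltW xy) ?yt//.
by exists g => //; rewrite path_arcs_cons inE gp orbT.
Qed.

End Geometry.

(** * Drawings with prescribed sides *)

Section TwoSided.
Variables (R : realType) (T : finType).
Implicit Types (D : drawing R T) (G : digraph T) (e f : T * T).
Implicit Types (u v w : T) (A B : seq T) (h : T -> nat).
Local Open Scope ring_scope.

Definition chain G A := {in A &, forall u v, connect (adj G) u v \/ connect (adj G) v u}.

(** What remains of an outerplanar drawing once the side paths are forgotten. It is symmetric under
    reflection and passes to every drawing with the same embedding. *)
Record two_sided D G A B : Prop := TwoSided {
  ts_planar : upward_planar D G;
  ts_ends : forall e, e \in arcs G -> (e.1 \in verts G) && (e.2 \in verts G);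
  ts_cover : forall v, v \in verts G -> (v \in A) || (v \in B);
  ts_left : {in A, forall v, leftmost D G v};
  ts_right : {in B, forall v, rightmost D G v};
  ts_chainl : chain G A;
  ts_chainr : chain G B }.

Definition increasing G h := forall u v, adj G u v -> (h u < h v)%N.

Lemma two_sided_mirror D G A B : two_sided D G A B -> two_sided (mirror D) G B A.
Proof.
case=> pl ends cov lA rB cA cB; split=> //.
- exact: planar_mirror.
- by move=> v /cov; rewrite orbC.
- by move=> v vB; apply: (proj2 (leftmost_mirror D G v)); exact: rB.
- by move=> v vA; apply: (proj2 (rightmost_mirror D G v)); exact: lA.
Qed.

Lemma increasing_connect G h u v : increasing G h -> connect (adj G) u v ->
  u = v \/ (h u < h v)%N.
Proof.
by move=> inc; apply: (@connect_lt _ _ _ nat) => x y /inc; rewrite ltEnat.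
Qed.

(** On a chain both [vy D] and [h] follow reachability and cannot disagree; between vertices on
    different sides they are unrelated. *)
Lemma chain_increasing D G A h u v : upward_drawing D G -> chain G A ->
  increasing G h -> u \in A -> v \in A -> vy D u <= vy D v -> (h u <= h v)%N.
Proof.
move=> ud cA inc uA vA; case: (cA u v uA vA) => c.
  by case: (increasing_connect inc c) => [->//|/ltnW].
case: (connect_vy ud c) => [->//|]; by rewrite ltNge => /negbTE->.
Qed.

(* Which arc starts, respectively ends, to the left of the other one depends
   only on the sides of the ends and not on the relative heights of vertices on
   different sides; this allows h to be any monotone height. *)
Definition starts_left A B h f e : bool :=
  (f.1 \in A) && (h e.1 < h f.1)%N || (e.1 \in B) && (h f.1 < h e.1)%N.
Definition ends_left A B h f e : bool :=
  (f.2 \in A) && (h f.2 < h e.2)%N || (e.2 \in B) && (h e.2 < h f.2)%N.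

Lemma starts_leftP D G A B h e f : two_sided D G A B -> increasing G h ->
  e \in arcs G -> f \in arcs G -> vy D e.1 < vy D f.2 -> vy D f.1 < vy D e.2 ->
  starts_left A B h f e ->
  exists2 y, arc_span D e y /\ arc_span D f y & curve D f y < curve D e y.
Proof.
suff main D' A' B' e' f' : two_sided D' G A' B' -> increasing G h ->
    e' \in arcs G -> f' \in arcs G -> vy D' e'.1 < vy D' f'.2 ->
    vy D' f'.1 < vy D' e'.2 -> (f'.1 \in A') && (h e'.1 < h f'.1)%N ->
    exists2 y, arc_span D' e' y /\ arc_span D' f' y & curve D' f' y < curve D' e' y.
  move=> ts inc eG fG ef fe /orP[]; first exact: main ts inc eG fG ef fe.
  move=> sl; have [y [fy ey] c] := main _ _ _ f e (two_sided_mirror ts) inc fG eG fe ef sl.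
  by exists y; last by move: c; rewrite /= ltrN2.
case=> -[ud _] ends cov lA rB cA cB inc eG fG ef fe /andP[fA hef].
have /andP[e1 e2] := ends _ eG; have /andP[f1 f2] := ends _ fG.
have [le|lt] := leP (vy D' e'.1) (vy D' f'.1).
  exists (vy D' f'.1); first by rewrite (span_start ud)// /arc_span le ltW.
  rewrite (curve_start ud)//.
  move: le; rewrite le_eqVlt => /predU1P[eq|lt]; last first.
    by apply: (leftmost_lt ud) => //; [exact: lA|rewrite lt].
  rewrite -eq (curve_start ud)//; apply: (leftmost_vertex ud) => //; first exact: lA.
  by apply: contraTneq hef => ->; rewrite ltnn.
(* Here [D'] and [h] order the two tails oppositely, so they are not both in [A']: the tail of [e']
   is on the right side and can be compared at its own height. *)
exists (vy D' e'.1); first by rewrite (span_start ud)// /arc_span !ltW.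
rewrite (curve_start ud)//; apply: (rightmost_lt ud) => //; last by rewrite lt.
apply: rB; have /orP[eA|//] := cov _ e1.
have := chain_increasing ud cA inc fA eA (ltW lt).
by rewrite leqNgt hef.
Qed.

Lemma ends_leftP D G A B h e f : two_sided D G A B -> increasing G h ->
  e \in arcs G -> f \in arcs G -> vy D e.1 < vy D f.2 -> vy D f.1 < vy D e.2 ->
  ends_left A B h f e ->
  exists2 y, arc_span D e y /\ arc_span D f y & curve D f y < curve D e y.
Proof.
suff main D' A' B' e' f' : two_sided D' G A' B' -> increasing G h ->
    e' \in arcs G -> f' \in arcs G -> vy D' e'.1 < vy D' f'.2 ->
    vy D' f'.1 < vy D' e'.2 -> (f'.2 \in A') && (h f'.2 < h e'.2)%N ->
    exists2 y, arc_span D' e' y /\ arc_span D' f' y & curve D' f' y < curve D' e' y.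
  move=> ts inc eG fG ef fe /orP[]; first exact: main ts inc eG fG ef fe.
  move=> sl; have [y [fy ey] c] := main _ _ _ f e (two_sided_mirror ts) inc fG eG fe ef sl.
  by exists y; last by move: c; rewrite /= ltrN2.
case=> -[ud _] ends cov lA rB cA cB inc eG fG ef fe /andP[fA hef].
have /andP[e1 e2] := ends _ eG; have /andP[f1 f2] := ends _ fG.
have [le|lt] := leP (vy D' f'.2) (vy D' e'.2).
  exists (vy D' f'.2); first by rewrite (span_end ud)// /arc_span le ltW.
  rewrite (curve_end ud)//.
  move: le; rewrite le_eqVlt => /predU1P[eq|lt]; last first.
    by apply: (leftmost_lt ud) => //; [exact: lA|rewrite lt andbT].
  rewrite eq (curve_end ud)//; apply: (leftmost_vertex ud) => //; first exact: lA.
  by apply: contraTneq hef => ->; rewrite ltnn.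
exists (vy D' e'.2); first by rewrite (span_end ud)// /arc_span !ltW.
rewrite (curve_end ud)//; apply: (rightmost_lt ud) => //; last by rewrite lt andbT.
apply: rB; have /orP[eA|//] := cov _ e2.
have := chain_increasing ud cA inc eA fA (ltW lt).
by rewrite leqNgt hef.
Qed.

(** If [f] starts to the left of [e] and [e] ends to the left of [f], the two inequalities hold at
    actual heights of [D] as well and contradict [planar_sign]. *)
Lemma no_interleaving D G A B h e f : two_sided D G A B -> increasing G h ->
  e \in arcs G -> f \in arcs G -> (h e.1 < h f.2)%N -> (h f.1 < h e.2)%N ->
  starts_left A B h f e -> ends_left A B h e f -> False.
Proof.
move=> ts inc eG fG ef fe sl el.
have [[ud pl] ends cov lA rB cA cB] := ts.
have [ye yf] : vy D e.1 < vy D e.2 /\ vy D f.1 < vy D f.2.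
  by case: e f eG fG {ef fe sl el} => ? ? [? ?]; split; exact: arc_increasing ud _.
have /andP[e1 e2] := ends _ eG; have /andP[f1 f2] := ends _ fG.
have chA := chain_increasing ud cA inc; have chB := chain_increasing ud cB inc.
(* The arcs overlap in [h] but might have disjoint height ranges in [D]; this case and its symmetric
   one contradict the common order of [h] and [vy D] on each side. *)
have [lt1|fe'] := ltP (vy D e.1) (vy D f.2); last first.
  have eB : e.1 \in B.
    have /orP[eA|//] := cov _ e1; case/orP: sl => /andP[// fA' lt].
    by have := chA _ _ fA' eA (ltW (lt_le_trans yf fe')); rewrite leqNgt lt.
  have fB : f.2 \notin B.
    by apply/negP => fB; have := chB _ _ fB eB fe'; rewrite leqNgt ef.
  have fA : f.2 \in A by have := cov _ f2; rewrite (negbTE fB) orbF.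
  case/orP: el => /andP[]; last by rewrite (negbTE fB).
  move=> eA lt; have := chA _ _ fA eA (le_trans fe' (ltW ye)).
  by rewrite leqNgt lt.
have [lt2|ef'] := ltP (vy D f.1) (vy D e.2); last first.
  have fA : f.1 \in A.
    have /orP[//|fB] := cov _ f1; case/orP: sl => /andP[// eB lt].
    by have := chB _ _ eB fB (ltW (lt_le_trans ye ef')); rewrite leqNgt lt.
  have eA : e.2 \notin A.
    by apply/negP => eA; have := chA _ _ eA fA ef'; rewrite leqNgt fe.
  have eB : e.2 \in B by have := cov _ e2; rewrite (negbTE eA).
  case/orP: el => /andP[]; first by rewrite (negbTE eA).
  move=> fB lt; have := chB _ _ eB fB (le_trans ef' (ltW yf)).
  by rewrite leqNgt lt.
have [y [ey fy] c] := starts_leftP ts inc eG fG lt1 lt2 sl.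
have [y' [fy' ey'] c'] := ends_leftP ts inc fG eG lt2 lt1 el.
have := planar_sign (conj ud pl) eG fG ey' fy' ey fy c'.
by rewrite leNgt c.
Qed.

End TwoSided.

(** * Sides of the digraph in drawings with the same embedding *)

Lemma path_arcs_after (T : finType) (e : rel T) x (p : seq T) (g : T * T) :
  path e x p -> g \in path_arcs x p ->
  exists2 q, path e g.2 q & forall f, f \in path_arcs x p ->
    [\/ f = g, connect e f.2 g.1 | f \in path_arcs g.2 q].
Proof.
elim: p x => [|y p IH] x //= /andP[exy pth]; rewrite path_arcs_cons inE.
case/orP => [/eqP->/=|gp].
  by exists p => // f; rewrite inE => /orP[/eqP->|]; [constructor 1|constructor 3].
have [q qth qP] := IH y pth gp; exists q => // f; rewrite inE => /orP[/eqP->/=|/qP//].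
by constructor 2; apply: (path_connect pth); have [] := path_arcs_mem gp.
Qed.

Section Preserving.
Variables (R : realType) (T : finType).
Implicit Types (D : drawing R T) (G : digraph T) (e f : T * T).
Implicit Types (s t u v w : T) (p pl pr : seq T).
Local Open Scope ring_scope.

Lemma outerplanar_two_sided D G s t pl pr : outerplanar_st D G s t pl pr ->
  two_sided D G (s :: pl) (s :: pr).
Proof.
move=> op; have [[ends _ _ _] up [[pthl _] _] [[pthr _] _] cov] := op; split=> //.
- by move=> v; exact: outerplanar_leftmost op.
- by move=> v; exact: outerplanar_rightmost op.
- by move=> u v; exact: path_total.
- by move=> u v; exact: path_total.
Qed.

(** Induction along the path: a vertex of the path weakly left of [f] can touch [f] only where [f]
    ends, since no vertex lies inside an arc and the second assumption on [curve] excludes contact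
    at the lower end. Otherwise the sign is strict and carries over to the next vertex. *)
Lemma path_stays_left D G f x p g y : upward_planar D G -> f \in arcs G ->
  path (adj G) x p -> x \in verts G -> {subset p <= verts G} ->
  vy D f.1 <= vy D x ->
  (vy D f.1 = vy D x -> vx D x < curve D f (vy D x)) ->
  (vy D x <= vy D f.2 -> vx D x <= curve D f (vy D x)) ->
  g \in path_arcs x p -> arc_span D g y -> arc_span D f y ->
  curve D g y <= curve D f y.
Proof.
move=> [ud pl] fG; elim: p x y => // x' p IH x y /= /andP[xx' pth] xG pG fx strict weak.
have x'G : x' \in verts G by apply: pG; rewrite mem_head.
have first z : arc_span D (x, x') z -> arc_span D f z ->
    curve D (x, x') z <= curve D f z.
  move=> gz fz; have xf : vy D x <= vy D f.2.
    by move: gz fz => /andP[/= + _] /andP[_]; exact: le_trans.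
  have := weak xf; rewrite le_eqVlt => /predU1P[eq|lt]; last first.
    apply: (planar_sign (conj ud pl) xx' fG _ _ gz fz (_ : _ < curve D f (vy D x))).
    - exact: (span_start ud xx').
    - by rewrite /arc_span fx.
    - by rewrite (curve_start ud xx').
  have zx : z = vy D x.
    apply/eqP; move: gz => /andP[/= xz _]; rewrite eq_le xz andbT leNgt.
    apply/negP => xz'.
    have xf2 : vy D x < vy D f.2 by apply: lt_le_trans xz' _; case/andP: fz.
    move: fx; rewrite le_eqVlt => /predU1P[/strict|fx]; first by rewrite eq ltxx.
    by have := off_arc ud fG xG; rewrite fx xf2 -eq eqxx => /(_ isT).
  by rewrite zx (curve_start ud xx') /= eq.
rewrite path_arcs_cons inE => /orP[/eqP->|gp]; first exact: first.
have xx'y : vy D x < vy D x' := arc_increasing ud xx'.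
have fx' : vy D f.1 < vy D x' by exact: le_lt_trans xx'y.
apply: (IH x') => //.
- by move=> w wp; apply: pG; rewrite in_cons wp orbT.
- exact: ltW.
- by move=> eq; rewrite eq ltxx in fx'.
- move=> le; have := first (vy D x'); rewrite (curve_end ud xx'); apply.
    exact: (span_end ud xx').
  by rewrite /arc_span ltW.
Qed.

(* The out-arcs and in-arcs of G being ordered as in D, an arc can leave the
   left side of G only to the right; going back along arcs from a vertex lying
   to the left of this side, one would end at the source. *)
Lemma left_side_preserved D D' G s t pl pr f g y : outerplanar_st D G s t pl pr ->
  upward_planar D' G -> same_embedding D D' G ->
  f \in arcs G -> g \in path_arcs s pl ->
  arc_span D' g y -> arc_span D' f y -> curve D' g y <= curve D' f y.
Proof.
move=> [st [udD plD] [[pth lst] ls] rs cov] [ud pln] emb.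
have [ends _ _ _] := st.
have gG h : h \in path_arcs s pl -> h \in arcs G by exact: path_arcs_arcs.
have sG : s \in verts G by case: st => _ _ /(_ s)[_ /(_ erefl)[]].
(* Induction on the number of vertices below the tail of [f], so that arcs entering this tail are
   already treated. *)
have [n] := ubnP #|[set u | vy D' u < vy D' f.1]|%SET.
elim: n f g y => // n IH f g y; rewrite ltnS => len fG gp gy fy.
have /andP[f1G f2G] := ends _ fG.
have fup : vy D' f.1 < vy D' f.2 by case: (f) fG => a b; exact: arc_increasing.
have plG : {subset s :: pl <= verts G}.
  move=> w; rewrite in_cons => /orP[/eqP->//|/(path_arcs_pred s)[u up]].
  by have /andP[] := ends _ (gG _ up).
(* One arc [g0] of the side at the height of the tail of [f] suffices: earlier arcs can share with
   [f] at most that height, and later ones are handled by [path_stays_left]. *)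
suff [g0 [g0p g0f cmp strict]] : exists g0, [/\ g0 \in path_arcs s pl,
    arc_span D' g0 (vy D' f.1),
    forall z, arc_span D' g0 z -> arc_span D' f z -> curve D' g0 z <= curve D' f z
    & g0.1 = f.1 \/ curve D' g0 (vy D' f.1) < vx D' f.1].
  have [q qth qP] := path_arcs_after pth g0p.
  have g0up : vy D' g0.1 < vy D' g0.2.
    by case: (g0) (gG _ g0p) => a b; exact: arc_increasing.
  case: (qP g gp) => [gg|gg|gq].
  - by rewrite gg in gy *; exact: cmp.
  - have gle := connect_vy_le ud gg.
    have [g1y yg2] := andP gy; have [f1y yf2] := andP fy; have [a b] := andP g0f.
    have e1 : vy D' g.2 = vy D' g0.1 by lra.
    have e2 : y = vy D' g.2 by lra.
    have e3 : vy D' f.1 = vy D' g0.1 by lra.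
    have := connect_vy ud gg; rewrite e1 ltxx => -[gg0|//].
    rewrite e2 (curve_end ud (gG _ gp)) gg0 -(curve_start ud (gG _ g0p)).
    by apply: cmp; rewrite -?e3 ?(span_start ud).
  - have [a b] := andP g0f.
    apply: (@path_stays_left D' G f g0.2 q g) => //.
    + by apply: plG; rewrite in_cons; have [_ ->] := path_arcs_mem g0p; rewrite orbT.
    + move=> w /(path_arcs_pred g0.2)[u /(path_arcs_arcs qth) uw].
      by have /andP[] := ends _ uw.
    + move=> eq; case: strict => [eq'|]; first by move: g0up; rewrite eq' eq ltxx.
      rewrite -{1}(curve_end ud (gG _ g0p)) -eq => /lt_le_trans; apply.
      by rewrite (curve_start ud).
    + move=> le; rewrite -(curve_end ud (gG _ g0p)); apply: cmp.
        exact: (span_end ud (gG _ g0p)).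
      by rewrite /arc_span b.
(* If the tail is on the side, the side arc leaving it is to the left of [f] in [D], hence in [D']
   because the order of out-arcs is part of the embedding. *)
have [f1p|f1p] := boolP (f.1 \in s :: pl).
  have [|u up] := path_arcs_succ f1p.
    rewrite lst; apply/eqP => f1t.
    have [_ /(_ f.2)] : is_sink G t by case: st => _ _ _ /(_ t)[_ /(_ erefl)].
    by rewrite -f1t /adj -surjective_pairing fG.
  exists (f.1, u); split=> //; last by left.
    exact: (span_start ud (gG _ up)).
  have [<-//|fu] := eqVneq f (f.1, u).
  have uup : vy D' f.1 < vy D' u by exact: (arc_increasing ud (gG _ up)).
  have lf : left_of D' (f.1, u) f.
    apply/(emb (f.1, u) f (gG _ up) fG); first by left.
    move=> z z1 z2.
    have z1' : vy D (f.1, u).1 <= z <= vy D (f.1, u).2.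
      by case/andP: z1 => *; apply/andP; split; exact: ltW.
    have z2' : vy D f.1 <= z <= vy D f.2.
      by case/andP: z2 => *; apply/andP; split; exact: ltW.
    rewrite lt_neqAle; apply/andP; split; last first.
      by apply: (ls (curve D f z, z) _ _ up z1'); right; exists f.
    apply/eqP => eq; apply: (plD (f.1, u) f) => //; first exact: gG.
      by rewrite eq_sym.
    by exists z.
  move=> z gz fz.
  pose m := Num.min (vy D' u) (vy D' f.2).
  have m1 : vy D' f.1 < m by rewrite lt_min uup.
  have [mu mf] : m <= vy D' u /\ m <= vy D' f.2 by rewrite !ge_min !lexx orbT.
  have [h1 h2] : vy D' f.1 < (vy D' f.1 + m) / 2 /\ (vy D' f.1 + m) / 2 < m by lra.
  apply: (planar_sign (conj ud pln) (gG _ up) fG _ _ gz fz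
    (lf ((vy D' f.1 + m) / 2) _ _)); rewrite /arc_span /=; apply/andP; split; lra.
have f1s : f.1 != s by apply: contraNneq f1p => ->; rewrite mem_head.
have sf : vy D' s < vy D' f.1.
  by have [/esym/eqP|//] := connect_vy ud (source_connect ud st f1G); rewrite (negbTE f1s).
have ft : vy D' f.1 <= vy D' (last s pl).
  rewrite lst; exact: connect_vy_le ud (sink_connect ud st f1G).
have pl0 : pl != [::] by apply: contraTneq gp => ->.
have range : vy D' s <= vy D' f.1 <= vy D' (last s pl) by rewrite ltW.
have [g0 g0p g0f] := path_span ud pth range pl0.
have g0up : vy D' g0.1 < vy D' g0.2.
  by case: (g0) (gG _ g0p) => a b; exact: arc_increasing.
have [m1 m2] := path_arcs_mem g0p.
have mpl : g0.2 \in s :: pl by rewrite in_cons m2 orbT.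
have ne1 : g0.1 != f.1 by apply: contraNneq f1p => <-.
have ne2 : g0.2 != f.1 by apply: contraNneq f1p => <-.
have sf1 : s != f.1 by rewrite eq_sym.
have [w sw wf] := connect_last (source_connect ud st f1G) sf1.
(* The induction hypothesis for the arc from [w] gives the weak inequality; equality would put the
   tail of [f] on [g0], but it is not on the side. *)
have lt : curve D' g0 (vy D' f.1) < vx D' f.1.
  rewrite lt_neqAle; apply/andP; split; last first.
    rewrite -(curve_end ud wf); apply: (IH (w, f.1)) => //; last exact: (span_end ud wf).
    apply: leq_trans len; apply: proper_card; apply/properP; split.
      apply/fintype.subsetP => v; rewrite !inE => /lt_trans; apply.
      exact: (arc_increasing ud wf).
    by exists w; rewrite inE /= ?ltxx//; exact: (arc_increasing ud wf).
  have [] := andP g0f; rewrite le_eqVlt => /predU1P[eq _|lt1].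
    by rewrite -eq (curve_start ud (gG _ g0p)); apply: (vertex_neq ud) => //; exact: plG.
  rewrite le_eqVlt => /predU1P[eq|lt2].
    rewrite eq (curve_end ud (gG _ g0p)) eq_sym; apply: (vertex_neq ud) => //.
      exact: plG.
    by rewrite eq_sym.
  by apply: (off_arc ud) => //; [exact: gG|rewrite lt1].
exists g0; split=> //; last by right.
move=> z gz fz; apply: (planar_sign (conj ud pln) (gG _ g0p) fG g0f _ gz fz).
  exact: (span_start ud fG).
by rewrite (curve_start ud fG).
Qed.

Lemma leftmost_preserved D D' G s t pl pr v : outerplanar_st D G s t pl pr ->
  upward_planar D' G -> same_embedding D D' G ->
  v \in s :: pl -> leftmost D' G v.
Proof.
move=> op up emb; have [st _ [[pth _] _] _ _] := op; have [ud _] := up.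
rewrite in_cons => /orP[/eqP->|]; first exact: leftmost_source st.
move=> /(path_arcs_pred s)[u uv].
have uvG : (u, v) \in arcs G by exact: (path_arcs_arcs pth).
have key e : e \in arcs G -> arc_span D' e (vy D' v) -> vx D' v <= curve D' e (vy D' v).
  move=> eG ev; rewrite -[X in X <= _](curve_end ud uvG).
  exact: (left_side_preserved op up emb eG uv (span_end ud uvG) ev).
move=> z [[w wG ->]|[e eG [ez ->]]] zv; last by rewrite zv in ez *; exact: key.
have [sw|sw] := eqVneq s w.
  have [ends _ _ _] := st; have /andP[uG _] := ends _ uvG.
  have := connect_vy_le ud (source_connect ud st uG); rewrite sw.
  by have := arc_increasing ud uvG; move: zv => /= -> lt; rewrite leNgt lt.
have [x _ xw] := connect_last (source_connect ud st wG) sw.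
rewrite /= in zv *; rewrite -[X in _ <= X](curve_end ud xw) /= zv; apply: key => //.
by rewrite -zv; exact: (span_end ud xw).
Qed.

Lemma two_sided_preserved D D' G s t pl pr : outerplanar_st D G s t pl pr ->
  upward_planar D' G -> same_embedding D D' G ->
  two_sided D' G (s :: pl) (s :: pr).
Proof.
move=> op up emb; have [_ ends cov _ _ cl cr] := outerplanar_two_sided op.
split=> //; first by move=> v; exact: leftmost_preserved op up emb.
move=> v vr; apply: (proj1 (leftmost_mirror _ _ _)).
apply: leftmost_preserved (outerplanar_mirror op) _ _ vr.
  exact: planar_mirror.
exact: same_embedding_mirror.
Qed.

End Preserving.

(** * Linear extensions and HP-completions *)

Section Orders.
Variable T : finType.
Implicit Types (G : digraph T) (e f : T * T) (A B : seq T) (n : T -> nat).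
Implicit Types (s t u v w : T) (p : seq T) (Q : {set T * T}).

Lemma acyclicP G u v : acyclic G -> adj G u v -> connect (adj G) v u -> False.
Proof.
move=> ac uv /connectP[p pth ulast].
by have := ac (v :: p); rewrite /= rcons_path pth -ulast uv => /(_ isT).
Qed.

Lemma increasing_acyclic G n : increasing G n -> acyclic G.
Proof.
move=> inc [//|x p] /=; rewrite rcons_path => /andP[pth lx].
have cx : connect (adj G) x (last x p) by apply/connectP; exists p.
have := inc _ _ lx; case: (increasing_connect inc cx) => [<-|]; first by rewrite ltnn.
by move=> h1 h2; have := ltn_trans h1 h2; rewrite ltnn.
Qed.

Lemma path_arcs_index x p f : uniq (x :: p) -> f \in path_arcs x p ->
  index f.2 (x :: p) = (index f.1 (x :: p)).+1.
Proof.
elim: p x => [|y p IH] x //= /and3P[xp yp up]; rewrite path_arcs_cons inE.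
move: xp; rewrite inE negb_or => /andP[xy xp].
case/orP => [/eqP->|fp] /=; first by rewrite !eqxx (negbTE xy).
have [f1 f2] := path_arcs_mem fp.
have xf2 : x != f.2 by apply: contraNneq xp => ->.
have xf1 : x != f.1.
  by move: f1; rewrite inE => /orP[/eqP->//|f1]; apply: contraNneq xp => ->.
have /= := IH y; rewrite yp up => /(_ isT fp).
by rewrite (negbTE xf1) (negbTE xf2) => ->.
Qed.

(** Injectivity and the bound make [n] a bijection from the vertices to an initial segment of the
    integers starting at 0; values elsewhere are arbitrary. *)
Definition valid_order G n := [/\ {in verts G &, injective n},
  {in verts G, forall v, (n v < #|verts G|)%N} & increasing G n].

Definition new_arcs G n : {set T * T} :=
  [set f | [&& f.1 \in verts G, f.2 \in verts G, n f.2 == (n f.1).+1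
             & f \notin arcs G]]%SET.

Definition arcs_over G n f : {set T * T} :=
  [set e in arcs G | (n e.1 < n f.1)%N && (n f.2 < n e.2)%N]%SET.

Definition order_cost G n := (\sum_(f in new_arcs G n) #|arcs_over G n f|)%N.

Lemma valid_order_onto G n k : valid_order G n -> (k < #|verts G|)%N ->
  exists2 v, v \in verts G & n v = k.
Proof.
move=> [inj bnd _] kV.
pose g v : 'I_#|verts G| := insubd (Ordinal kV) (n v).
have gE v : v \in verts G -> g v = n v :> nat.
  by move=> vG; rewrite val_insubd bnd.
have ginj : {in verts G &, injective g}.
  by move=> u v uG vG /(congr1 val) /=; rewrite !gE //; exact: inj.
have : Ordinal kV \in (g @: verts G)%SET.
  suff -> : (g @: verts G)%SET = [set: 'I_#|verts G|]%SET by rewrite finset.in_setT.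
  apply/eqP; rewrite eqEcard finset.subsetT (card_in_imset ginj) cardsT card_ord.
    exact: leqnn.
by case/imsetP => v vG /(congr1 val) /=; rewrite gE// => kE; exists v.
Qed.

Definition closed_arcs G := forall e, e \in arcs G -> (e.1 \in verts G) && (e.2 \in verts G).

(** The order is the position on the hamiltonian path; acyclicity makes it increasing on G. A
    consecutive pair that is not an arc of G must be in [Q], and conversely [Q] lies on the path and
    avoids G. *)
Lemma completion_order G s t Q : closed_arcs G -> acyclic_HP_completion G s t Q ->
  exists2 n, valid_order G n & Q = new_arcs G n.
Proof.
move=> ends [dis ac [p [[[pth lst] un mem] sub]]].
have sub_adj : subrel (adj G) (adj (add_arcs G Q)).
  by move=> u v; rewrite /adj /= inE => ->.
pose q := s :: p; have idx f : f \in path_arcs s p -> index f.2 q = (index f.1 q).+1.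
  exact: path_arcs_index.
have tr : transitive (connect (adj (add_arcs G Q))) by move=> x y z; exact: connect_trans.
have srt : sorted (connect (adj (add_arcs G Q))) q.
  by rewrite /q /=; apply: sub_path pth => x y; exact: connect1.
have cnt := sorted_leq_index tr (@connect0 _ _) srt.
have inc u v : u \in q -> v \in q -> adj G u v -> (index u q < index v q)%N.
  move=> uq vq uv; rewrite ltnNge; apply/negP => le.
  by apply: (acyclicP ac (sub_adj _ _ uv)); exact: cnt.
exists (index^~ q).
- split.
  + by move=> u v uG vG; apply: index_inj; rewrite // mem.
  + by move=> v vG; rewrite -(eq_card mem) (card_uniqP un) index_mem mem.
  + by move=> u v uv; have /andP[uG vG] := ends _ uv; apply: inc; rewrite ?mem.
- apply/setP => f; rewrite inE; apply/idP/idP => [fQ|/and4P[f1 f2 /eqP nf fG]].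
    have fp := sub f fQ; have [f1 f2] := path_arcs_mem fp.
    apply/and4P; split; first by rewrite -mem.
    - by rewrite -mem in_cons f2 orbT.
    - by apply/eqP; exact: idx.
    - by rewrite (disjointFr dis fQ).
  have f1q : f.1 \in q by rewrite mem.
  have [|v vp] := path_arcs_succ f1q.
    apply: contraPneq nf => f1l; rewrite f1l /q index_last// => f2l.
    by move: f2; rewrite -mem -index_mem f2l ltnn.
  have vq : v \in q by have [_] := path_arcs_mem vp; rewrite in_cons => ->; rewrite orbT.
  have := idx _ vp; rewrite /= -nf => /(index_inj s vq); rewrite mem => /(_ f2) vf.
  have := path_arcs_adj pth vp; rewrite /= vf /adj /= -surjective_pairing inE.
  by rewrite (negbTE fG).
Qed.

(** Consecutive vertices are joined by an old or a new arc. Consequently every upward drawing of the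
    completion has heights increasing along [n]. *)
Lemma order_path_connect G n u v : valid_order G n ->
  u \in verts G -> v \in verts G -> (n u < n v)%N ->
  connect (adj (add_arcs G (new_arcs G n))) u v.
Proof.
move=> vn; have [inj bnd inc] := vn.
have [k] := ubnP (n v); elim: k v => // k IH v; rewrite ltnS => le uG vG uv.
have v0 : (0 < n v)%N by apply: leq_ltn_trans uv.
have [|w wG nw] := @valid_order_onto G n (n v).-1 vn.
  by apply: leq_ltn_trans (bnd _ vG); exact: leq_pred.
have wv : adj (add_arcs G (new_arcs G n)) w v.
  by rewrite /adj !inE /= wG vG nw prednK// eqxx orbN.
have [uw|wu] := ltnP (n u) (n w).
  apply: connect_trans (connect1 wv); apply: IH => //.
  by apply: leq_trans le; rewrite nw prednK.
suff -> : u = w by exact: connect1.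
by apply: inj => //; apply/eqP; rewrite eqn_leq wu andbT nw -ltnS prednK.
Qed.

Lemma order_completion G s t n : st_digraph G s t -> valid_order G n ->
  acyclic_HP_completion G s t (new_arcs G n).
Proof.
move=> [ends ac src snk] vn; have [inj bnd inc] := vn.
have [sG s0] : is_source G s by apply/src.
have [tG t0] : is_sink G t by apply/snk.
pose e u v := [&& u \in verts G, v \in verts G & n v == (n u).+1].
have esub : subrel e (adj (add_arcs G (new_arcs G n))).
  by move=> u v /and3P[uG vG uv]; rewrite /adj /= !inE /= uG vG uv orbN.
have ns : n s = 0.
  have V0 : (0 < #|verts G|)%N by exact: leq_trans (bnd _ sG).
  have [v vG nv] := valid_order_onto vn V0.
  rewrite -((src v).1 _)//; split=> // u; apply/negP => /inc; by rewrite nv.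
have [p [pth pn pG]] : exists p, [/\ path e s p, [seq n v | v <- s :: p] = iota 0 #|verts G|
    & {subset s :: p <= verts G}].
  have V0 : (0 < #|verts G|)%N by exact: leq_trans (bnd _ sG).
  suff main k : (k < #|verts G|)%N -> exists p, [/\ path e s p,
      [seq n v | v <- s :: p] = iota 0 k.+1 & {subset s :: p <= verts G}].
    by have := main #|verts G|.-1; rewrite prednK// => /(_ (leqnn _)).
  elim: k => [|k IH] kV.
    by exists [::]; split=> //=; [rewrite ns|move=> v; rewrite inE => /eqP->].
  have [p [pth pn pG]] := IH (ltnW kV).
  have [v vG nv] := valid_order_onto vn kV.
  exists (rcons p v); split.
  - rewrite rcons_path pth /= /e vG nv pG ?mem_last//=.
    have : n (last s p) = last 0 [seq n v | v <- s :: p] by rewrite /= last_map.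
    by rewrite pn -(nth_last 0%N (iota _ _)) size_iota nth_iota//= => ->.
  - by rewrite -rcons_cons map_rcons pn nv -[k.+2]addn1 iotaD add0n cats1.
  - by move=> w; rewrite -rcons_cons mem_rcons in_cons => /orP[/eqP->|/pG].
have pm v : (v \in s :: p) = (v \in verts G).
  apply/idP/idP => [/pG//|vG]; have : n v \in [seq n v | v <- s :: p].
    by rewrite pn mem_iota /= add0n bnd.
  by case/mapP => w wp; move=> /(inj _ _ vG (pG _ wp)) ->.
have un : uniq (s :: p) by apply: (@map_uniq _ _ n); rewrite pn iota_uniq.
have nl : (n (last s p)).+1 = #|verts G|.
  have : n (last s p) = last 0 [seq n v | v <- s :: p] by rewrite /= last_map.
  have V0 : (0 < #|verts G|)%N by exact: leq_trans (bnd _ sG).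
  by rewrite pn -(nth_last 0%N (iota _ _)) size_iota nth_iota ?prednK// => ->; rewrite add0n prednK.
have lst : last s p = t.
  have lG : last s p \in verts G by apply: pG; exact: mem_last.
  apply/snk; split=> // u; apply/negP => lu; have /andP[_ uG] := ends _ lu.
  by have := bnd _ uG; rewrite -nl ltnS leqNgt (inc _ _ lu).
have inc' : increasing (add_arcs G (new_arcs G n)) n.
  move=> u v; rewrite /adj /= !inE => /orP[/inc//|/and4P[_ _ /eqP /= -> _]].
  exact: ltnSn.
split.
- by apply/pred0P => f /=; rewrite inE; case: (f \in arcs G); rewrite ?andbF.
- exact: increasing_acyclic inc'.
- exists p; split; first by split=> //; split=> //; exact: sub_path pth.
  move=> f; rewrite inE => /and4P[f1 f2 /eqP nf fG].
  have f1p : f.1 \in s :: p by rewrite pm.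
  have [|v vp] := path_arcs_succ f1p.
    apply: contraPneq nf => f1t nf; have := bnd _ f2.
    by rewrite nf f1t nl ltnn.
  have /and3P[_ vG /eqP nv] := path_arcs_adj pth vp.
  have vf : v = f.2 by apply: inj => //; rewrite nf.
  by move: vp; rewrite vf -surjective_pairing.
Qed.

End Orders.

(** Vertices are sorted by height, ties being broken by [enum_rank], and numbered by their count of
    predecessors. *)
Lemma valid_order_exists (R : realType) (T : finType) (D : drawing R T) (G : digraph T) :
  upward_drawing D G -> closed_arcs G -> exists n, valid_order G n.
Proof.
move=> ud ends.
pose lt u v := (vy D u < vy D v)%R ||
  (vy D u == vy D v) && (enum_rank u < enum_rank v)%N.
have lt_irr u : lt u u = false by rewrite /lt ltxx ltnn andbF.
have lt_tr v u w : lt u v -> lt v w -> lt u w.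
  rewrite /lt => /orP[uv|/andP[/eqP-> uv]] /orP[vw|/andP[/eqP vw' vw]].
  - by rewrite (lt_trans uv vw).
  - by rewrite -vw' uv.
  - by rewrite vw.
  - by rewrite vw' eqxx (ltn_trans uv vw) orbT.
have lt_tot u v : u != v -> lt u v || lt v u.
  move=> uv; rewrite /lt; case: (ltgtP (vy D u) (vy D v)) => //= _.
  by rewrite -neq_ltn; apply: contra uv => /eqP/val_inj/enum_rank_inj/eqP.
pose n v := #|[set u in verts G | lt u v]%SET|.
have nlt u v : u \in verts G -> lt u v -> (n u < n v)%N.
  move=> uG uv; apply: proper_card; apply/properP; split.
    apply/fintype.subsetP => w; rewrite !inE => /andP[-> wu].
    exact: lt_tr wu uv.
  by exists u; rewrite !inE uG ?uv// lt_irr.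
exists n; split.
- move=> u v uG vG nuv; apply: contraTeq isT => /lt_tot /orP[/nlt|/nlt].
    by rewrite nuv ltnn => /(_ uG).
  by rewrite nuv ltnn => /(_ vG).
- move=> v vG; apply: proper_card; apply/properP; split.
    by apply/fintype.subsetP => w; rewrite !inE => /andP[].
  by exists v; rewrite // !inE lt_irr andbF.
- move=> u v uv; have /andP[uG _] := ends _ uv; apply: nlt => //.
  by rewrite /lt (arc_increasing ud uv).
Qed.

(** * Exchanging blocks *)

Section BlockSwap.
Variables (i m k : nat).
Hypotheses (m0 : (0 < m)%N) (k0 : (0 < k)%N).
Implicit Types (x y : nat).
Local Open Scope nat_scope.

Definition block_swap x :=
  if i < x <= i + m then x + k else if i + m < x <= i + m + k then x - m else x.

(** In the notation of the overview, [outer] marks the positions of u and L2, and [inner] those of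
    R1 and v. *)
Definition outer x := (x == i) || (i + m < x <= i + m + k).
Definition inner x := (i < x <= i + m) || (x == i + m + k + 1).

Variant block_swap_spec x : nat -> Prop :=
| BlockSwapLow of x <= i : block_swap_spec x x
| BlockSwapFst of i < x & x <= i + m : block_swap_spec x (x + k)
| BlockSwapSnd of i + m < x & x <= i + m + k : block_swap_spec x (x - m)
| BlockSwapHigh of i + m + k < x : block_swap_spec x x.

Lemma block_swapP x : block_swap_spec x (block_swap x).
Proof.
rewrite /block_swap; case: ifP => [/andP[]|h1]; first by constructor 2.
case: ifP => [/andP[]|h2]; first by constructor 3.
by have [h|h] := leqP x i; [constructor 1|constructor 4; lia].
Qed.

Lemma block_swap_inj : injective block_swap.
Proof. by move=> x y; case: block_swapP => ?; case: block_swapP; lia. Qed.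

Lemma block_swap_bound N x : i + m + k + 1 < N -> x < N -> block_swap x < N.
Proof. by case: block_swapP; lia. Qed.

(** Only pairs from the first and the second block are inverted. Without arcs from inner to outer
    positions, the swapped order is still a linear extension. *)
Lemma block_swap_lt x y : x < y -> ~ (outer y && inner x) ->
  block_swap x < block_swap y.
Proof.
rewrite /outer /inner => xy h.
by case: (block_swapP x) => ?; case: (block_swapP y) => ?; lia.
Qed.

(** In the first two cases both vertices are on one side and hence joined in G; only the third can
    create a new arc, from the end of the second block to the start of the first. *)
Lemma block_swap_succ x y : block_swap y = (block_swap x).+1 ->
  [\/ outer x && outer y, inner x && inner y, x = i + m + k /\ y = i + 1
    | y = x.+1 /\ (x < i) || (i + m + k < x)].
Proof.
rewrite /outer /inner.
case: (block_swapP x) => [hx|hx hx'|hx hx'|hx];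
  case: (block_swapP y) => [hy|hy hy'|hy hy'|hy] h; try lia.
- by constructor 4; lia.
- by constructor 1; lia.
- by constructor 2; lia.
- by constructor 2; lia.
- by constructor 3; lia.
- by constructor 1; lia.
- by constructor 4; lia.
Qed.

Lemma block_swap_over x y : block_swap x < i + k -> i + k + 1 < block_swap y ->
  (outer x && inner y -> x = i /\ y = i + m + k + 1) ->
  [|| (x < i) && (i + 1 < y), (x < i + m) && (i + m + 1 < y)
    | (x < i + m + k) && (i + m + k + 1 < y)].
Proof.
rewrite /outer /inner.
case: (block_swapP x) => [hx|hx hx'|hx hx'|hx];
  case: (block_swapP y) => [hy|hy hy'|hy hy'|hy]; lia.
Qed.

Lemma block_swap_outside x y : (y < i) || (i + m + k < y) ->
  (block_swap x < block_swap y) = (x < y).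
Proof. by case: (block_swapP x) => ?; case: (block_swapP y) => ? ?; lia. Qed.

Lemma block_swap_outside' x y : (y <= i) || (i + m + k < y) ->
  (block_swap y < block_swap x) = (y < x).
Proof. by case: (block_swapP x) => ?; case: (block_swapP y) => ? ?; lia. Qed.

Lemma block_swap_first : block_swap (i + 1) = i + k + 1.
Proof. by case: block_swapP; lia. Qed.

Lemma block_swap_last : block_swap (i + m + k) = i + k.
Proof. by case: block_swapP; lia. Qed.

Lemma block_swap_groups : [/\ outer i, inner (i + 1), inner (i + m),
  outer (i + m + 1) & outer (i + m + k) /\ inner (i + m + k + 1)].
Proof. by rewrite /outer /inner; split; [| | | |split]; lia. Qed.

End BlockSwap.

Section Exchange.
Variables (T : finType) (G : digraph T).
Implicit Types (e f : T * T) (A B : seq T) (n : T -> nat).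
Implicit Types (s t u v w : T) (p : seq T).

Definition tight A := forall n, increasing G n ->
  {in A &, forall u v, n v = (n u).+1 -> adj G u v}.

(** The path arc leaving [u] has its head after [u] and no later than [v]; when [v] follows [u]
    immediately, this head is [v]. So a new arc always changes sides. *)
Lemma path_tight s p : path (adj G) s p -> tight (s :: p).
Proof.
move=> pth n inc u v us vs nv.
have [|w up] := path_arcs_succ us.
  apply: contraPneq nv => ul; have := path_last_connect pth vs; rewrite -ul => c.
  by case: (increasing_connect inc c) => [->|]; lia.
have := path_arcs_adj pth up; rewrite /= => uw.
have [/= vu|/= wv] := path_arcs_cmp pth up vs.
  by case: (increasing_connect inc vu) => [vu'|]; [move: nv; rewrite vu'|]; lia.
case: (increasing_connect inc wv) => [<-//|]; by have := inc _ _ uw; lia.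
Qed.

(* Minimizes the number of crossings first, then the number of new arcs: the
   second criterion excludes orders that are optimal but cross an upper limiting
   arc several times. *)
Definition weight n :=
  (\sum_(f in new_arcs G n) (#|arcs_over G n f| * #|{: T * T}|.+1 + 1))%N.

Lemma weight_cost n : weight n = (order_cost G n * #|{: T * T}|.+1 + #|new_arcs G n|)%N.
Proof. by rewrite /weight big_split /= -big_distrl /= sum1_card. Qed.

(** The multiplier exceeds any possible number of new arcs, so [weight] compares lexicographically,
    crossings first. *)
Lemma weight_minimal n n' : (weight n <= weight n')%N ->
  (order_cost G n <= order_cost G n')%N.
Proof.
have : (#|new_arcs G n'| <= #|{: T * T}|)%N := max_card _.
rewrite !weight_cost; move: (order_cost _ _) (order_cost _ _) #|_| #|_| #|_|.
by move=> a b c d e; nia.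
Qed.

Lemma sum_subset (I : finType) (X Y : {set I}) (F : I -> nat) : X \subset Y ->
  (\sum_(x in X) F x <= \sum_(x in Y) F x)%N.
Proof.
move=> XY; rewrite (big_setID X (A := Y)) /= (finset.setIidPr XY).
exact: leq_addr.
Qed.

(* The blocks [i+1, i+m] and [i+m+1, i+m+k] are swapped: three new arcs are
   replaced by a single one, and every arc over the latter was over one of the
   former. *)
Lemma exchange A B n i m k : tight A -> tight B -> valid_order G n ->
  (0 < m)%N -> (0 < k)%N -> (i + m + k + 1 < #|verts G|)%N ->
  {in verts G, forall a, outer i m k (n a) -> a \in A} ->
  {in verts G, forall b, inner i m k (n b) -> b \in B} ->
  {in verts G &, forall a b, outer i m k (n a) -> inner i m k (n b) ->
     ~~ adj G b a /\ (adj G a b -> n a = i /\ n b = i + m + k + 1)%N} ->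
  closed_arcs G ->
  exists2 n', valid_order G n' & (weight n' < weight n)%N.
Proof.
move=> tA tB vn m0 k0 lV inA inB noe ends.
have [inj bnd inc] := vn.
pose n' w := block_swap i m k (n w).
have vn' : valid_order G n'.
  split.
  - by move=> u v uG vG /(block_swap_inj m0 k0); exact: inj.
  - by move=> v vG; apply: block_swap_bound lV _ => //; exact: bnd.
  - move=> u v uv; have /andP[/= uG vG] := ends _ uv.
    apply: block_swap_lt => //; first exact: inc.
    move=> /andP[ov iu]; have [] := noe v u vG uG ov iu; by rewrite uv.
have [inj' bnd' inc'] := vn'.
exists n' => //.
have onto j : (j <= i + m + k + 1)%N -> exists2 v, v \in verts G & n v = j.
  by move=> le; apply: valid_order_onto vn _; exact: leq_ltn_trans lV.
have [u uG nu] : exists2 v, v \in verts G & n v = i by apply: onto; lia.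
have [r1 r1G nr1] : exists2 v, v \in verts G & n v = (i + 1)%N by apply: onto; lia.
have [rm rmG nrm] : exists2 v, v \in verts G & n v = (i + m)%N by apply: onto; lia.
have [l1 l1G nl1] : exists2 v, v \in verts G & n v = (i + m + 1)%N by apply: onto; lia.
have [lk lkG nlk] : exists2 v, v \in verts G & n v = (i + m + k)%N by apply: onto; lia.
have [v vG nv] : exists2 v, v \in verts G & n v = (i + m + k + 1)%N by apply: onto.
pose w n f := (#|arcs_over G n f| * #|{: T * T}|.+1 + 1)%N.
(* The new arcs that end by position [i] or start after the second block; the swap changes neither
   them nor the sets of arcs over them. *)
pose C : {set T * T} := [set f in new_arcs G n | (n f.1 < i)%N || (i + m + k < n f.1)%N]%SET.
have sub' : new_arcs G n' \subset ((lk, r1) |: C)%SET.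
  apply/fintype.subsetP => -[a b]; rewrite !inE /= => /and4P[aG bG /eqP nab abG].
  case: (block_swap_succ m0 k0 nab) => [/andP[oa ob]|/andP[ia ib]|[na nb]|[nb na]].
  - case/negP: abG; apply: tA inc' _ _ _ _ nab; exact: inA.
  - case/negP: abG; apply: tB inc' _ _ _ _ nab; exact: inB.
  - apply/orP; left; apply/eqP; congr pair; apply: inj => //; by rewrite ?na ?nb.
  - by rewrite aG bG nb eqxx abG na orbT.
have same f : f \in C -> w n' f = w n f.
  rewrite inE => /andP[]; rewrite inE => /and4P[f1 f2 /eqP nf _] fi.
  rewrite /w; suff -> : arcs_over G n' f = arcs_over G n f by [].
  apply/setP => e; rewrite !inE; case: (boolP (e \in arcs G)) => //= eG.
  rewrite (block_swap_outside _ _ _ fi)//; congr andb.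
  apply: block_swap_outside' => //; rewrite nf.
  by case/orP: fi => [->//|/ltnW h]; rewrite ltnS h orbT.
have [ou ir1 irm ol1 [olk iv]] := block_swap_groups i m0 k0.
have ltl : (i < i + m + k /\ i + 1 < i + m + k + 1)%N by clear - m0 k0; lia.
have noe1 : ~~ adj G u r1.
  have [|| _ h] := noe _ _ uG r1G; rewrite ?nu ?nr1//.
  by apply/negP => /h[_]; rewrite nr1 => e; move: (proj2 ltl); rewrite -e ltnn.
have noe2 : ~~ adj G rm l1 by apply: (proj1 (noe _ _ l1G rmG _ _)); rewrite ?nl1 ?nrm.
have noe3 : ~~ adj G lk v.
  have [|| _ h] := noe _ _ lkG vG; rewrite ?nlk ?nv//.
  by apply/negP => /h[+ _]; rewrite nlk => e; move: (proj1 ltl); rewrite e ltnn.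
have new1 : (u, r1) \in new_arcs G n by rewrite inE /= uG r1G nu nr1 addn1 eqxx.
have new2 : (rm, l1) \in new_arcs G n by rewrite inE /= rmG l1G nrm nl1 addn1 eqxx.
have new3 : (lk, v) \in new_arcs G n by rewrite inE /= lkG vG nlk nv addn1 eqxx.
have overs : (#|arcs_over G n' (lk, r1)| <=
    #|arcs_over G n (u, r1)| + #|arcs_over G n (rm, l1)| + #|arcs_over G n (lk, v)|)%N.
  have sub : arcs_over G n' (lk, r1) \subset (arcs_over G n (u, r1) :|:
      arcs_over G n (rm, l1) :|: arcs_over G n (lk, v))%SET.
    apply/fintype.subsetP => e; rewrite !inE /= => /and3P[eG h1 h2].
    have /andP[e1 e2] := ends _ eG.
    rewrite eG nu nr1 nrm nl1 nlk nv /= -orbA.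
    apply: (block_swap_over m0 k0).
    - by move: h1; rewrite /n' nlk block_swap_last.
    - by move: h2; rewrite /n' nr1 block_swap_first.
    - move=> /andP[oe ie]; apply: (proj2 (noe _ _ e1 e2 oe ie)).
      by rewrite /adj -surjective_pairing.
  apply: leq_trans (subset_leq_card sub) _.
  apply: leq_trans (leq_card_setU _ _) _.
  by rewrite leq_add2r leq_card_setU.
have sum3 : (w n (u, r1) + w n (rm, l1) + w n (lk, v) + \sum_(f in C) w n f
    <= weight n)%N.
  have CP : C \subset new_arcs G n by apply/fintype.subsetP => f; rewrite inE => /andP[].
  rewrite /weight (big_setID (A := new_arcs G n) C) /= (finset.setIidPr CP) addnC leq_add2l.
  have inD f : f \in new_arcs G n -> (i <= n f.1 <= i + m + k)%N ->
      f \in (new_arcs G n :\: C)%SET.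
    by move=> fP /andP[h1 h2]; rewrite finset.in_setD fP andbT inE fP /= negb_or -!leqNgt h1.
  rewrite (bigD1 (u, r1)) /=; last by apply: inD; rewrite //= nu leqnn ltnW; case: ltl.
  rewrite (bigD1 (rm, l1)) /=; last first.
    rewrite inD//= ?nrm; last by rewrite leq_addr leq_addr.
    by apply/eqP => -[ru _]; move: nrm; rewrite ru nu; clear - m0; lia.
  rewrite (bigD1 (lk, v)) /=; last first.
    rewrite inD//= ?nlk; last by rewrite leqnn -addnA leq_addr.
    apply/andP; split; apply/eqP => -[ru _]; move: nlk; rewrite ru ?nu ?nrm;
      clear - m0 k0; lia.
  by rewrite /w !addnA leq_addr.
have sum0 : (weight n' <= w n' (lk, r1) + \sum_(f in C) w n f)%N.
  apply: leq_trans (sum_subset _ sub') _.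
  rewrite big_setU1 /=; last by rewrite !inE /= nlk ltnn orbF; apply/negP => /andP[_]; clear; lia.
  by rewrite leq_add2l; apply/eq_leq/eq_bigr.
(* Strictness comes from the summand 1 in [w]: it is counted three times before the swap and once
   after it. *)
apply: leq_ltn_trans sum0 _; apply: leq_trans sum3.
rewrite /w; move: (leq_mul overs (leqnn #|{: T * T}|.+1)); rewrite !mulnDl.
by move: (_ * _)%N (_ * _)%N (_ * _)%N (_ * _)%N => a1 a2 a3 a4; clear; lia.
Qed.

End Exchange.

(** * Optimal linear extensions *)

Section Optimal.
Variables (T : finType) (G : digraph T) (n : T -> nat).
Implicit Types (e f : T * T) (A B : seq T) (a b u v w : T).
Hypothesis ends : closed_arcs G.
Hypothesis vn : valid_order G n.
Hypothesis opt : forall n', valid_order G n' -> (weight G n <= weight G n')%N.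
Local Open Scope nat_scope.

Definition sides_separated A B := forall e a b, e \in arcs G -> a \in A -> b \in B ->
  n e.1 < n a < n e.2 -> n e.1 < n b < n e.2 -> ~~ adj G a b /\ ~~ adj G b a.

Definition covers A B := forall v, v \in verts G -> (v \in A) || (v \in B).

(** An arc joining both sides strictly under [e] would start on one side of [e] and end on the other
    one. *)
Lemma two_sided_separated (R : realType) (D : drawing R T) A B :
  two_sided D G A B -> sides_separated A B.
Proof.
move=> ts e a b eG aA bB /andP[ea ae] /andP[eb be]; have [_ _ inc] := vn.
split; apply/negP => fG; have := inc _ _ fG => lt.
  by apply: (@no_interleaving _ _ D G A B n e (a, b)) => //=;
    rewrite /starts_left /ends_left /= ?aA ?bB ?ea ?be ?orbT.
by apply: (@no_interleaving _ _ D G A B n (b, a) e) => //=;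
  rewrite /starts_left /ends_left /= ?aA ?bB ?eb ?ae ?orbT.
Qed.

Lemma separated_sym A B : sides_separated A B -> sides_separated B A.
Proof. by move=> sep e a b eG aA bB ha hb; have [] := sep e b a eG bB aA hb ha. Qed.

(** An alternation A, B, A, B in the order shrinks to two consecutive blocks, each on one side, to
    which [exchange] applies: [i] is the last A position before [r], [l'] the first one after [r],
    and [j] the first B position after [l']. *)
Lemma no_pattern A B lo hi a0 r l b0 :
  tight G A -> tight G B -> covers A B ->
  {in verts G &, forall a b, a \in A -> b \in B -> lo <= n a < hi -> lo < n b <= hi ->
     ~~ adj G b a /\ (adj G a b -> n a = lo /\ n b = hi)} ->
  [/\ a0 \in A, r \in B, l \in A & b0 \in B] ->
  [/\ a0 \in verts G, r \in verts G, l \in verts G & b0 \in verts G] ->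
  lo <= n a0 -> n a0 < n r -> n r < n l -> n l < n b0 -> n b0 <= hi -> False.
Proof.
move=> tA tB cov noe [aA rB lA bB] [aG rG lG bG] la ar rl lb bh.
have [inj bnd inc] := vn.
pose inA j := [exists a, [&& a \in verts G, a \in A & n a == j]].
pose inB j := [exists b, [&& b \in verts G, b \in B & n b == j]].
have inAP a : a \in verts G -> inA (n a) = (a \in A).
  move=> aG'; apply/existsP/idP => [[a' /and3P[a'G a'A /eqP /inj <-//]]|aA'].
  by exists a; rewrite aG' aA' eqxx.
have inBP b : b \in verts G -> inB (n b) = (b \in B).
  move=> bG'; apply/existsP/idP => [[b' /and3P[b'G b'B /eqP /inj <-//]]|bB'].
  by exists b; rewrite bG' bB' eqxx.
have exl : exists j, (n r < j) && inA j by exists (n l); rewrite rl inAP.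
have [l' /andP[rl' l'A] l'min] := ex_minnP exl.
have exi : exists j, (j < n r) && inA j by exists (n a0); rewrite ar inAP.
have bi j : (j < n r) && inA j -> j <= n r by move=> /andP[/ltnW].
have [i /andP[ir iA] imax] := ex_maxnP exi bi.
have l'l : l' <= n l by apply: l'min; rewrite rl inAP.
have exj : exists j, (l' < j) && inB j.
  by exists (n b0); rewrite inBP// bB (leq_ltn_trans l'l lb).
have [j /andP[lj jB] jmin] := ex_minnP exj.
have ai : n a0 <= i by apply: imax; rewrite ar inAP.
have jb : j <= n b0 by apply: jmin; rewrite inBP// bB (leq_ltn_trans l'l lb).
(* By extremality, positions from [i + 1] to [l' - 1] are all in [B] and those from [l'] to [j - 1]
   all in [A]. *)
pose m := l'.-1 - i; pose k := j - l'.
have ilm : i + m = l'.-1 by rewrite /m; clear - ir rl'; lia.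
have mk : i + m + k + 1 = j by rewrite ilm /k; clear - ir rl' lj; lia.
have l'E : l'.-1.+1 = l' by clear - rl'; lia.
have hB b : b \in verts G -> i < n b < l' -> b \in B.
  move=> bG' /andP[ib bl]; have /orP[bA|//] := cov _ bG'.
  have [nb|nb|nb] := ltngtP (n b) (n r).
  - by have := imax (n b); rewrite nb inAP// bA => /(_ isT); rewrite leqNgt ib.
  - by have := l'min (n b); rewrite nb inAP// bA => /(_ isT); rewrite leqNgt bl.
  - by rewrite (inj _ _ bG' rG nb).
have hA a : a \in verts G -> l' <= n a < j -> a \in A.
  move=> aG' /andP[]; rewrite leq_eqVlt => /predU1P[la' _|la' aj].
    by rewrite -inAP// -la'.
  have /orP[//|aB] := cov _ aG'.
  by have := jmin (n a); rewrite la' inBP// aB => /(_ isT); rewrite leqNgt aj.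
have [n' vn' lt] : exists2 n', valid_order G n' & weight G n' < weight G n.
  apply: (@exchange _ _ A B n i m k) => //.
  - by rewrite /m; clear - ir rl'; lia.
  - by rewrite /k; clear - lj; lia.
  - by rewrite mk; apply: leq_ltn_trans jb _; exact: bnd.
  - move=> a aG'; rewrite /outer ilm => /orP[/eqP ai'|h]; first by rewrite -inAP// ai'.
    by apply: hA => //; move: h mk; rewrite ilm; clear - l'E; lia.
  - move=> b bG'; rewrite /inner mk ilm => /orP[h|/eqP bj]; last by rewrite -inBP// bj.
    by apply: hB => //; move: h; clear - l'E; lia.
  - move=> a b aG' bG' oa ib.
    have a1 : i <= n a < j by move: oa mk; rewrite /outer; clear; lia.
    have b1 : i < n b <= j by move: ib mk; rewrite /inner; clear; lia.
    have aA' : a \in A.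
      move: oa; rewrite /outer ilm => /orP[/eqP ai'|h]; first by rewrite -inAP// ai'.
      by apply: hA => //; move: h mk; rewrite ilm; clear - l'E; lia.
    have bB' : b \in B.
      move: ib; rewrite /inner mk ilm => /orP[h|/eqP bj]; last by rewrite -inBP// bj.
      by apply: hB => //; move: h; clear - l'E; lia.
    have [||h1 h2] := noe a b aG' bG' aA' bB'.
    + by move: a1; clear - la ai jb bh; lia.
    + by move: b1; clear - la ai jb bh; lia.
    + split=> // /h2[ha hb]; rewrite mk; move: a1 b1; clear - la ai jb bh ha hb; lia.
by have := opt vn'; rewrite leqNgt lt.
Qed.

(** By tightness the ends share no side; in particular a vertex lying on both sides is never the end
    of a new arc. *)
Lemma new_arc_sides A B f : tight G A -> tight G B -> covers A B ->
  f \in new_arcs G n ->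
  [/\ f.1 \in A, f.1 \notin B, f.2 \in B & f.2 \notin A] \/
  [/\ f.1 \in B, f.1 \notin A, f.2 \in A & f.2 \notin B].
Proof.
have [_ _ inc] := vn.
move=> tA tB cov; rewrite inE => /and4P[f1 f2 /eqP nf fG].
have nA : f.1 \in A -> f.2 \notin A.
  move=> f1A; apply/negP => f2A; case/negP: fG.
  by rewrite [f]surjective_pairing; exact: tA nf.
have nB : f.1 \in B -> f.2 \notin B.
  move=> f1A; apply/negP => f2A; case/negP: fG.
  by rewrite [f]surjective_pairing; exact: tB nf.
have := cov _ f2; have /orP[f1A|f1B] := cov _ f1.
  rewrite (negbTE (nA f1A)) /= => f2B; left; split; rewrite ?nA//.
  by apply: contraL f2B; exact: nB.
rewrite (negbTE (nB f1B)) orbF => f2A; right; split; rewrite ?nB//.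
by apply: contraL f2A; exact: nA.
Qed.

Lemma new_arc_inj f g : f \in new_arcs G n -> g \in new_arcs G n ->
  n f.1 = n g.1 -> f = g.
Proof.
have [inj _ _] := vn; case: f g => a b [c d]; rewrite !inE /=.
move=> /and4P[aG bG /eqP nb _] /and4P[cG dG /eqP nd _] ac.
by congr pair; apply: inj => //; rewrite nb nd ac.
Qed.

(** The middle arc runs from B to A. Each new arc has an end on either side, so [f] supplies an A
    vertex before it and [h] a B vertex after it, which completes the forbidden alternation. *)
Lemma no_three_over A B e f g h : tight G A -> tight G B -> covers A B ->
  sides_separated A B -> e \in arcs G ->
  f \in new_arcs G n -> g \in new_arcs G n -> h \in new_arcs G n ->
  n e.1 < n f.1 -> n f.1 < n g.1 -> n g.1 < n h.1 -> n h.2 < n e.2 ->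
  g.1 \in B -> g.1 \notin A -> g.2 \in A -> g.2 \notin B -> False.
Proof.
move=> tA tB cov sep eG fP gP hP ef fg gh he g1B g1A g2A g2B.
have [inj bnd inc] := vn.
have new k : k \in new_arcs G n -> [/\ k.1 \in verts G, k.2 \in verts G & n k.2 = (n k.1).+1].
  by rewrite inE => /and4P[k1 k2 /eqP nk _].
have [f1G f2G nf] := new _ fP; have [g1G g2G ng] := new _ gP.
have [h1G h2G nh] := new _ hP.
have [a [aG aA fa ag]] : exists a, [/\ a \in verts G, a \in A, n e.1 < n a & n a < n g.1].
  case: (new_arc_sides tA tB cov fP) => -[s1 s2 s3 s4]; first by exists f.1; rewrite f1G s1 ef.
  exists f.2; rewrite f2G s3 nf ltnS (ltnW ef); split=> //.
  rewrite ltn_neqAle fg andbT -nf; apply: contra g1A => /eqP/inj <-//.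
have [b [bG bB gb bh]] : exists b, [/\ b \in verts G, b \in B, n g.2 < n b & n b < n e.2].
  have h1e : n h.1 < n e.2 by apply: ltn_trans he; rewrite nh.
  case: (new_arc_sides tA tB cov hP) => -[s1 s2 s3 s4].
    exists h.2; split=> //; by rewrite nh ng ltnS.
  exists h.1; split=> //; rewrite ltn_neqAle ng gh andbT -ng.
  by apply: contra g2B => /eqP/inj ->.
(* With these bounds all positions are strictly under [e], where no arc at all joins the two
   sides. *)
apply: (@no_pattern A B (n e.1).+1 (n e.2).-1 a g.1 g.2 b) => //.
- move=> a' b' a'G b'G a'A b'B ha hb; have [|| h1 h2] := sep e a' b' eG a'A b'B.
  + by move: ha; clear; lia.
  + by move: hb; clear; lia.
  + by rewrite (negbTE h1).
- by rewrite ng.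
- by move: bh; clear; lia.
Qed.

(** Among three new arcs under [e], take the lowest, the highest and another one; the direction of
    the latter decides which side plays the role of [A]. *)
Lemma over_le2 A B e : tight G A -> tight G B -> covers A B -> sides_separated A B ->
  e \in arcs G ->
  #|[set f in new_arcs G n | (n e.1 < n f.1) && (n f.2 < n e.2)]%SET| <= 2.
Proof.
move=> tA tB cov sep eG; set F := [set f in _ | _]%SET.
rewrite leqNgt; apply/negP => F3.
have [f0 f0F] : exists f, f \in F by apply/card_gt0P; apply: ltn_trans F3.
pose f := [arg min_(f < f0 in F) n f.1]; pose h := [arg max_(f > f0 in F) n f.1].
have [fF fmin] : f \in F /\ forall g, g \in F -> n f.1 <= n g.1.
  by rewrite /f; case: arg_minnP.
have [hF hmax] : h \in F /\ forall g, g \in F -> n g.1 <= n h.1.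
  by rewrite /h; case: arg_maxnP.
have [g] : exists g, g \in (F :\ f :\ h)%SET.
  apply/card_gt0P; have := cardsD1 f F; have := cardsD1 h (F :\ f)%SET.
  have := leq_b1 (f \in F); have := leq_b1 (h \in (F :\ f)%SET); move: F3.
  move: (f \in F : nat) (h \in (F :\ f)%SET : nat) => b1 b2.
  by move: #|_| #|_| #|_| => c1 c2 c3; clear; lia.
rewrite finset.in_setD1 finset.in_setD1 => /and3P[gh gf gF'].
have FP k : k \in F -> [/\ k \in new_arcs G n, n e.1 < n k.1 & n k.2 < n e.2].
  by rewrite inE => /andP[-> /andP[]].
have [fP ef _] := FP _ fF; have [hP _ he] := FP _ hF.
have [gP _ _] := FP _ gF'.
have fg : n f.1 < n g.1.
  by rewrite ltn_neqAle fmin// andbT; apply: contra gf => /eqP/new_arc_inj ->.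
have gh' : n g.1 < n h.1.
  by rewrite ltn_neqAle hmax// andbT; apply: contra gh => /eqP/new_arc_inj ->.
case: (new_arc_sides tA tB cov gP) => -[s1 s2 s3 s4].
  apply: (@no_three_over B A e f g h) => //.
    by move=> v /cov; rewrite orbC.
  exact: separated_sym.
exact: (@no_three_over A B e f g h).
Qed.

Lemma order_connect A u v : chain G A -> u \in A -> v \in A -> n u < n v ->
  connect (adj G) u v.
Proof.
have [_ _ inc] := vn; move=> cA uA vA uv; case: (cA u v uA vA) => // c.
by case: (increasing_connect inc c) uv => [->|]; [rewrite ltnn|lia].
Qed.

Lemma order_neq u v : n u < n v -> u != v.
Proof. by apply: contraTneq => ->; rewrite ltnn. Qed.

Section NonTransitiveArc.
Variables (A B : seq T) (x z : T).
Hypotheses (tA : tight G A) (tB : tight G B) (cov : covers A B) (sep : sides_separated A B).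
Hypotheses (cA : chain G A) (cB : chain G B).
Hypotheses (xz : adj G x z) (xA : x \in A) (zB : z \in B).
Hypothesis ntr : forall w, connect (adj G) x w -> connect (adj G) w z ->
  x != w -> w != z -> False.

(** The alternation is [x], [r], [l], [z]. The range now includes [x] and [z], so arcs touching one
    of them must be excluded too: such an arc, continued along its side, would be a longer path from
    [x] to [z]. Only the arc from [x] to [z] survives, and [exchange] tolerates it. *)
Lemma over_sorted r l : r \in verts G -> l \in verts G -> r \in B -> l \in A ->
  n x < n r -> n r < n l -> n l < n z -> False.
Proof.
have [inj bnd inc] := vn; have /andP[/= xG zG] := ends xz.
move=> rG lG rB lA xr rl lz.
apply: (@no_pattern A B (n x) (n z) x r l z) => // a b aG bG aA bB /andP[xa az] /andP[xb bz].
split.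
  apply/negP => ba; have ab := inc _ _ ba.
  have [||_] := @sep (x, z) a b xz aA bB; rewrite /=; last by rewrite ba.
    by rewrite az (leq_ltn_trans _ ab)// ltnW.
  by rewrite xb (leq_trans ab)// ltnW.
move=> ab; have [xa'|ax] := ltnP (n x) (n a); have [bz'|zb] := ltnP (n b) (n z).
- have [||] := @sep (x, z) a b xz aA bB; rewrite /= ?xa' ?xb//; last by rewrite ab.
- have bz' : b = z by apply: inj => //; apply/eqP; rewrite eqn_leq bz.
  case: (ntr (w := a)); first exact: order_connect cA xA aA xa'.
  + by apply: connect1; rewrite -bz'.
  + exact: order_neq.
  + exact: order_neq.
- have ax' : a = x by apply: inj => //; apply/eqP; rewrite eqn_leq ax.
  case: (ntr (w := b)); first by apply: connect1; rewrite -ax'.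
  + exact: order_connect cB bB zB bz'.
  + exact: order_neq.
  + exact: order_neq.
- by split; apply/eqP; rewrite eqn_leq ?ax ?xa// bz.
Qed.

Lemma over_side f : f \in new_arcs G n -> n x < n f.1 -> n f.2 < n z ->
  [/\ f.1 \in A, f.2 \in B & f.2 \notin A].
Proof.
move=> fP xf fz; case: (new_arc_sides tA tB cov fP) => -[s1 s2 s3 s4] //.
move: fP; rewrite inE => /and4P[f1 f2 /eqP nf _].
by case: (over_sorted f1 f2 s1 s3 xf _ fz); rewrite nf.
Qed.

(** Both arcs run from A to B, so the head of the lower one and the tail of the higher one would
    violate [over_sorted]. *)
Lemma over_unique f g : f \in new_arcs G n -> g \in new_arcs G n ->
  n x < n f.1 -> n f.2 < n z -> n x < n g.1 -> n g.2 < n z -> f = g.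
Proof.
suff main f' g' : f' \in new_arcs G n -> g' \in new_arcs G n ->
  n x < n f'.1 -> n f'.2 < n z -> n x < n g'.1 -> n g'.2 < n z -> n f'.1 < n g'.1 -> False.
  move=> fP gP xf fz xg gz; apply: new_arc_inj => //.
  by case: (ltngtP (n f.1) (n g.1)) => // lt; [case: (main f g)|case: (main g f)].
move=> fP gP xf fz xg gz lt.
have [f1A f2B f2A] := over_side fP xf fz; have [g1A g2B _] := over_side gP xg gz.
have [inj _ _] := vn.
move: fP gP; rewrite !inE => /and4P[f1 f2 /eqP nf _] /and4P[g1 g2 /eqP ng _].
apply: (over_sorted f2 g1 f2B g1A); rewrite ?nf.
- exact: ltnW.
- rewrite ltn_neqAle lt andbT -nf; apply: contra f2A => /eqP/inj ->//.
- by apply: leq_trans gz; rewrite ng.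
Qed.

End NonTransitiveArc.
End Optimal.

(** * Cardinality bounds and convexity of the parabola *)

Lemma card_fset_set_le (K : choiceType) (I : finType) (S : {set I}) (g : I -> K)
    (X : set K) :
  (forall x, X x -> exists2 i, i \in S & x = g i) ->
  finite_set X /\ (#|` fset_set X|%fset <= #|S|)%N.
Proof.
move=> h; pose Y := [fset g i | i in S]%fset.
have XY : (X `<=` [set` Y])%classic.
  by move=> x /h[i iS ->] /=; apply/imfsetP; exists i.
have fX : finite_set X by apply: sub_finite_set XY (finite_fset Y).
split=> //; apply: (@leq_trans #|` Y|%fset).
  by apply: fsubset_leq_card; rewrite -[Y]set_fsetK -fset_set_sub.
apply: leq_trans (leq_imfset_card _ _ _) _.
by rewrite -(card_uniqP (enum_finmem_uniq _)) (eq_card (enum_finmemE _)).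
Qed.

Lemma card_fset_set_ge (K : choiceType) (I : finType) (S : {set I}) (g : I -> K)
    (X : set K) : finite_set X -> {in S &, injective g} ->
  (forall i, i \in S -> X (g i)) -> (#|S| <= #|` fset_set X|%fset)%N.
Proof.
move=> fX ginj h; pose Y := [fset g i | i in S]%fset.
have -> : #|S| = #|` Y|%fset.
  rewrite (card_in_imfset _ ginj); set q := enum_finmem _.
  have <- : #|q| = size q by apply/card_uniqP; exact: enum_finmem_uniq.
  by apply: eq_card => i; rewrite enum_finmemE.
apply: fsubset_leq_card; apply/fsubsetP => x /imfsetP[i /= iS ->].
by rewrite in_fset_set // inE; exact: h.
Qed.

(** The chord inequality cleared of the denominator [h2 - h1]; for points on the parabola the gap is
    exactly the product in [p3], and [p1], [p2] account for points to the right of it. *)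
Lemma chord_above_parabola (R : realFieldType) (x1 x2 h1 h2 h : R) :
  (h1 ^+ 2 <= x1 -> h2 ^+ 2 <= x2 -> h1 < h -> h < h2 ->
  h ^+ 2 * (h2 - h1) < x1 * (h2 - h) + x2 * (h - h1))%R.
Proof.
move=> b1 b2 lt1 lt2.
have p1 : (0 <= (x1 - h1 ^+ 2) * (h2 - h))%R by rewrite mulr_ge0 ?subr_ge0 // ltW.
have p2 : (0 <= (x2 - h2 ^+ 2) * (h - h1))%R by rewrite mulr_ge0 ?subr_ge0 // ltW.
have p3 : (0 < (h2 - h1) * (h2 - h) * (h - h1))%R.
  by rewrite !mulr_gt0 ?subr_gt0 // (lt_trans lt1).
by nra.
Qed.

(** * Straight drawings *)

Section StraightDrawing.
Variables (R : realType) (T : finType) (D : drawing R T) (G : digraph T).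
Variables (A B : seq T) (n : T -> nat).
Implicit Types (e f : T * T) (u v w : T) (y : R).
Hypothesis ts : two_sided D G A B.
Hypothesis vn : valid_order G n.
Local Open Scope ring_scope.

Let height v : R := (n v)%:R.
(** Heights are below [#|verts G|], so this width keeps the left parabola strictly to the left of
    the right one at all heights used. Vertices common to both sides go to the left parabola. *)
Let width : R := 2 * #|verts G|%:R ^+ 2 + 1.
Let abscissa v : R := if v \in A then height v ^+ 2 else width - height v ^+ 2.

(* The vertices lie on the two parabolas x = y^2 and x = width - y^2, hence in
   convex position, and arcs are straight segments. *)
Definition straight : drawing R T := Drawing abscissa height (fun e y =>
  abscissa e.1 + (abscissa e.2 - abscissa e.1) / (height e.2 - height e.1) * (y - height e.1)).

Let inG e := (e.1 \in verts G) && (e.2 \in verts G).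

Lemma height_lt u v : (height u < height v) = (n u < n v)%N.
Proof. by rewrite /height ltr_nat. Qed.

Lemma straight_affine e : exists a b, forall y, curve straight e y = a + b * y.
Proof.
exists (abscissa e.1 - (abscissa e.2 - abscissa e.1) / (height e.2 - height e.1) * height e.1).
exists ((abscissa e.2 - abscissa e.1) / (height e.2 - height e.1)) => y /=.
by rewrite mulrBr; lra.
Qed.

Lemma straight_start e : curve straight e (height e.1) = abscissa e.1.
Proof. by rewrite /= subrr mulr0 addr0. Qed.

Lemma straight_end e : (n e.1 < n e.2)%N -> curve straight e (height e.2) = abscissa e.2.
Proof.
by rewrite -height_lt => lt /=; rewrite divfK ?subr_eq0 ?gt_eqF// addrC subrK.
Qed.

Lemma abscissa_bounds v : v \in verts G ->
  height v ^+ 2 <= abscissa v <= width - height v ^+ 2 .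
Proof.
move=> vG; have [_ bnd _] := vn.
have h1 : 0 <= height v by rewrite ler0n.
have h2 : height v <= #|verts G|%:R by rewrite ler_nat ltnW// bnd.
have : height v ^+ 2 <= #|verts G|%:R ^+ 2 by rewrite ler_sqr ?nnegrE ?ler0n.
by rewrite /abscissa /width; case: ifP => _; lra.
Qed.

Lemma straight_scaled e y : (n e.1 < n e.2)%N ->
  curve straight e y * (height e.2 - height e.1) =
  abscissa e.1 * (height e.2 - y) + abscissa e.2 * (y - height e.1).
Proof.
rewrite -height_lt => lt /=; have : height e.2 - height e.1 != 0.
  by rewrite subr_eq0 gt_eqF.
move: (abscissa _) (abscissa _) (height _) (height _) => x1 x2 h2 h1 ne.
by field.
Qed.

Lemma straight_left e v : inG e -> v \in A -> (n e.1 < n v < n e.2)%N ->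
  abscissa v < curve straight e (height v).
Proof.
move=> /andP[e1 e2] vA /andP[]; rewrite -!height_lt => lt1 lt2.
have /andP[b1 _] := abscissa_bounds e1; have /andP[b2 _] := abscissa_bounds e2.
have lt : 0 < height e.2 - height e.1 by rewrite subr_gt0; exact: lt_trans lt2.
rewrite -(ltr_pM2r lt) straight_scaled -?height_lt ?(lt_trans lt1)// {1}/abscissa vA.
exact: chord_above_parabola.
Qed.

Lemma straight_right e v : inG e -> v \notin A -> (n e.1 < n v < n e.2)%N ->
  curve straight e (height v) < abscissa v.
Proof.
move=> /andP[e1 e2] vA /andP[]; rewrite -!height_lt => lt1 lt2.
have /andP[_ b1] := abscissa_bounds e1; have /andP[_ b2] := abscissa_bounds e2.
have lt : 0 < height e.2 - height e.1 by rewrite subr_gt0; exact: lt_trans lt2.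
rewrite -(ltr_pM2r lt) straight_scaled -?height_lt ?(lt_trans lt1)// {3}/abscissa (negbTE vA).
rewrite lerBrDr addrC -lerBrDr in b1; rewrite lerBrDr addrC -lerBrDr in b2.
by have := chord_above_parabola b1 b2 lt1 lt2; lra.
Qed.

Let slt e f y := curve straight e y < curve straight f y.

Lemma notA_B v : v \in verts G -> v \notin A -> v \in B.
Proof. by move=> /(ts_cover ts) /orP[->|//]. Qed.

Lemma straight_starts e f : inG e -> inG f -> n e.1 != n f.1 ->
  (n e.1 < n f.2)%N -> (n f.1 < n e.2)%N ->
  let y := Num.max (height e.1) (height f.1) in
  starts_left A B n f e /\ slt f e y \/ starts_left A B n e f /\ slt e f y.
Proof.
move=> eG fG ef ef' fe'; have /andP[e1 _] := eG; have /andP[f1 _] := fG.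
rewrite /= /slt /starts_left; move: ef; rewrite neq_ltn => /orP[lt|lt].
  rewrite max_r; last by rewrite ltW// height_lt.
  rewrite straight_start; have [fA|fA] := boolP (f.1 \in A).
    by left; rewrite lt straight_left// lt.
  by right; rewrite lt notA_B// orbT straight_right// lt.
rewrite max_l; last by rewrite ltW// height_lt.
rewrite straight_start; have [eA|eA] := boolP (e.1 \in A).
  by right; rewrite lt straight_left// lt.
by left; rewrite lt notA_B// orbT straight_right// lt.
Qed.

Lemma straight_ends e f : inG e -> inG f -> (n e.1 < n e.2)%N -> (n f.1 < n f.2)%N ->
  n e.2 != n f.2 -> (n e.1 < n f.2)%N -> (n f.1 < n e.2)%N ->
  let y := Num.min (height e.2) (height f.2) in
  ends_left A B n f e /\ slt f e y \/ ends_left A B n e f /\ slt e f y.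
Proof.
move=> eG fG eu fu ef ef' fe'; have /andP[_ e2] := eG; have /andP[_ f2] := fG.
rewrite /= /slt /ends_left; move: ef; rewrite neq_ltn => /orP[lt|lt].
  rewrite min_l; last by rewrite ltW// height_lt.
  rewrite straight_end//; have [eA|eA] := boolP (e.2 \in A).
    by right; rewrite lt straight_left// lt andbT.
  by left; rewrite lt notA_B// orbT straight_right// lt andbT.
rewrite min_r; last by rewrite ltW// height_lt.
rewrite straight_end//; have [fA|fA] := boolP (f.2 \in A).
  by left; rewrite lt straight_left// lt andbT.
by right; rewrite lt notA_B// orbT straight_right// lt andbT.
Qed.

Lemma straight_meet_sign e f y y1 y2 : curve straight e y = curve straight f y ->
  y1 < y -> y < y2 -> slt e f y1 = slt f e y2.
Proof.
have [a [b eE]] := straight_affine e; have [c [d fE]] := straight_affine f.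
by rewrite /slt !eE !fE => eq lt1 lt2; apply/idP/idP => h; nra.
Qed.

Lemma straight_meet_eq e f y y1 y2 : curve straight e y = curve straight f y ->
  y1 != y -> curve straight e y1 = curve straight f y1 ->
  curve straight e y2 = curve straight f y2.
Proof.
have [a [b eE]] := straight_affine e; have [c [d fE]] := straight_affine f.
rewrite !eE !fE => eq neq eq1.
have /eqP : (b - d) * (y1 - y) = 0 by lra.
rewrite mulf_eq0 (subr_eq0 y1) (negbTE neq) orbF subr_eq0 => /eqP bd.
by rewrite bd in eq *; lra.
Qed.

(** The difference of two affine functions vanishes once and changes sign there, unless it is
    identically zero; a common tail or head would force the latter, which strict convexity at the
    other ends excludes. *)
Lemma straight_meet e f y : inG e -> inG f -> (n e.1 < n e.2)%N -> (n f.1 < n f.2)%N ->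
  e != f -> meet_at straight e f y ->
  [/\ n e.1 != n f.1, n e.2 != n f.2, (n e.1 < n f.2)%N, (n f.1 < n e.2)%N &
   starts_left A B n f e /\ ends_left A B n e f \/
   starts_left A B n e f /\ ends_left A B n f e].
Proof.
have [inj _ _] := vn.
move=> eG fG eu fu ef [ey0 fy0 eq].
have /andP[ey ye] : height e.1 < y < height e.2 := ey0.
have /andP[fy yf] : height f.1 < y < height f.2 := fy0.
have ef' : (n e.1 < n f.2)%N by rewrite -height_lt; exact: lt_trans yf.
have fe' : (n f.1 < n e.2)%N by rewrite -height_lt; exact: lt_trans ye.
have maxy : Num.max (height e.1) (height f.1) < y by rewrite gt_max ey.
have miny : y < Num.min (height e.2) (height f.2) by rewrite lt_min ye.
have /andP[e1 e2] := eG; have /andP[f1 f2] := fG.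
have n1 : n e.1 != n f.1.
  apply: contra ef => /eqP /inj ef1; have {}ef1 := ef1 e1 f1.
  have all y2 : curve straight e y2 = curve straight f y2.
    apply: (@straight_meet_eq e f y (height e.1) _ eq); first by rewrite lt_eqF.
    by rewrite straight_start ef1 straight_start.
  have [/inj ef2|n2] := eqVneq (n e.2) (n f.2).
    by rewrite [e]surjective_pairing ef1 (ef2 e2 f2) -surjective_pairing.
  by case: (straight_ends eG fG eu fu n2 ef' fe') => -[_]; rewrite /slt all ltxx.
have st := straight_starts eG fG n1 ef' fe'.
have n2 : n e.2 != n f.2.
  apply/eqP => /inj ef2; have {}ef2 := ef2 e2 f2.
  have all y2 : curve straight e y2 = curve straight f y2.
    apply: (@straight_meet_eq e f y (height e.2) _ eq); first by rewrite gt_eqF.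
    by rewrite straight_end// ef2 straight_end.
  by case: st => -[_]; rewrite /slt all ltxx.
split=> //; have en := straight_ends eG fG eu fu n2 ef' fe'.
have sgn1 := @straight_meet_sign e f y _ _ eq maxy miny.
have sgn2 := @straight_meet_sign f e y _ _ (esym eq) maxy miny.
case: st => -[st s1]; case: en => -[en s2]; [|by left|by right|].
  by move: s2; rewrite /slt ltNge ltW//; rewrite sgn2 in s1.
by move: s2; rewrite /slt ltNge ltW//; rewrite sgn1 in s1.
Qed.

Let P := new_arcs G n.

Lemma arc_upward e : e \in arcs (add_arcs G P) -> inG e /\ (n e.1 < n e.2)%N.
Proof.
have [_ _ inc] := vn; case/finset.setUP => [eG|].
  by split; [exact: (ts_ends ts)|apply: inc; rewrite /adj -surjective_pairing].
by rewrite inE => /and4P[e1 e2 /eqP -> _]; split=> //; rewrite /inG e1.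
Qed.

(** Two old arcs cannot interleave, and two distinct new arcs occupy disjoint strips of height 1. In
    the mixed case the ends differ in height, so the old arc passes over the new one. *)
Lemma meet_over e f y : e \in arcs (add_arcs G P) -> f \in arcs (add_arcs G P) ->
  e != f -> meet_at straight e f y ->
  f \in P /\ e \in arcs_over G n f \/ e \in P /\ f \in arcs_over G n e.
Proof.
have [_ _ inc] := vn.
move=> eGP fGP ef m; have [eV eu] := arc_upward eGP; have [fV fu] := arc_upward fGP.
have [n1 n2 ef' fe' st] := straight_meet eV fV eu fu ef m.
have new g : g \in P -> n g.2 = (n g.1).+1 by rewrite inE => /and4P[_ _ /eqP].
case/finset.setUP: eGP => [eG|eP]; case/finset.setUP: fGP => [fG|fP].
- exfalso; case: st => -[sl el].
    exact: (no_interleaving ts inc eG fG ef' fe' sl el).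
  exact: (no_interleaving ts inc fG eG fe' ef' sl el).
- left; split=> //; rewrite inE eG /=; rewrite (new f)// in n2 ef' *.
  by apply/andP; split; clear - n1 n2 ef' fe'; lia.
- right; split=> //; rewrite inE fG /=; rewrite (new e)// in n2 fe' *.
  by apply/andP; split; clear - n1 n2 ef' fe'; lia.
- by rewrite (new e)// in fe'; rewrite (new f)// in ef'; clear - n1 ef' fe'; lia.
Qed.

Definition over_pairs : {set (T * T) * (T * T)} :=
  [set p | (p.1 \in P) && (p.2 \in arcs_over G n p.1)]%SET.

Lemma card_over_pairs : #|over_pairs| = order_cost G n.
Proof.
rewrite /order_cost -sum1_card (eq_bigl (fun p => (p.1 \in P) && (p.2 \in arcs_over G n p.1))).
  rewrite -(pair_big_dep (fun f => f \in P) (fun f e => e \in arcs_over G n f) (fun _ _ => 1%N)) /=.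
  by apply: eq_bigr => f _; rewrite sum1_card.
by move=> p; rewrite inE.
Qed.

Lemma meet_atC (D' : drawing R T) e f y : meet_at D' e f y -> meet_at D' f e y.
Proof. by case=> ? ? ?; split. Qed.

Lemma straight_crossings : finite_set (crossings straight (add_arcs G P)) /\
  (num_crossings straight (add_arcs G P) <= order_cost G n)%N.
Proof.
rewrite -card_over_pairs; apply: (card_fset_set_le (g := fun p =>
  ([set p.1; p.2]%SET, xget 0 (meet_at straight p.1 p.2)))).
have uniq f e y y' : f \in arcs (add_arcs G P) -> e \in arcs (add_arcs G P) -> f != e ->
    meet_at straight f e y -> meet_at straight f e y' -> y = y'.
  move=> fGP eGP fe m m'; have [fV fu] := arc_upward fGP; have [eV eu] := arc_upward eGP.
  have [n1 n2 ef' fe' _] := straight_meet fV eV fu eu fe m.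
  have [_ _ eq] := m; have [_ _ eq'] := m'; apply/eqP/negPn/negP => yy.
  have all z : curve straight f z = curve straight e z.
    by apply: (@straight_meet_eq f e y y' z eq _ eq'); rewrite eq_sym.
  by case: (straight_starts fV eV n1 ef' fe') => -[_]; rewrite /slt all ltxx.
have main f e y c : f \in P -> e \in arcs_over G n f -> c.1 = [set f; e]%SET ->
    c.2 = y -> meet_at straight f e y ->
    exists2 i, i \in over_pairs & c = ([set i.1; i.2]%SET, xget 0 (meet_at straight i.1 i.2)).
  move=> fP eo c1 c2 m; exists (f, e); first by rewrite inE fP.
  case: c c1 c2 => c1 c2 /= -> ->; congr pair.
  move: eo; rewrite inE => /andP[eG _].
  have fG : f \notin arcs G by move: fP; rewrite inE => /and4P[].
  apply: (uniq f e) => //.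
  - by apply/finset.setUP; right.
  - by apply/finset.setUP; left.
  - by apply: contraNneq fG => ->.
  - by have := xgetPex 0 (ex_intro _ y m).
move=> c [e [f [eGP fGP ef c1 m]]].
case: (meet_over eGP fGP ef m) => -[h1 h2].
  by apply: (main f e c.2) => //; [rewrite c1 finset.setUC|exact: meet_atC].
exact: (main e f c.2).
Qed.

Lemma straight_upward : upward_drawing straight (add_arcs G P).
Proof.
have [inj _ _] := vn; split; last by have [] := straight_crossings.
- move=> u v uG vG /= [_ /eqP]; rewrite /height eqr_nat => /eqP; exact: inj.
- move=> u v uvP; have [uvG lt] := arc_upward uvP; split.
  + by rewrite /= height_lt.
  + apply: continuous_subspaceT => y.
    have [a [b eE]] := straight_affine (u, v).
    rewrite (_ : curve straight (u, v) = fun y => a + b * y); last exact: funext.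
    by apply: cvgD; [exact: cvg_cst|apply: cvgM; [exact: cvg_cst|exact: cvg_id]].
  + exact: straight_start.
  + exact: straight_end.
- move=> e w eP wG; have [eG lt] := arc_upward eP; rewrite /= !height_lt => h.
  have [wA|wA] := boolP (w \in A); first by rewrite gt_eqF// straight_left.
  by rewrite lt_eqF// straight_right.
Qed.

Lemma straight_planar : upward_planar straight G.
Proof.
have [inj arcsP off fin] := straight_upward.
have sub e : e \in arcs G -> e \in arcs (add_arcs G P) by rewrite inE => ->.
split; first split=> //.
- by move=> u v /sub; exact: arcsP.
- by move=> e w /sub; exact: off.
- apply: sub_finite_set fin => c [e [f [/sub eG /sub fG ef c1 m]]].
  by exists e, f.
- move=> e f eG fG ef [y m].
  case: (meet_over (sub e eG) (sub f fG) ef m) => -[]; rewrite inE => /and4P[_ _ _].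
    by rewrite fG.
  by rewrite eG.
Qed.

End StraightDrawing.

(** * Crossing numbers *)

Section CrossingNumber.
Variables (R : realType) (T : finType).
Implicit Types (D X : drawing R T) (G : digraph T) (e f : T * T) (s t u v : T).
Implicit Types (pl pr : seq T) (n : T -> nat) (Q : {set T * T}).
Local Open Scope ring_scope.

Lemma planar_left_of X G e f y : upward_planar X G -> e \in arcs G -> f \in arcs G ->
  arc_span X e y -> arc_span X f y -> curve X e y < curve X f y -> left_of X e f.
Proof.
move=> up eG fG ey fy lt z ez fz; have [_ pl] := up.
have w g : vy X g.1 < z < vy X g.2 -> arc_span X g z.
  by case/andP => h1 h2; rewrite /arc_span !ltW.
rewrite lt_neqAle (planar_sign up eG fG ey fy (w _ ez) (w _ fz) lt) andbT.
apply/eqP => eq; apply: (pl e f) => //; last by exists z.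
by apply/eqP => ef; move: lt; rewrite ef ltxx.
Qed.

Lemma left_of_asym X e f : vy X e.1 < vy X e.2 -> vy X f.1 < vy X f.2 ->
  vy X e.1 < vy X f.2 -> vy X f.1 < vy X e.2 ->
  left_of X e f -> left_of X f e -> False.
Proof.
move=> e12 f12 ef fe lef lfe.
have [y h1 h2] : exists2 y, vy X e.1 < y < vy X e.2 & vy X f.1 < y < vy X f.2.
  pose a := Num.max (vy X e.1) (vy X f.1); pose b := Num.min (vy X e.2) (vy X f.2).
  have ab : a < b by rewrite gt_max !lt_min e12 ef fe f12.
  have [a1 a2] : vy X e.1 <= a /\ vy X f.1 <= a by rewrite !le_max !lexx orbT.
  have [b1 b2] : b <= vy X e.2 /\ b <= vy X f.2 by rewrite !ge_min !lexx orbT.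
  by exists ((a + b) / 2); apply/andP; split; lra.
by have := lt_trans (lef y h1 h2) (lfe y h2 h1); rewrite ltxx.
Qed.

(** For arcs with a common tail, [ends_left] decides the order in both drawings; for a common head,
    [starts_left] does. *)
Lemma straight_embedding D G A B n : two_sided D G A B -> valid_order G n ->
  same_embedding D (straight R G A n) G.
Proof.
move=> ts vn; set S := straight R G A n; have [inj _ inc] := vn.
have upS : upward_planar S G := straight_planar ts vn.
have upD := ts_planar ts.
have up X e : upward_planar X G -> e \in arcs G -> vy X e.1 < vy X e.2.
  by case: e => a b [ud _] eG; exact: arc_increasing eG.
(* The heights of such arcs overlap, so [left_of] is asymmetric on them and agreement in one
   direction gives both equivalences. *)
have key e f : e \in arcs G -> f \in arcs G -> e.1 = f.1 \/ e.2 = f.2 ->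
    left_of D e f -> left_of S e f ->
    (left_of D e f <-> left_of S e f) /\ (left_of D f e <-> left_of S f e).
  move=> eG fG ef lD lS; split=> //.
  have ov X : upward_planar X G -> vy X e.1 < vy X f.2 /\ vy X f.1 < vy X e.2.
    move=> uX; have := up X e uX eG; have := up X f uX fG.
    by case: ef => ->.
  have [[d1 d2] [s1 s2]] := (ov D upD, ov S upS).
  by split=> h; [case: (@left_of_asym D e f)|case: (@left_of_asym S e f)] => //; exact: up.
move=> e f eG fG ef.
have [<-|nef] := eqVneq e f.
  split=> h; [case: (@left_of_asym D e e)|case: (@left_of_asym S e e)] => //; exact: up.
have [eV fV] := (ts_ends ts eG, ts_ends ts fG).
have nup g : g \in arcs G -> (n g.1 < n g.2)%N by case: g => a b; exact: inc.
have /andP[e1 e2] := eV; have /andP[f1 f2] := fV.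
suff [h|h] : (left_of D e f /\ left_of S e f) \/ (left_of D f e /\ left_of S f e).
- by have [] := key e f eG fG ef h.1 h.2.
- have fe : f.1 = e.1 \/ f.2 = e.2 by case: ef => ->; [left|right].
  by have [] := key f e fG eG fe h.1 h.2.
have vyD g h : g \in arcs G -> h \in arcs G -> g.1 = h.1 \/ g.2 = h.2 ->
    vy D g.1 < vy D h.2 /\ (n g.1 < n h.2)%N.
  by move=> gG hG [->|<-]; split; rewrite ?up ?nup.
have fe : f.1 = e.1 \/ f.2 = e.2 by case: ef => ->; [left|right].
have [d1 n1] := vyD e f eG fG ef; have [d2 n2] := vyD f e fG eG fe.
have eS := span_start upS.1 eG; have eS' := span_end upS.1 eG.
have fS := span_start upS.1 fG; have fS' := span_end upS.1 fG.
have sS g h : g \in arcs G -> h \in arcs G -> (n g.1 < n h.2)%N -> (n h.1 < n g.2)%N ->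
    arc_span S g (Num.max (vy S g.1) (vy S h.1)) /\ arc_span S g (Num.min (vy S g.2) (vy S h.2)).
  move=> gG hG gh hg; have l1 : vy S g.1 < vy S h.2 by rewrite ltr_nat.
  have l2 : vy S h.1 < vy S g.2 by rewrite ltr_nat.
  have := up S g upS gG.
  rewrite /arc_span le_max lexx ge_max le_min ge_min lexx !(ltW l1) !(ltW l2) /= andbT.
  by move/ltW => ->.
have [ma mi] := sS e f eG fG n1 n2; have [ma' mi'] := sS f e fG eG n2 n1.
rewrite maxC in ma'; rewrite minC in mi'.
case: (ef) => eqv.
- have nn : n e.2 != n f.2.
    apply: contra nef => /eqP/inj eqv'.
    by rewrite [e]surjective_pairing eqv eqv' // -surjective_pairing.
  case: (straight_ends ts vn eV fV (nup e eG) (nup f fG) nn n1 n2) => -[el lt].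
    right; split; last exact: planar_left_of upS fG eG mi' mi lt.
    have [y [ey fy] lt'] := ends_leftP ts inc eG fG d1 d2 el.
    exact: planar_left_of upD fG eG fy ey lt'.
  left; split; last exact: planar_left_of upS eG fG mi mi' lt.
  have [y [fy ey] lt'] := ends_leftP ts inc fG eG d2 d1 el.
  exact: planar_left_of upD eG fG ey fy lt'.
- have nn : n e.1 != n f.1.
    apply: contra nef => /eqP/inj eqv'.
    by rewrite [e]surjective_pairing eqv eqv' // -surjective_pairing.
  case: (straight_starts ts vn eV fV nn n1 n2) => -[el lt].
    right; split; last exact: planar_left_of upS fG eG ma' ma lt.
    have [y [ey fy] lt'] := starts_leftP ts inc eG fG d1 d2 el.
    exact: planar_left_of upD fG eG fy ey lt'.
  left; split; last exact: planar_left_of upS eG fG ma ma' lt.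
  have [y [fy ey] lt'] := starts_leftP ts inc fG eG d2 d1 el.
  exact: planar_left_of upD eG fG ey fy lt'.
Qed.

Lemma straight_preserving D G A B n : two_sided D G A B -> valid_order G n ->
  preserving_drawing D G (new_arcs G n) (straight R G A n).
Proof.
move=> ts vn; split.
- exact: straight_upward ts vn.
- exact: straight_planar ts vn.
- exact: straight_embedding ts vn.
Qed.

Lemma set2_inj (U : finType) (S : {set U}) (a b c d : U) :
  a \notin S -> c \notin S -> b \in S -> d \in S ->
  [set a; b]%SET = [set c; d]%SET -> a = c /\ b = d.
Proof.
move=> aS cS bS dS eq.
have : a \in [set c; d]%SET by rewrite -eq !inE eqxx.
have : b \in [set c; d]%SET by rewrite -eq !inE eqxx orbT.
rewrite !inE => /orP[/eqP bc|/eqP->]; first by rewrite -bc bS in cS.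
by move=> /orP[/eqP->//|/eqP ad]; rewrite ad dS in aS.
Qed.

(** Heights of [X] increase along [n], so [e] spans the heights of any new arc [f] that it passes
    over. As [f] joins a leftmost and a rightmost vertex, it changes sides of [e]. Different pairs
    give different crossings, since only one member of the unordered pair is in G. *)
Lemma crossings_lower_bound D X G s t pl pr n :
  outerplanar_st D G s t pl pr -> valid_order G n ->
  preserving_drawing D G (new_arcs G n) X ->
  (order_cost G n <= num_crossings X (add_arcs G (new_arcs G n)))%N.
Proof.
move=> op vn [ud up emb].
have ts := two_sided_preserved op up emb.
have [_ _ [[pthl _] _] [[pthr _] _] cov] := op.
have [tl tr] := (path_tight pthl, path_tight pthr).
have vylt u v : u \in verts G -> v \in verts G -> (n u < n v)%N -> vy X u < vy X v.
  move=> uG vG uv; case: (connect_vy ud (order_path_connect vn uG vG uv)) => // eq.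
  by move: uv; rewrite eq ltnn.
have meets f e : f \in new_arcs G n -> e \in arcs_over G n f -> exists y, meet_at X f e y.
  move=> fP; rewrite inE => /and3P[eG l1 l2].
  have /andP[e1 e2] := ts_ends ts eG.
  have [f1 f2] : f.1 \in verts G /\ f.2 \in verts G.
    by move: fP; rewrite inE => /and4P[].
  have fup : vy X f.1 < vy X f.2.
    by apply: vylt => //; move: fP; rewrite inE => /and4P[_ _ /eqP -> _].
  have {}l1 := vylt _ _ e1 f1 l1; have {}l2 := vylt _ _ f2 e2 l2.
  have eGP : e \in arcs (add_arcs G (new_arcs G n)) by apply/finset.setUP; left.
  have fGP : f \in arcs (add_arcs G (new_arcs G n)) by apply/finset.setUP; right.
  have b1 : vy X e.1 < vy X f.1 < vy X e.2 by rewrite l1 (lt_trans fup).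
  have b2 : vy X e.1 < vy X f.2 < vy X e.2 by rewrite l2 (lt_trans l1).
  have sp y : vy X e.1 < y < vy X e.2 -> arc_span X e y.
    by case/andP => h1 h2; rewrite /arc_span !ltW.
  have sf1 := span_start ud fGP; have sf2 := span_end ud fGP.
  case: (new_arc_sides vn tl tr cov fP) => -[s1 _ s2 _].
    have [||c _ m] := meet_between ud fGP eGP sf1 (sp _ b1) sf2 (sp _ b2).
    - rewrite (curve_start ud fGP); apply: leftmost_lt up.1 f1 _ eG b1.
      exact: (ts_left ts s1).
    - rewrite (curve_end ud fGP); apply: rightmost_lt up.1 f2 _ eG b2.
      exact: (ts_right ts s2).
    - by exists c.
  have [||c _ m] := meet_between ud fGP eGP sf2 (sp _ b2) sf1 (sp _ b1).
  - rewrite (curve_end ud fGP); apply: leftmost_lt up.1 f2 _ eG b2.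
    exact: (ts_left ts s2).
  - rewrite (curve_start ud fGP); apply: rightmost_lt up.1 f1 _ eG b1.
    exact: (ts_right ts s1).
  - by exists c.
rewrite -card_over_pairs; apply: (card_fset_set_ge (g := fun p =>
  ([set p.1; p.2]%SET, xget 0 (meet_at X p.1 p.2)))).
- by case: ud.
- have nG f : f \in new_arcs G n -> f \notin arcs G by rewrite inE => /and4P[].
  have oG e f : e \in arcs_over G n f -> e \in arcs G by rewrite inE => /andP[].
  have pP p : p \in over_pairs G n -> p.1 \notin arcs G /\ p.2 \in arcs G.
    by rewrite inE => /andP[/nG -> /oG ->].
  move=> [f e] [f' e'] /pP[/= h1 h2] /pP[/= h3 h4] [eq _].
  by have [-> ->] := set2_inj h1 h3 h2 h4 eq.
- move=> [f e]; rewrite inE /= => /andP[fP eo]; have [y m] := meets f e fP eo.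
  exists f, e; split.
  + by apply/finset.setUP; right.
  + by apply/finset.setUP; left; move: eo; rewrite inE => /andP[].
  + by apply: contraTneq fP => ->; move: eo; rewrite !inE => /andP[-> _]; rewrite !andbF.
  + by [].
  + by have := xgetPex 0 (ex_intro _ y m).
Qed.

End CrossingNumber.

(** A set convex for reachability meets a path in a contiguous segment. *)
Lemma filter_convex_path (T : finType) (e : rel T) x (p : seq T) (A : pred T) :
  path e x p ->
  (forall u v w, u \in p -> v \in p -> w \in p -> A u -> A w ->
     connect e u v -> connect e v w -> A v) ->
  sorted e [seq v <- p | A v].
Proof.
elim: p x => [|y p IH] x //= /andP[_ pth] conv.
have srt : sorted e [seq v <- p | A v].
  apply: (IH y) => // u v w up vp wp; apply: conv; by rewrite in_cons ?up ?vp ?wp orbT.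
case: ifP => // Ay /=; case: p pth conv srt {IH} => [|y2 p] //= /andP[yy2 pth] conv.
case: ifP => [Ay2 /= ->|nA _]; first by rewrite yy2.
rewrite (_ : [seq v <- p | A v] = [::])//; apply/eqP; rewrite -(negbK (_ == _)) -has_filter.
apply/hasPn => w wp; apply/negP => Aw; case/negP: (negbT nA).
apply: (conv y y2 w) => //; rewrite ?in_cons ?eqxx ?wp ?orbT//; first exact: connect1.
by apply: (path_connect pth); rewrite in_cons wp orbT.
Qed.

(** * Maximal polygons *)

Section Interval.
Variables (R : realType) (T : finType) (G : digraph T).
Implicit Types (D : drawing R T) (H : digraph T) (e f g : T * T).
Implicit Types (s t a b u v w : T) (p pl pr plH prH : seq T) (y : R).
Local Open Scope ring_scope.

Lemma on_arc D e w : upward_drawing D G -> e \in arcs G -> w \in verts G ->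
  e.1 \in verts G -> e.2 \in verts G ->
  arc_span D e (vy D w) -> curve D e (vy D w) = vx D w -> w = e.1 \/ w = e.2.
Proof.
move=> ud eG wG e1 e2 /andP[]; rewrite le_eqVlt => /predU1P[eq _ c|lt1].
  left; apply/eqP/negPn/negP => ne; have := vertex_neq ud wG e1 ne (esym eq).
  by rewrite -c -eq (curve_start ud eG) eqxx.
rewrite le_eqVlt => /predU1P[eq c|lt2 c].
  right; apply/eqP/negPn/negP => ne; have := vertex_neq ud wG e2 ne eq.
  by rewrite -c eq (curve_end ud eG) eqxx.
by have := off_arc ud eG wG; rewrite lt1 lt2 c eqxx => /(_ isT).
Qed.

Definition between a b v := [&& v \in verts G, connect (adj G) a v & connect (adj G) v b].

Definition st_interval a b : digraph T := Digraph [set v | between a b v]%SET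
  [set e in arcs G | between a b e.1 && between a b e.2]%SET.

Definition inside a b (S : seq T) v := [&& between a b v, v != a, v != b & v \in S].

Section Fixed.
Variables (s t a b : T) (H : digraph T).

(** The sides are parameters so that [polygon_setup_mirror] carries each result about the left side
    over to the right one. *)
Record polygon_setup D pl pr plH prH : Prop := PolygonSetup {
  ps_outer : outerplanar_st D G s t pl pr;
  ps_sub : subdigraph H G;
  ps_poly : st_polygon D H a b plH prH;
  ps_arcs : forall e, e \in arcs G ->
    (arc_points D e `<=` region D a b plH prH)%classic -> e \in arcs H }.

Lemma polygon_setup_mirror D pl pr plH prH : polygon_setup D pl pr plH prH ->
  polygon_setup (mirror D) pr pl prH plH.
Proof.
case=> op sub po ar; split=> //.
- exact: outerplanar_mirror.
- exact: st_polygon_mirror.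
- move=> e eG h; apply: ar => // z [ez zc].
  have [|h1 h2 h3] := h (flipx z); first by split; rewrite //= zc.
  split=> //; first by have := proj1 (left_of_mirror _ _ _ _) h3; rewrite flipxK.
  by have := proj1 (right_of_mirror _ _ _ _) h2; rewrite flipxK.
Qed.

Section Left.
Variables (D : drawing R T) (pl pr plH prH : seq T).
Hypothesis ps : polygon_setup D pl pr plH prH.

Let op := ps_outer ps.
Let ts := outerplanar_two_sided op.
Let up := ts_planar ts.
Let ud := up.1.
Let ends := ts_ends ts.

Lemma between_vy v : between a b v -> vy D a <= vy D v <= vy D b.
Proof. by case/and3P => _ av vb; rewrite !(connect_vy_le ud). Qed.

Lemma between_vy_start v : between a b v -> v != a -> vy D a < vy D v.
Proof.
by case/and3P => _ av _ va; case: (connect_vy ud av) va => [->|//]; rewrite eqxx.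
Qed.

Lemma between_vy_end v : between a b v -> v != b -> vy D v < vy D b.
Proof.
by case/and3P => _ _ vb vb'; case: (connect_vy ud vb) vb' => [->|//]; rewrite eqxx.
Qed.

Lemma sub_connect u v : connect (adj H) u v -> connect (adj G) u v.
Proof.
apply: connect_sub => x z xz; apply: connect1; have [_ /fintype.subsetP] := ps_sub ps.
by apply.
Qed.

Let poly_op : outerplanar_st D H a b plH prH. Proof. by case: (ps_poly ps). Qed.
Let udH : upward_drawing D H. Proof. by case: poly_op => _ []. Qed.
Let stH : st_digraph H a b. Proof. by case: poly_op. Qed.

Lemma polygon_between v : v \in verts H -> between a b v.
Proof.
move=> vH; apply/and3P; split.
- by have [/fintype.subsetP/(_ v vH)] := ps_sub ps.
- exact: sub_connect (source_connect udH stH vH).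
- exact: sub_connect (sink_connect udH stH vH).
Qed.

Lemma sub_path_adj x p : path (adj H) x p -> path (adj G) x p.
Proof. by apply: sub_path => u v; have [_ /fintype.subsetP] := ps_sub ps; apply. Qed.

Lemma polygon_ends : a \in verts H /\ b \in verts H.
Proof. by have [_ _ /(_ a)[_ /(_ erefl)[]] ] := stH; have [_ _ _ /(_ b)[_ /(_ erefl)[]] ] := stH. Qed.

Lemma side_verts p v : path (adj H) a p -> v \in a :: p -> v \in verts H.
Proof.
move=> pth; rewrite in_cons => /orP[/eqP->|/(path_arcs_pred a)[u up']].
  by case: polygon_ends.
by have [e _ _ _] := stH; have /andP[] := e _ (path_arcs_arcs pth up').
Qed.

Lemma inner_between p v : path (adj H) a p -> v \in inner_verts a b p ->
  [/\ between a b v, v != a & v != b].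
Proof.
by move=> pth; rewrite inE => /and3P[/(side_verts pth)/polygon_between].
Qed.

Let pthl : path (adj H) a plH /\ last a plH = b.
Proof. by case: poly_op => _ _ [[]]. Qed.
Let pthr : path (adj H) a prH /\ last a prH = b.
Proof. by case: poly_op => _ _ _ [[]]. Qed.

Lemma side_span p v : path (adj H) a p -> last a p = b ->
  (0 < #|inner_verts a b p|)%N -> between a b v ->
  exists2 g, g \in path_arcs a p & arc_span D g (vy D v).
Proof.
move=> pth lst inn bv; apply: (path_span ud (sub_path_adj pth)).
  by rewrite lst; exact: between_vy.
apply: contraTneq inn => ->; rewrite -leqNgt leqn0 cards_eq0; apply/eqP/setP => w.
by rewrite !inE; case: (w == a).
Qed.

Lemma mem_arc_side p g v : g \in path_arcs a p -> v = g.1 \/ v = g.2 -> v \in a :: p.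
Proof.
by move=> /path_arcs_mem[h1 h2] [->//|->]; rewrite in_cons h2 orbT.
Qed.

(** Were [v] on the right side of G, nothing could be drawn to its right, so the right side of [H]
    would pass through [v], against disjointness. *)
Lemma polygon_left_inner v : v \in inner_verts a b plH ->
  v \notin s :: pr /\ v \in s :: pl.
Proof.
move=> vi; have [bv va vb] := inner_between pthl.1 vi.
have vG : v \in verts G by case/and3P: bv.
suff vR : v \notin s :: pr.
  by split=> //; have := ts_cover ts vG; rewrite (negbTE vR) orbF.
apply/negP => vR; case: (ps_poly ps) => _ _ ir dis _.
have [g gp gv] := side_span pthr.1 pthr.2 ir bv.
have gG := path_arcs_arcs (sub_path_adj pthr.1) gp.
have le1 := rightmost_span (ts_right ts vR) gG gv.
have le2 : vx D v <= curve D g (vy D v).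
  have [_ _ _ [_ h] _] := poly_op; apply: (h (vertex_point D v)) gp gv.
  left; exists v => //; apply: side_verts pthl.1 _.
  by move: vi; rewrite inE => /andP[].
have /andP[g1 g2] := ends gG.
have eq : curve D g (vy D v) = vx D v by apply/eqP; rewrite eq_le le1.
have vr := mem_arc_side gp (on_arc ud gG vG g1 g2 gv eq).
by have := disjointFr dis vi; rewrite inE vr va vb.
Qed.

(** At the height of a vertex on both sides of G nothing else is drawn, so both sides of [H] would
    contain it. *)
Lemma inside_exclusive v : inside a b (s :: pl) v -> v \notin s :: pr.
Proof.
move=> /and4P[bv va vb vL]; apply/negP => vR.
have vG : v \in verts G by case/and3P: bv.
case: (ps_poly ps) => _ il ir dis _.
have on p : path (adj H) a p -> last a p = b -> (0 < #|inner_verts a b p|)%N ->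
    v \in inner_verts a b p.
  move=> pth lst inn; have [g gp gv] := side_span pth lst inn bv.
  have gG := path_arcs_arcs (sub_path_adj pth) gp; have /andP[g1 g2] := ends gG.
  rewrite inE va vb !andbT; apply: mem_arc_side gp (on_arc ud gG vG g1 g2 gv _).
  apply/eqP; rewrite eq_le (rightmost_span (ts_right ts vR) gG gv).
  exact: (leftmost_span (ts_left ts vL) gG gv).
have := on _ pthr.1 pthr.2 ir.
by rewrite (disjointFr dis (on _ pthl.1 pthl.2 il)).
Qed.

Lemma polygon_inner_inside v : v \in inner_verts a b plH -> inside a b (s :: pl) v.
Proof.
move=> vi; have [bv va vb] := inner_between pthl.1 vi.
by have [_ vL] := polygon_left_inner vi; apply/and4P.
Qed.

(** An arc [f] strictly left of [g] cannot pass to the left of an inner vertex of [p], which is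
    leftmost; nor can it have an end at an inner height of [g] that is on the right side of G or on
    [p]. It is used both for the side of [H] and for that of the interval. *)
Lemma left_of_side p f g y : path (adj G) a p -> last a p = b ->
  (forall v, v \in a :: p -> [|| v == a, v == b | inside a b (s :: pl) v]) ->
  f \in arcs G -> between a b f.1 -> between a b f.2 ->
  g \in path_arcs a p -> arc_span D g y -> arc_span D f y ->
  curve D f y < curve D g y ->
  (f.1 = g.1 \/ f.1 \notin s :: pr /\ f.1 \notin a :: p) /\
  (f.2 = g.2 \/ f.2 \notin s :: pr /\ f.2 \notin a :: p).
Proof.
move=> pth lst pin fG bf1 bf2 gp gy fy lt.
have gG := path_arcs_arcs pth gp.
have /andP[g1G g2G] := ends gG; have /andP[f1G f2G] := ends fG.
have [g1p g2p'] := path_arcs_mem gp.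
have g2p : g.2 \in a :: p by rewrite in_cons g2p' orbT.
have gup : vy D g.1 < vy D g.2 by case: (g) gG => x z; exact: arc_increasing.
have fup : vy D f.1 < vy D f.2 by case: (f) fG => x z; exact: arc_increasing.
have le := planar_sign up fG gG fy gy _ _ lt.
have [gy1 gy2] := andP gy; have [fy1 fy2] := andP fy.
have bp v : v \in a :: p -> between a b v.
  move=> vp; case/or3P: (pin v vp) => [/eqP->|/eqP->|/and4P[]//];
    by apply: polygon_between; case: polygon_ends.
have inL v : v \in a :: p -> v != a -> v != b -> v \in s :: pl.
  by move=> /pin /or3P[->|->|/and4P[]].
have [sg1 sg2] := (span_start ud gG, span_end ud gG).
have [sf1 sf2] := (span_start ud fG, span_end ud fG).
have [cg1 cg2] := (curve_start ud gG, curve_end ud gG).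
have [cf1 cf2] := (curve_start ud fG, curve_end ud fG).
split.
- case: (ltgtP (vy D f.1) (vy D g.1)) => [lt1|lt1|eq1].
  + have g1a : g.1 != a.
      by apply: contraTneq lt1 => ->; rewrite -leNgt; have /andP[] := between_vy bf1.
    have g1b : g.1 != b.
      by apply: contraTneq gup => ->; rewrite -leNgt; have /andP[] := between_vy (bp _ g2p).
    have sfg : arc_span D f (vy D g.1) by rewrite /arc_span ltW//= (le_trans gy1).
    have le1 := leftmost_span (ts_left ts (inL _ g1p g1a g1b)) fG sfg.
    have eq : curve D f (vy D g.1) = vx D g.1.
      by apply/eqP; rewrite eq_le le1 andbT -cg1 le.
    case: (on_arc ud fG g1G f1G f2G sfg eq) => e; first by move: lt1; rewrite e ltxx.
    have ye : y = vy D f.2 by apply/eqP; rewrite eq_le fy2 -e.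
    by move: lt; rewrite ye cf2 -e cg1 ltxx.
  + have sgf : arc_span D g (vy D f.1) by rewrite /arc_span ltW//= (le_trans fy1).
    right; split; apply/negP => f1m.
      have le1 := rightmost_span (ts_right ts f1m) gG sgf.
      have eq : curve D g (vy D f.1) = vx D f.1.
        by apply/eqP; rewrite eq_le le1 -cf1 le.
      case: (on_arc ud gG f1G g1G g2G sgf eq) => e; first by move: lt1; rewrite e ltxx.
      have ye : y = vy D f.1 by apply/eqP; rewrite eq_le fy1 e gy2.
      by move: lt; rewrite ye cf1 e cg2 ltxx.
    case: (path_arcs_cmp pth gp f1m) => c.
      by move: lt1; rewrite ltNge (connect_vy_le ud c).
    have ye : y = vy D f.1.
      by apply/eqP; rewrite eq_le fy1 (le_trans gy2)// (connect_vy_le ud c).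
    case: (connect_vy ud c) => [e|]; last by rewrite -ye ltNge gy2.
    by move: lt; rewrite ye cf1 -e cg2 ltxx.
  + left; apply/eqP/negPn/negP => ne.
    have g1a : g.1 != a.
      apply: contra ne => /eqP ga; apply/negPn/negP => ne.
      by have := between_vy_start bf1; rewrite -ga ne eq1 ltxx => /(_ isT).
    have g1b : g.1 != b.
      by apply: contraTneq gup => ->; rewrite -leNgt; have /andP[] := between_vy (bp _ g2p).
    have := leftmost_vertex ud g1G f1G (ts_left ts (inL _ g1p g1a g1b)).
    rewrite eq_sym ne -eq1 => /(_ isT erefl); rewrite ltNge -cf1.
    have := le (vy D f.1) sf1; rewrite eq1 cg1 => /(_ sg1).
    by rewrite -eq1 => ->.
- case: (ltgtP (vy D f.2) (vy D g.2)) => [lt2|lt2|eq2].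
  + have sgf : arc_span D g (vy D f.2) by rewrite /arc_span (le_trans gy1)//= ltW.
    right; split; apply/negP => f2m.
      have le1 := rightmost_span (ts_right ts f2m) gG sgf.
      have eq : curve D g (vy D f.2) = vx D f.2.
        by apply/eqP; rewrite eq_le le1 -cf2 le.
      case: (on_arc ud gG f2G g1G g2G sgf eq) => e; last by move: lt2; rewrite e ltxx.
      have ye : y = vy D f.2 by apply/eqP; rewrite eq_le fy2 e gy1.
      by move: lt; rewrite ye cf2 e cg1 ltxx.
    case: (path_arcs_cmp pth gp f2m) => c; last first.
      by move: lt2; rewrite ltNge (connect_vy_le ud c).
    have ye : y = vy D f.2.
      by apply/eqP; rewrite eq_le fy2 (le_trans _ gy1)// (connect_vy_le ud c).
    case: (connect_vy ud c) => [e|]; last by rewrite -ye ltNge gy1.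
    by move: lt; rewrite ye cf2 e cg1 ltxx.
  + have g2b : g.2 != b.
      by apply: contraTneq lt2 => ->; rewrite -leNgt; have /andP[] := between_vy bf2.
    have g2a : g.2 != a.
      by apply: contraTneq gup => ->; rewrite -leNgt; have /andP[] := between_vy (bp _ g1p).
    have sfg : arc_span D f (vy D g.2) by rewrite /arc_span (le_trans fy1)//= ltW.
    have le1 := leftmost_span (ts_left ts (inL _ g2p g2a g2b)) fG sfg.
    have eq : curve D f (vy D g.2) = vx D g.2.
      by apply/eqP; rewrite eq_le le1 andbT -cg2 le.
    case: (on_arc ud fG g2G f1G f2G sfg eq) => e; last by move: lt2; rewrite e ltxx.
    have ye : y = vy D f.1 by apply/eqP; rewrite eq_le fy1 -e gy2.
    by move: lt; rewrite ye cf1 -e cg2 ltxx.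
  + left; apply/eqP/negPn/negP => ne.
    have g2b : g.2 != b.
      apply: contra ne => /eqP ga; apply/negPn/negP => ne.
      by have := between_vy_end bf2; rewrite -ga ne eq2 ltxx => /(_ isT).
    have g2a : g.2 != a.
      by apply: contraTneq gup => ->; rewrite -leNgt; have /andP[] := between_vy (bp _ g1p).
    have := leftmost_vertex ud g2G f2G (ts_left ts (inL _ g2p g2a g2b)).
    rewrite eq_sym ne -eq2 => /(_ isT erefl); rewrite ltNge -cf2.
    have := le (vy D f.2) sf2; rewrite eq2 cg2 => /(_ sg2).
    by rewrite -eq2 => ->.
Qed.

(** The future left side of the interval: the part of the left side of G strictly between [a] and
    [b]. Its first vertex [a] is left out, as in [dipath]. *)
Definition side_path : seq T := rcons [seq v <- pl | inside a b (s :: pl) v] b.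

Lemma inside_mem v : inside a b (s :: pl) v -> v \in [seq v <- pl | inside a b (s :: pl) v].
Proof.
move=> iv; rewrite mem_filter iv /=; have /and4P[bv va _] := iv.
rewrite in_cons => /orP[/eqP vs|//].
have aG : a \in verts G by case/and3P: (polygon_between polygon_ends.1).
have := connect_vy_le ud (source_connect ud (let: And5 st _ _ _ _ := op in st) aG).
by rewrite -vs leNgt between_vy_start.
Qed.

Lemma mem_side_path v :
  (v \in a :: side_path) = [|| v == a, v == b | inside a b (s :: pl) v].
Proof.
rewrite in_cons mem_rcons in_cons; congr [|| _, _ | _].
by apply/idP/idP => [|/inside_mem//]; rewrite mem_filter => /andP[].
Qed.

Lemma inner_side_path v : (v \in inner_verts a b side_path) = inside a b (s :: pl) v.
Proof.
rewrite inE mem_side_path; case: eqP => [->|va] /=; first by rewrite /inside eqxx andbF.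
case: eqP => [->|vb] /=; first by rewrite /inside eqxx !andbF.
by rewrite andbT.
Qed.

Lemma inside_connect u v w : v \in pl -> inside a b (s :: pl) u -> inside a b (s :: pl) w ->
  connect (adj G) u v -> connect (adj G) v w -> inside a b (s :: pl) v.
Proof.
move=> vpl iu iw uv vw; have /and4P[bu ua _ _] := iu; have /and4P[bw _ wb _] := iw.
have [pth _] : path (adj G) s pl /\ last s pl = t by case: op => _ _ [[]].
apply/and4P; split.
- apply/and3P; split; last 2 first.
  + by case/and3P: bu => _ + _; move=> h; exact: connect_trans uv.
  + by case/and3P: bw => _ _; exact: connect_trans.
  + have [x xv] := path_arcs_pred s vpl.
    by have /andP[] := ends (path_arcs_arcs pth xv).
- apply: contraTneq (between_vy_start bu ua) => <-.
  by rewrite -leNgt (connect_vy_le ud uv).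
- apply: contraTneq (between_vy_end bw wb) => <-.
  by rewrite -leNgt (connect_vy_le ud vw).
- by rewrite in_cons vpl orbT.
Qed.

Lemma polygon_first : exists2 h, inside a b (s :: pl) h & adj G a h.
Proof.
have [_ il _ _ _] := ps_poly ps; have [x xi] := card_gt0P il.
have [pth lst] := pthl; have [bx xa xb] := inner_between pth xi.
have [|h ah] := path_arcs_succ (mem_head a plH).
  rewrite lst; apply: contraTneq (between_vy_start bx xa) => ->.
  by rewrite -leNgt; case/andP: (between_vy bx).
have hG := path_arcs_adj (sub_path_adj pth) ah.
exists h => //; apply: polygon_inner_inside; rewrite inE.
have [/= _ hp] := path_arcs_mem ah; rewrite in_cons hp orbT /=.
have lt : vy D a < vy D h by exact: (arc_increasing ud hG).
apply/andP; split; first by apply: contraTneq lt => ->; rewrite ltxx.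
have xp : x \in a :: plH by move: xi; rewrite inE => /andP[].
have [/= c|/= c] := path_arcs_cmp (sub_path_adj pth) ah xp.
  by have := between_vy_start bx xa; rewrite ltNge (connect_vy_le ud c).
apply: contraTneq (between_vy_end bx xb) => <-.
by rewrite -leNgt (connect_vy_le ud c).
Qed.

Lemma polygon_last : exists2 h, inside a b (s :: pl) h & adj G h b.
Proof.
have [_ il _ _ _] := ps_poly ps; have [x xi] := card_gt0P il.
have [pth lst] := pthl; have [bx xa xb] := inner_between pth xi.
have xp : x \in a :: plH by move: xi; rewrite inE => /andP[].
have bp : b \in plH.
  have := mem_last a plH; rewrite lst in_cons => /orP[/eqP ba|//].
  by have := between_vy_end bx xb; rewrite ba ltNge; case/andP: (between_vy bx) => ->.
have [h hb] := path_arcs_pred a bp.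
have hG := path_arcs_adj (sub_path_adj pth) hb.
exists h => //; apply: polygon_inner_inside; rewrite inE.
have [/= -> _] := path_arcs_mem hb; rewrite /=.
have lt : vy D h < vy D b by exact: (arc_increasing ud hG).
apply/andP; split; last by apply: contraTneq lt => ->; rewrite ltxx.
have [/= c|/= c] := path_arcs_cmp (sub_path_adj pth) hb xp; last first.
  by have := between_vy_end bx xb; rewrite ltNge (connect_vy_le ud c).
apply: contraTneq (between_vy_start bx xa) => <-.
by rewrite -leNgt (connect_vy_le ud c).
Qed.

(** Convexity makes the middle part a path; the arcs joining it to [a] and [b] are what has to be
    found. *)
Lemma side_path_path : path (adj G) a side_path.
Proof.
have [pth _] : path (adj G) s pl /\ last s pl = t by case: op => _ _ [[]].
have srt : sorted (adj G) [seq v <- pl | inside a b (s :: pl) v].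
  apply: filter_convex_path pth _ => u v w _ vp _; exact: inside_connect.
rewrite rcons_path.
have mem v : v \in [seq v <- pl | inside a b (s :: pl) v] -> inside a b (s :: pl) v.
  by rewrite mem_filter => /andP[].
have := inside_mem; case E : [seq v <- pl | inside a b (s :: pl) v] srt mem => [|l q] /=.
  by have [h ih _] := polygon_first; move=> _ _ /(_ h ih).
move=> srt mem mem'; rewrite srt andbT.
have il := mem _ (mem_head l q); have iL := mem _ (mem_last l q).
have leftx v e : inside a b (s :: pl) v -> e \in arcs G -> vy D e.1 < vy D v < vy D e.2 ->
    vx D v < curve D e (vy D v).
  move=> /and4P[/and3P[vG _ _] _ _ vL] eG h; exact: leftmost_lt ud vG (ts_left ts vL) eG h.
have rightx v e : between a b v -> v != a -> v != b -> ~~ inside a b (s :: pl) v ->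
    e \in arcs G -> vy D e.1 < vy D v < vy D e.2 -> curve D e (vy D v) < vx D v.
  move=> bv va vb ni eG h; have /and3P[vG _ _] := bv.
  have vR : v \in s :: pr.
    by have := ts_cover ts vG; move: ni; rewrite /inside bv va vb /= => /negbTE->.
  exact: rightmost_lt ud vG (ts_right ts vR) eG h.
apply/andP; split.
(* If the arc entering [l] comes from [w] other than [a], then [w] is on the right side, and this
   arc crosses the arc from [a] to the vertex [h] of [polygon_first], which is above [l]. The end at
   [b] is symmetric. *)
- have /and4P[bl la lb _] := il; have /and3P[lG al lb'] := bl.
  have al' : a != l by rewrite eq_sym.
  have [w aw wl] := connect_last al al'; have [<-//|wa] := eqVneq w a.
  have [h ih ah] := polygon_first; have [<-//|hl] := eqVneq h l.
  have lower v : v \in l :: q -> v != l -> vy D l < vy D v.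
    move=> vq vl; have := connect_vy ud (path_connect srt vq).
    by case=> // lv; rewrite lv eqxx in vl.
  have lh : vy D l < vy D h by apply: lower => //; exact: mem'.
  have wlt : vy D w < vy D l := arc_increasing ud wl.
  have /andP[/= wG _] := ends wl.
  have bw : between a b w.
    by apply/and3P; split=> //; exact: connect_trans (connect1 wl) lb'.
  have wb : w != b.
    apply: contraTneq wlt => ->; rewrite -leNgt; by case/andP: (between_vy bl).
  have nw : ~~ inside a b (s :: pl) w.
    apply/negP => /mem' wq; have [wl'|wl'] := eqVneq w l; first by rewrite wl' ltxx in wlt.
    by have := lower w wq wl'; rewrite ltNge ltW.
  have aw' : vy D a < vy D w := between_vy_start bw wa.
  have c1 : curve D (a, h) (vy D w) < curve D (w, l) (vy D w).
    rewrite (curve_start ud wl) rightx //= aw' /=; exact: lt_trans lh.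
  have c2 : curve D (w, l) (vy D l) < curve D (a, h) (vy D l).
    rewrite (curve_end ud wl) leftx //= lh andbT; exact: lt_trans wlt.
  have s1 : arc_span D (a, h) (vy D w).
    by rewrite /arc_span /= (ltW aw') ltW//; exact: lt_trans lh.
  have s2 : arc_span D (a, h) (vy D l).
    by rewrite /arc_span /= (ltW lh) andbT ltW//; exact: lt_trans wlt.
  have := planar_sign up ah wl s1 (span_start ud wl) s2 (span_end ud wl) c1.
  by rewrite leNgt c2.
- have /and4P[bl la lb _] := iL; have /and3P[lG al lb'] := bl.
  have [w lw wb'] := connect_first lb' lb; have [<-//|wb] := eqVneq w b.
  have [h ih hb] := polygon_last; have [<-//|hl] := eqVneq h (last l q).
  have upper v : v \in l :: q -> v != last l q -> vy D v < vy D (last l q).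
    move=> vq vl; have := connect_vy ud (path_last_connect srt vq).
    by case=> // lv; rewrite -lv eqxx in vl.
  have lh : vy D h < vy D (last l q) by apply: upper => //; exact: mem'.
  have wlt : vy D (last l q) < vy D w := arc_increasing ud lw.
  have /andP[/= _ wG] := ends lw.
  have bw : between a b w.
    by apply/and3P; split=> //; exact: connect_trans al (connect1 lw).
  have wa : w != a.
    apply: contraTneq wlt => ->; rewrite -leNgt; by case/andP: (between_vy bl).
  have nw : ~~ inside a b (s :: pl) w.
    apply/negP => /mem' wq; have [wl'|wl'] := eqVneq w (last l q).
      by rewrite wl' ltxx in wlt.
    by have := upper w wq wl'; rewrite ltNge ltW.
  have bw' : vy D w < vy D b := between_vy_end bw wb.
  have c1 : curve D (last l q, w) (vy D (last l q)) < curve D (h, b) (vy D (last l q)).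
    rewrite (curve_start ud lw) leftx //= lh /=; exact: lt_trans bw'.
  have c2 : curve D (h, b) (vy D w) < curve D (last l q, w) (vy D w).
    rewrite (curve_end ud lw) rightx //= bw' andbT; exact: lt_trans wlt.
  have s1 : arc_span D (h, b) (vy D (last l q)).
    by rewrite /arc_span /= (ltW lh) ltW//; exact: lt_trans bw'.
  have s2 : arc_span D (h, b) (vy D w).
    by rewrite /arc_span /= (ltW bw') andbT ltW//; exact: lt_trans wlt.
  have := planar_sign up lw hb (span_start ud lw) s1 (span_end ud lw) s2 c1.
  by rewrite leNgt c2.
Qed.

Lemma between_mem v : between a b v -> v \notin s :: pr -> v \in a :: side_path.
Proof.
move=> bv vR; have vG : v \in verts G by case/and3P: (bv).
have vL : v \in s :: pl by have := ts_cover ts vG; rewrite (negbTE vR) orbF.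
by rewrite mem_side_path /inside bv vL; do 2! case: eqP.
Qed.

Lemma side_path_between v : v \in a :: side_path -> between a b v.
Proof.
rewrite mem_side_path => /or3P[/eqP->|/eqP->|/and4P[]//];
  by apply: polygon_between; case: polygon_ends.
Qed.

Lemma side_path_last : last a side_path = b.
Proof. exact: last_rcons. Qed.

Lemma side_path_interval : path (adj (st_interval a b)) a side_path.
Proof.
apply: (@sub_in_path _ (mem (a :: side_path))) side_path_path; last exact/allP.
move=> u v ub vb uv; rewrite /adj inE /=.
rewrite (side_path_between ub) (side_path_between vb) !andbT; exact: uv.
Qed.

(** Vertices of the interval off the right side of G are all on this path, so [left_of_side] makes
    an arc drawn to the left of one of its arcs equal to it. *)
Lemma side_path_left : left_side D (st_interval a b) a b side_path.
Proof.
split; first by split; [exact: side_path_interval|exact: side_path_last].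
have arcP f y : f \in arcs G -> between a b f.1 -> between a b f.2 -> arc_span D f y ->
    right_of_path D a side_path (curve D f y, y).
  move=> fG b1 b2 fy g gp gy /=; rewrite leNgt; apply/negP => lt.
  have pin w : w \in a :: side_path -> [|| w == a, w == b | inside a b (s :: pl) w].
    by rewrite mem_side_path.
  have := left_of_side side_path_path side_path_last pin fG b1 b2 gp gy fy lt.
  case=> [[e1|[/(between_mem b1)-> //]]] [e2|[/(between_mem b2)-> //]].
  have fg : f = g by rewrite [f]surjective_pairing e1 e2 -surjective_pairing.
  by rewrite fg ltxx in lt.
move=> z [[v + ->]|[e + [ez zc]]]; rewrite inE; last first.
  by move=> /and3P[eG b1 b2]; rewrite [z]surjective_pairing zc; exact: arcP.
move=> bv; have [->|va] := eqVneq v a; last first.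
  have /and3P[vG av vb] := bv; have va' : a != v by rewrite eq_sym.
  have [w aw wv] := connect_last av va'; have /andP[/= wG _] := ends wv.
  have bw : between a b w.
    by apply/and3P; split=> //; exact: connect_trans (connect1 wv) vb.
  have := arcP (w, v) (vy D v) wv bw bv (span_end ud wv).
  by rewrite (curve_end ud wv).
move=> g gp /andP[/= ga _].
have [g1p _] := path_arcs_mem gp.
have [g1a|g1a] := eqVneq g.1 a.
  by rewrite -g1a (curve_start ud (path_arcs_arcs side_path_path gp)).
by have := between_vy_start (side_path_between g1p) g1a; rewrite ltNge ga.
Qed.

Lemma crossing_arc_right f g y v : f \in arcs G -> between a b f.1 -> between a b f.2 ->
  v = f.1 \/ v = f.2 -> v != a -> v != b -> v \in s :: pr ->
  g \in path_arcs a plH -> arc_span D g y -> arc_span D f y ->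
  curve D g y <= curve D f y.
Proof.
move=> fG b1 b2 vf va vb vR gp gy fy; rewrite leNgt; apply/negP => lt.
have [pth lst] := pthl.
have pin w : w \in a :: plH -> [|| w == a, w == b | inside a b (s :: pl) w].
  have [//|wa wp] := eqVneq w a; have [//|wb] := eqVneq w b.
  by apply: polygon_inner_inside; rewrite inE wp wa.
have vp : v \notin a :: plH.
  apply/negP => vp; have [|+ _] := @polygon_left_inner v; first by rewrite inE vp va.
  by rewrite vR.
have [g1 g2] := path_arcs_mem gp.
have [c1 c2] := left_of_side (sub_path_adj pth) lst pin fG b1 b2 gp gy fy lt.
case: vf => vf.
  case: c1 => [e|[+ _]]; last by rewrite -vf vR.
  by move: vp; rewrite vf e g1.
case: c2 => [e|[+ _]]; last by rewrite -vf vR.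
by move: vp; rewrite vf e in_cons g2 orbT.
Qed.

(** A leftmost vertex that is not left of the path lies on it. *)
Lemma region_between v : v \in verts G -> v \in s :: pl ->
  vy D a <= vy D v <= vy D b -> right_of_path D a side_path (vertex_point D v) ->
  between a b v.
Proof.
move=> vG vL range rp.
have [||g gp gv] := path_span ud side_path_path (y := vy D v).
- by rewrite side_path_last.
- by rewrite /side_path; case: [seq _ <- _ | _].
have gG := path_arcs_arcs side_path_path gp; have /andP[g1 g2] := ends gG.
have eq : curve D g (vy D v) = vx D v.
  apply/eqP; rewrite eq_le (rp g gp gv) /=.
  exact: leftmost_span (ts_left ts vL) gG gv.
apply: side_path_between; exact: mem_arc_side gp (on_arc ud gG vG g1 g2 gv eq).
Qed.

End Left.
Lemma planar_sub D H' : subdigraph H' G -> upward_planar D G -> upward_planar D H'.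
Proof.
move=> [/fintype.subsetP sv /fintype.subsetP sa] [[inj arcsP off fin] pl]; split.
  split.
  - by move=> u v /sv uG /sv vG; exact: inj.
  - by move=> u v /sa; exact: arcsP.
  - by move=> e w /sa eG /sv wG; exact: off.
  - apply: sub_finite_set fin => c [e [f [/sa eG /sa fG ef c1 m]]].
    by exists e, f.
by move=> e f /sa eG /sa fG; exact: pl.
Qed.

Lemma interval_sub : subdigraph (st_interval a b) G.
Proof.
by split; apply/fintype.subsetP => x; rewrite inE; [case/and3P|case/andP].
Qed.

Lemma interval_st_digraph : acyclic G -> closed_arcs G -> between a b a -> between a b b ->
  st_digraph (st_interval a b) a b.
Proof.
move=> ac ends ba bb.
have bI v : (v \in verts (st_interval a b)) = between a b v by rewrite inE.
split.
- by move=> e; rewrite inE /= !inE => /and3P[_ -> ->].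
- move=> c cyc; apply: ac; apply: sub_cycle cyc => u v; rewrite /adj inE.
  by case/andP.
- move=> v; split=> [[vI nov]|->].
    apply/eqP/negPn/negP => va; rewrite bI in vI; have /and3P[_ av vb] := vI.
    have av' : a != v by rewrite eq_sym.
    have [w aw wv] := connect_last av av'; have /andP[/= wG _] := ends _ wv.
    case/negP: (nov w); rewrite /adj inE /= vI andbT; apply/andP; split=> //.
    by apply/and3P; split=> //; exact: connect_trans (connect1 wv) vb.
  split=> [|u]; first by rewrite bI.
  apply/negP; rewrite /adj inE /= => /and3P[ua /and3P[_ au _] _].
  exact: acyclicP ac ua au.
- move=> v; split=> [[vI nov]|->].
    apply/eqP/negPn/negP => vb; rewrite bI in vI; have /and3P[_ av vb'] := vI.
    have [w vw wb] := connect_first vb' vb; have /andP[/= _ wG] := ends _ vw.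
    case/negP: (nov w); rewrite /adj inE /= vI /=; apply/andP; split=> //.
    by apply/and3P; split=> //; exact: connect_trans av (connect1 vw).
  split=> [|u]; first by rewrite bI.
  apply/negP; rewrite /adj inE /= => /and3P[bu _ /and3P[_ _ ub]].
  exact: acyclicP ac bu ub.
Qed.

(** Such an arc is trapped between the sides of [H] by [crossing_arc_right] and its mirror image. It
    therefore belongs to [H], where it joins inner vertices of both sides. *)
Lemma polygon_no_crossing_arc D pl pr plH prH u v f : polygon_setup D pl pr plH prH ->
  inside a b (s :: pl) u -> inside a b (s :: pr) v -> f \in arcs G ->
  f = (u, v) \/ f = (v, u) -> False.
Proof.
move=> ps iu iv fG fuv; have psm := polygon_setup_mirror ps.
have /and4P[bu ua ub uL] := iu; have /and4P[bv va vb vR] := iv.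
have [b1 b2] : between a b f.1 /\ between a b f.2 by case: fuv => ->.
have [uf vf] : (u = f.1 \/ u = f.2) /\ (v = f.1 \/ v = f.2).
  by case: fuv => ->; split; by [left|right].
have fH : f \in arcs H.
  apply: (ps_arcs ps fG) => -[x y] [/= fy ->]; split=> /=.
  - have [f1y yf2] := andP fy.
    have /andP[l1 _] := between_vy ps b1; have /andP[_ l2] := between_vy ps b2.
    by rewrite (le_trans l1 f1y) (le_trans yf2 l2).
  - move=> g gp gy; exact: (crossing_arc_right ps fG b1 b2 vf va vb vR gp gy fy).
  - move=> g gp gy; have := crossing_arc_right psm fG b1 b2 uf ua ub uL gp gy fy.
    by rewrite /= lerN2.
have [[st _ _ _ cov] _ _ _ noe] := ps_poly ps.
have [endsH _ _ _] := st; have /andP[f1H f2H] := endsH _ fH.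
have uH : u \in verts H by case: uf => ->.
have vH : v \in verts H by case: vf => ->.
have ul : u \in inner_verts a b plH.
  rewrite inE ua ub !andbT; have /orP[//|ur] := cov u uH.
  have [|+ _] := polygon_left_inner psm (v := u); first by rewrite inE ur ua ub.
  by rewrite uL.
have vr : v \in inner_verts a b prH.
  rewrite inE va vb !andbT; have /orP[vl|//] := cov v vH.
  have [|+ _] := polygon_left_inner ps (v := v); first by rewrite inE vl va vb.
  by rewrite vR.
have /andP[n1 n2] := noe u v ul vr.
by case: fuv fH => ->; apply/negP.
Qed.

Lemma interval_polygon D pl pr plH prH : polygon_setup D pl pr plH prH ->
  st_polygon_of D G (st_interval a b).
Proof.
move=> ps; have psm := polygon_setup_mirror ps.
have [[ends ac _ _] up _ _ cov] := ps_outer ps.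
have [aH bH] := polygon_ends ps.
have [ba bb] := (polygon_between ps aH, polygon_between ps bH).
have stI := interval_st_digraph ac ends ba bb.
split; first exact: interval_sub.
exists a, b, (side_path pl), (side_path pr).
have regG v : v \in verts G -> region D a b (side_path pl) (side_path pr) (vertex_point D v) ->
    between a b v.
  move=> vG [range rp lp]; have /orP[vL|vR] := cov v vG.
    exact: (region_between ps vG vL range rp).
  apply: (region_between psm vG vR range); apply: (proj2 (right_of_mirror _ _ _ _)).
  by rewrite /flipx /= opprK.
split.
- split.
  + split=> //.
    * exact: planar_sub interval_sub up.
    * exact: side_path_left ps.
    * exact: (proj1 (left_side_mirror _ _ _ _ _) (side_path_left psm)).
    * move=> v; rewrite inE => bv; rewrite !(mem_side_path ps, mem_side_path psm).
      rewrite /inside bv /=; do 2! case: eqP => //= _.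
      by apply: cov; case/and3P: bv.
  + have [h ih _] := polygon_first ps; apply/card_gt0P; exists h.
    by rewrite (inner_side_path ps).
  + have [h ih _] := polygon_first psm; apply/card_gt0P; exists h.
    by rewrite (inner_side_path psm).
  + apply/pred0P => v /=; apply/negP => /andP[].
    rewrite (inner_side_path ps) (inner_side_path psm) => iv /and4P[_ _ _].
    by rewrite (negbTE (inside_exclusive ps iv)).
  + move=> u v; rewrite (inner_side_path ps) (inner_side_path psm) => iu iv.
    apply/andP; split; apply/negP; rewrite /adj inE => /andP[eG _].
      by apply: polygon_no_crossing_arc ps iu iv eG _; left.
    by apply: polygon_no_crossing_arc ps iu iv eG _; right.
- by move=> v vG rv; rewrite inE; exact: regG.
- move=> e eG sub; have /andP[e1 e2] := ends _ eG; have ud := up.1.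
  rewrite inE eG /=; apply/andP; split; apply: regG => //; apply: sub; split => /=.
  + by have := span_start ud eG; rewrite /arc_span.
  + by rewrite (curve_start ud eG).
  + by have := span_end ud eG; rewrite /arc_span.
  + by rewrite (curve_end ud eG).
Qed.

End Fixed.

(** [H] is contained in the interval, which is an st-polygon of G; maximality gives equality. *)
Lemma maximal_polygon_interval D H s t pl pr a b plH prH :
  outerplanar_st D G s t pl pr -> maximal_st_polygon D G H ->
  st_polygon D H a b plH prH -> H = st_interval a b.
Proof.
move=> op [[sub [a' [b' [pl' [pr' [po _ ar]]]]]] mx] po'.
have [[[_ _ src snk] _ _ _ _] _ _ _ _] := po; have [[st' _ _ _ _] _ _ _ _] := po'.
have [_ _ src' snk'] := st'.
have aa : a' = a by apply/src'; apply/src.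
have bb : b' = b by apply/snk'; apply/snk.
rewrite {}aa {}bb {src snk} in po ar.
have ps : polygon_setup s t a b H D pl pr pl' pr' by split.
apply/esym/mx; first exact: interval_polygon ps.
have [ends _ _ _] := st'; have [/fintype.subsetP sv /fintype.subsetP sa] := sub.
split; apply/fintype.subsetP => x xH; rewrite inE; first exact: (polygon_between ps xH).
by have /andP[x1 x2] := ends _ xH; rewrite sa//= !(polygon_between ps).
Qed.

End Interval.

(** * Upper limiting arcs *)

Section Optimum.
Variables (R : realType) (T : finType) (D : drawing R T) (G : digraph T).
Variables (s t : T) (pl pr : seq T).
Hypothesis op : outerplanar_st D G s t pl pr.
Implicit Types (n : T -> nat) (e f : T * T) (H : digraph T).

Let ts := outerplanar_two_sided op.
Let up := ts_planar ts.
Let ud := up.1.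
Let ends := ts_ends ts.
Let st : st_digraph G s t. Proof. by case: op. Qed.

Lemma straight_minimal n : valid_order G n ->
  crossing_minimal D G (new_arcs G n) (straight R G (s :: pl) n) /\
  num_crossings (straight R G (s :: pl) n) (add_arcs G (new_arcs G n)) = order_cost G n.
Proof.
move=> vn; have pres := straight_preserving ts vn.
have [_ le] := straight_crossings ts vn.
split; last first.
  by apply/eqP; rewrite eqn_leq le (crossings_lower_bound op vn pres).
split=> // X presX; exact: leq_trans le (crossings_lower_bound op vn presX).
Qed.

Lemma optimal_order_exists : exists2 n, valid_order G n &
  forall n', valid_order G n' -> (weight G n <= weight G n')%N.
Proof.
have [n0 vn0] := valid_order_exists ud ends.
pose P k := `[< exists2 n, valid_order G n & weight G n = k >].
have exP : exists k, P k by exists (weight G n0); apply/asboolP; exists n0.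
have [k /asboolP[n vn nk] kmin] := ex_minnP exP.
exists n => // n' vn'; rewrite nk; apply: kmin; apply/asboolP; by exists n'.
Qed.

Section Fixed.
Variables (n : T -> nat).
Hypothesis vn : valid_order G n.
Hypothesis opt : forall n', valid_order G n' -> (weight G n <= weight G n')%N.

Let P := new_arcs G n.
Let D' := straight R G (s :: pl) n.

(** Any competing set comes from a linear extension, whose cost bounds its crossings from below; the
    straight drawing attains the bound for [n]. *)
Lemma optimal_crossings : crossing_optimal D G s t P.
Proof.
split; first exact: order_completion st vn.
have [cm num] := straight_minimal vn.
exists (order_cost G n); first by exists D'.
move=> Q m cQ [X [presX _] <-].
have [n' vn' QE] := completion_order ends cQ; rewrite {}QE in presX *.
apply: leq_trans (weight_minimal (opt vn')) _.
exact: crossings_lower_bound op vn' presX.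
Qed.

Lemma crossing_arc_over e f : e \in arcs G -> f \in crossing_arcs D' P e ->
  [/\ f \in P, (n e.1 < n f.1)%N & (n f.2 < n e.2)%N].
Proof.
move=> eG; rewrite inE => /andP[fP /asboolP[y m]].
have fG : f \notin arcs G by move: fP; rewrite inE => /and4P[].
have eP : e \notin P by rewrite inE eG !andbF.
have ef : e != f by apply: contraNneq fG => <-.
have eGP : e \in arcs (add_arcs G P) by apply/finset.setUP; left.
have fGP : f \in arcs (add_arcs G P) by apply/finset.setUP; right.
case: (meet_over ts vn eGP fGP ef m) => -[h1]; last by rewrite h1 in eP.
by rewrite inE => /and3P[_ h2 h3].
Qed.

Let tightl : tight G (s :: pl).
Proof. by apply: path_tight; case: op => _ _ [[]]. Qed.
Let tightr : tight G (s :: pr).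
Proof. by apply: path_tight; case: op => _ _ _ [[]]. Qed.
Let cov : covers G (s :: pl) (s :: pr) := ts_cover ts.
Let sep : sides_separated G n (s :: pl) (s :: pr) := two_sided_separated vn ts.

Lemma crossing_arcs_le2 e : e \in arcs G -> (#|crossing_arcs D' P e| <= 2)%N.
Proof.
move=> eG; apply: leq_trans (over_le2 ends vn opt tightl tightr cov sep eG).
apply: subset_leq_card; apply/fintype.subsetP => f /(crossing_arc_over eG)[fP h1 h2].
by rewrite inE fP h1.
Qed.

(** The second vertex of a longer path to [b] would be in the interval but not on the side of [e],
    whose vertices all precede or follow [e]. It would be an inner vertex of the other side, joined
    to the inner vertex [e.1]. *)
Lemma upper_limiting_nontransitive H a b plH prH e :
  H = st_interval G a b -> st_polygon D H a b plH prH ->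
  (e \in path_arcs a plH) || (e \in path_arcs a prH) -> e.2 = b ->
  [/\ e \in arcs G, connect (adj G) a e.1, a != e.1 &
    forall w, connect (adj G) e.1 w -> connect (adj G) w b -> e.1 != w -> w != b -> False].
Proof.
move=> HI po.
suff main (X : drawing R T) p q : st_polygon X H a b p q -> e \in path_arcs a p -> e.2 = b ->
  [/\ e \in arcs G, connect (adj G) a e.1, a != e.1 &
    forall w, connect (adj G) e.1 w -> connect (adj G) w b -> e.1 != w -> w != b -> False].
  by case/orP; [exact: main po|exact: main (st_polygon_mirror po)].
move=> [[stH _ [[pth _] _] _ covH] ip _ _ noe] ep e2.
have HG u v : adj H u v -> adj G u v by rewrite HI /adj inE => /andP[].
have eH : adj H e.1 e.2 := path_arcs_adj pth ep.
have eG : e \in arcs G by rewrite [e]surjective_pairing; exact: HG.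
have lt u v : adj G u v -> (vy D u < vy D v)%R by exact: arc_increasing.
have conn v : v \in verts H -> connect (adj G) a v /\ connect (adj G) v b.
  by rewrite HI inE => /and3P[].
have [endsH _ _ _] := stH.
have e1H : e.1 \in verts H by have /andP[] := endsH _ eH.
have [ae1 _] := conn _ e1H.
have pathG : path (adj G) a p by exact: sub_path pth.
have pH v : v \in a :: p -> v \in verts H.
  rewrite in_cons => /orP[/eqP->|/(path_arcs_pred a)[u uv]].
    by have [_ _ /(_ a)[_ /(_ erefl)[]]] := stH.
  by have := path_arcs_adj pth uv; move/endsH => /andP[].
have e1a : a != e.1.
  have [y yi] := card_gt0P ip; move: yi; rewrite inE => /and3P[yp ya yb].
  have [ay yb'] := conn y (pH y yp).
  apply/eqP => ae; have := path_arcs_cmp pathG ep yp; rewrite -ae e2 => -[c|c].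
    case: (connect_vy ud ay) => [e'|l1]; first by rewrite e' eqxx in ya.
    by have := connect_vy_le ud c; rewrite leNgt l1.
  case: (connect_vy ud yb') => [e'|l1]; first by rewrite e' eqxx in yb.
  by have := connect_vy_le ud c; rewrite leNgt l1.
split=> // w e1w wb e1w' wb'.
have [w1 ew1 w1w] := connect_first e1w e1w'.
have w1b : w1 != b.
  apply/eqP => w1b; case: (connect_vy ud wb) => [wb''|l1]; first by rewrite wb'' eqxx in wb'.
  by have := connect_vy_le ud w1w; rewrite w1b leNgt l1.
have w1H : w1 \in verts H.
  have /andP[_ w1G] := ends ew1.
  rewrite HI inE; apply/and3P; split=> //; last exact: connect_trans w1w wb.
  exact: connect_trans ae1 (connect1 ew1).
have w1a : w1 != a.
  apply/eqP => w1a; have := lt _ _ ew1; rewrite w1a.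
  by have := connect_vy_le ud ae1; rewrite leNgt => /negbTE->.
have e1b : e.1 != b.
  by apply: contraTneq (lt _ _ (HG _ _ eH)) => ->; rewrite e2 ltxx.
have e1i : e.1 \in inner_verts a b p.
  by have [e1p _] := path_arcs_mem ep; rewrite inE e1p eq_sym e1a.
have w1i : w1 \in inner_verts a b q.
  rewrite inE w1a w1b !andbT; have /orP[w1p|//] := covH _ w1H.
  case: (path_arcs_cmp pathG ep w1p) => c.
    by have := connect_vy_le ud c; rewrite leNgt lt.
  have [_ w1b'] := conn _ w1H; rewrite e2 in c.
  case: (connect_vy ud w1b') => [e'|l1]; first by rewrite e' eqxx in w1b.
  by have := connect_vy_le ud c; rewrite leNgt l1.
have /andP[/negP + _] := noe _ _ e1i w1i; apply.
have /andP[e1G w1G] := ends ew1; have [c1 c2] := conn _ e1H; have [c3 c4] := conn _ w1H.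
rewrite HI /adj inE; apply/andP; split; first exact: ew1.
by apply/andP; split; apply/and3P.
Qed.

(** The content of [no_interleaving] freed from the drawing, so that exchanging [A] and [B] requires
    no reflection. *)
Definition uncrossed A B := forall e f, e \in arcs G -> f \in arcs G ->
  (n e.1 < n f.2)%N -> (n f.1 < n e.2)%N ->
  starts_left A B n f e -> ends_left A B n e f -> False.

Lemma uncrossed_sym A B : uncrossed A B -> uncrossed B A.
Proof.
move=> un e f eG fG ef fe sl el; apply: (un f e) => //.
- by move: sl; rewrite /starts_left orbC.
- by move: el; rewrite /ends_left orbC.
Qed.

Section Limiting.
Variables (lambda : nat) (o : lambda.-tuple (element T)) (i : 'I_lambda).
Variables (H : digraph T) (a b : T) (plH prH : seq T) (x : T) (A B : seq T).
Hypotheses (dec : polygon_decomposition D G o) (oi : tnth o i = inl H).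
Hypotheses (HI : H = st_interval G a b) (po : st_polygon D H a b plH prH).
Hypotheses (xb : (x, b) \in arcs G) (ax : connect (adj G) a x) (ax' : a != x).
Hypothesis ntr : forall w, connect (adj G) x w -> connect (adj G) w b ->
  x != w -> w != b -> False.
Hypotheses (cA : chain G A) (cB : chain G B) (covAB : covers G A B).
Hypotheses (un : uncrossed A B) (xA : x \in A) (bB : b \in B).

Let x_lt_b : (n x < n b)%N. Proof. by have [_ _ inc] := vn; exact: inc. Qed.
Let conn_lt u v : connect (adj G) u v -> u = v \/ (n u < n v)%N.
Proof. by have [_ _ inc] := vn; exact: increasing_connect. Qed.

Let polygon_source j K : tnth o j = inl K -> maximal_st_polygon D G K /\
  exists u w p q, st_polygon D K u w p q /\ K = st_interval G u w.
Proof.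
move=> oj; have [_ mx _ _] := dec.
have mK : maximal_st_polygon D G K by apply/mx; exists j.
split=> //; have [[_ [u [w [p [q [pK _ _]]]]]] _] := mK.
by exists u, w, p, q; split=> //; exact: maximal_polygon_interval op mK pK.
Qed.

Let source_of K u w p q : st_polygon D K u w p q -> is_source K u.
Proof. by case=> -[[_ _ src _] _ _ _ _] _ _ _ _; apply/src. Qed.

(** If the member containing [r] came after [H], its representative, hence [r], would be reachable
    from [a]; as [r] also reaches [b], it would be in [H] itself. *)
Lemma prefix_head r : r \in verts G -> r \in B -> (n r < n b)%N ->
  r \in prefix_verts o i.
Proof.
move=> rG rB rb; have rb' := order_connect vn cB rB bB rb.
have [_ mx fr ord] := dec.
have inH : connect (adj G) a r -> r \in prefix_verts o i.
  move=> ar; apply/finset.bigcupP; exists i; first exact: leqnn.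
  by rewrite oi /= HI inE; apply/and3P.
have later (j : 'I_lambda) u : (i < j)%N -> representative (tnth o j) u -> connect (adj G) a u.
  move=> ij ru; have ne : i != j by apply: contraTneq ij => ->; rewrite ltnn.
  rewrite -(ord i j a u ne) // oi /=; exact: source_of po.
have [[K [mK rK]]|noK] := pselect (exists K, maximal_st_polygon D G K /\ r \in verts K).
  have [j oj] : exists j, tnth o j = inl K by apply/mx.
  have [ji|ij] := leqP j i.
    by apply/finset.bigcupP; exists j; rewrite // oj.
  have [_ [u [w [p [q [pK KI]]]]]] := polygon_source oj.
  apply: inH; apply: (connect_trans (y := u)).
    by apply: (later j) => //; rewrite oj /=; exact: source_of pK.
  by move: rK; rewrite KI inE => /and3P[].
have [j oj] : exists j, tnth o j = inr r.
  apply/fr; split=> // K mK; apply/negP => rK; apply: noK; by exists K.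
have [ji|ij] := leqP j i.
  by apply/finset.bigcupP; exists j; rewrite // oj /= finset.in_set1.
by apply: inH; apply: (later j) => //; rewrite oj.
Qed.

(** [l] does not reach [b], so it is not in [H], and it comes after [a], so it is no earlier free
    vertex. An earlier polygon containing it would straddle the arc from [x] to [b]. *)
Lemma prefix_tail l : l \in verts G -> l \in A -> (n x < n l)%N -> (n l < n b)%N ->
  l \notin prefix_verts o i.
Proof.
move=> lG lA xl lb; have xl' := order_connect vn cA xA lA xl.
have [_ mx fr ord] := dec; have [inj _ inc] := vn.
have lnb : ~ connect (adj G) l b.
  by move=> c; exact: (ntr xl' c (order_neq xl) (order_neq lb)).
have [xG bG] := andP (ends xb : (x \in verts G) && (b \in verts G)).
have nax : (n a < n x)%N by case: (conn_lt ax) => // ax0; case/eqP: ax'.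
apply/negP => /finset.bigcupP[j ji lj].
move: ji; rewrite leq_eqVlt => /predU1P[/val_inj ji|ji].
  by apply: lnb; move: lj; rewrite ji oi /= HI inE => /and3P[].
have earlier u : representative (tnth o j) u -> connect (adj G) u a.
  move=> ru; have ne : j != i by apply: contraTneq ji => ->; rewrite ltnn.
  rewrite -(ord j i u a ne) // oi /=; exact: source_of po.
case E : (tnth o j) lj earlier => [K|r] /= lj earlier; last first.
  move: lj; rewrite finset.in_set1 => /eqP lr.
  have := earlier l lr; case/conn_lt => [la|]; last by move: xl nax; clear; lia.
  by move: xl nax; rewrite la; clear; lia.
have [_ [u [w [p [q [pK KI]]]]]] := polygon_source E.
have ua := earlier u (source_of pK).
have nu : (n u < n x)%N.
  by case/conn_lt: ua => [->//|h]; exact: ltn_trans nax.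
have lw : connect (adj G) l w by move: lj; rewrite KI inE => /and3P[].
(* The cut of G along the arc from [x] to [b]. The source [u] of the earlier polygon is below it;
   its sink [w], reached from [l], is not. *)
pose below v := (v \in A) && (n v <= n x)%N || (v \in B) && (n v <= n b)%N.
have KG v : v \in verts K -> v \in verts G by rewrite KI inE => /and3P[].
have [[stK _ [[pp pl'] _] [[pq ql] _] _] _ _ dis noe] := pK.
have [endsK _ srcK snkK] := stK.
have uG : u \in verts G by apply: KG; have [] := source_of pK.
have wG : w \in verts G by apply: KG; have [_ /(_ erefl)[]] := snkK w.
have belowu : below u.
  by rewrite /below; have /orP[->|->] := covAB uG; rewrite ?(ltnW nu) // (ltnW (ltn_trans nu x_lt_b)) orbT.
have beloww : ~~ below w.
  apply/negP => /orP[/andP[wA wx]|/andP[wB wb]].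
    by case/conn_lt: lw => [lw|lw]; move: xl wx; rewrite -?lw; [|move: lw]; clear; lia.
  apply: lnb; apply: connect_trans lw _.
  move: wb; rewrite leq_eqVlt => /predU1P[/(inj _ _ wG bG) ->|]; first exact: connect0.
  exact: (order_connect vn cB wB bB).
(* Any other arc leaving the cut would interleave with the arc from [x] to [b]. *)
have leave c d : adj G c d -> below c -> ~~ below d -> c = x \/ c = b.
  move=> cd bc nbd; have /andP[cG dG] := ends cd.
  have [->|cx] := eqVneq c x; first by left.
  have [->|cb] := eqVneq c b; first by right.
  exfalso; have ncd := inc _ _ cd.
  have ncx : n c != n x by apply: contra cx => /eqP/inj->.
  have ncb : n c != n b by apply: contra cb => /eqP/inj->.
  have db : d != b by apply: contraNneq nbd => ->; rewrite /below bB leqnn orbT.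
  have ndb : n d != n b by apply: contra db => /eqP/inj->.
  have cltb : (n c < n b)%N.
    case/orP: bc => /andP[_ h]; last by rewrite ltn_neqAle ncb.
    exact: leq_ltn_trans x_lt_b.
  have xltd : (n x < n d)%N.
    rewrite ltnNge; apply/negP => dx; move: nbd; rewrite /below.
    by have /orP[->|->] := covAB dG; rewrite ?dx // (leq_trans dx (ltnW x_lt_b)) orbT.
  apply: (un (e := (c, d)) (f := (x, b)) cd xb) => //=; rewrite /starts_left /ends_left /=.
    rewrite xA /=; have [//|xc] := ltnP (n c) (n x).
    have cinB : c \in B.
      case/orP: bc => /andP[// cA' h].
      by move: ncx; rewrite eqn_leq h xc.
    by rewrite cinB /= ltn_neqAle eq_sym ncx xc.
  have [bd|db'] := ltnP (n b) (n d); first by rewrite bB orbT.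
  have ltdb : (n d < n b)%N by rewrite ltn_neqAle ndb.
  rewrite ltdb andbT; have /orP[->//|dB] := covAB dG.
  by move: nbd; rewrite /below dB db' orbT.
(* Each side of [K] leaves the cut through [x] or [b]. The sides being disjoint, one passes through
   [x] and the other through [b], and the arc between these inner vertices contradicts the
   definition of an st-polygon. *)
have crossing p' : path (adj K) u p' -> last u p' = w ->
    exists2 c, c \in inner_verts u w p' & c = x \/ c = b.
  move=> pth lst.
  have [c cp cxb] : exists2 c, c \in u :: p' & c = x \/ c = b.
    have : path (adj G) u p'.
      by apply: sub_path pth => c d; rewrite KI /adj inE => /andP[].
    elim: (p') (u) belowu lst => [|d p2 IH] c bc /=; first by move=> e; move: beloww; rewrite -e bc.
    move=> lst /andP[cd pth']; have [bd|nbd] := boolP (below d).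
      by have [c' c'p h] := IH d bd lst pth'; exists c'; rewrite // in_cons c'p orbT.
    by exists c; [exact: mem_head|exact: leave cd bc nbd].
  exists c => //; rewrite inE cp /=; apply/andP; split.
    apply/eqP => cu; move: nu x_lt_b; rewrite -cu; case: cxb => ->; clear; lia.
  apply: contraNneq beloww => <-; rewrite /below; case: cxb => ->.
    by rewrite xA leqnn.
  by rewrite bB leqnn orbT.
have [c ci cxb] := crossing p pp pl'; have [d di dxb] := crossing q pq ql.
have cd : c != d by apply: contraTneq di => <-; rewrite (disjointFr dis ci).
have inK v : v \in verts K -> connect (adj G) u v /\ connect (adj G) v w.
  by rewrite KI inE => /and3P[].
have pathK v p' : path (adj K) u p' -> v \in inner_verts u w p' -> v \in verts K.
  move=> pth; rewrite inE in_cons => /andP[/orP[/eqP->|/(path_arcs_pred u)[y yv]] _].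
    by have [] := source_of pK.
  by have := path_arcs_adj pth yv; move/endsK => /andP[].
have [cK dK] := (pathK c p pp ci, pathK d q pq di).
have adjK y z : y \in verts K -> z \in verts K -> adj G y z -> adj K y z.
  move=> yK zK yz; rewrite KI /adj inE; apply/andP; split; first exact: yz.
  have [y1 y2] := inK _ yK; have [z1 z2] := inK _ zK.
  by apply/andP; split; apply/and3P; split=> //; exact: KG.
have /andP[n1 n2] := noe c d ci di.
case: cxb => cE; case: dxb => dE.
- by case/eqP: cd; rewrite cE dE.
- by case/negP: n1; apply: adjK => //; rewrite cE dE.
- by case/negP: n2; apply: adjK => //; rewrite cE dE.
- by case/eqP: cd; rewrite cE dE.
Qed.

End Limiting.

Lemma order_uncrossed : uncrossed (s :: pl) (s :: pr).
Proof. by have [_ _ inc] := vn; move=> e f; exact: (no_interleaving ts inc). Qed.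

Lemma limiting_crossing lambda (o : lambda.-tuple (element T)) (i : 'I_lambda) H e :
  polygon_decomposition D G o -> tnth o i = inl H -> upper_limiting D s pl pr H e ->
  (#|crossing_arcs D' P e| <= 1)%N /\
  forall f, f \in crossing_arcs D' P e ->
    f.2 \in prefix_verts o i /\ f.1 \notin prefix_verts o i.
Proof.
move=> dec oi [a [b [plH [prH [po ep e2 sides]]]]].
have [_ mx _ _] := dec; have mH : maximal_st_polygon D G H by apply/mx; exists i.
have HI := maximal_polygon_interval op mH po.
have [eG ae1 ae1' ntr] := upper_limiting_nontransitive HI po ep e2.
have eE : e = (e.1, b) by rewrite -e2 -surjective_pairing.
have [chl chr] := (ts_chainl ts, ts_chainr ts).
suff main A B : tight G A -> tight G B -> covers G A B -> sides_separated G n A B ->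
    chain G A -> chain G B -> uncrossed A B -> e.1 \in A -> e.2 \in B ->
    (#|crossing_arcs D' P e| <= 1)%N /\ forall f, f \in crossing_arcs D' P e ->
      f.2 \in prefix_verts o i /\ f.1 \notin prefix_verts o i.
  case/orP: sides => /andP[]; first exact: main order_uncrossed.
  apply: main (uncrossed_sym order_uncrossed) => //; last exact: separated_sym.
  by move=> v /cov; rewrite orbC.
move=> tA tB cAB sAB cA cB un e1A; rewrite e2 => bB.
have xb : adj G e.1 b by rewrite /adj -eE.
have over f : f \in crossing_arcs D' P e -> [/\ f \in P, (n e.1 < n f.1)%N & (n f.2 < n b)%N].
  by move=> /(crossing_arc_over eG); rewrite e2.
split.
  rewrite leqNgt; apply/negP => /card_gt1P[f [g [/over[fP f1 f2] /over[gP g1 g2]]]].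
  by case/eqP; apply: (over_unique ends vn opt tA tB cAB sAB cA cB xb e1A bB ntr).
move=> f /over[fP f1 f2].
have [f1A f2B _] := over_side ends vn opt tA tB cAB sAB cA cB xb e1A bB ntr fP f1 f2.
move: (fP); rewrite inE => /and4P[f1G f2G /eqP nf _]; split.
  exact: (prefix_head dec oi HI po cB bB f2G f2B f2).
apply: (prefix_tail dec oi HI po xb ae1 ae1' ntr cA cB cAB un e1A bB f1G f1A f1).
by apply: ltn_trans f2; rewrite nf.
Qed.

End Fixed.
End Optimum.

Theorem theorem4 (R : realType) (T : finType) (D : drawing R T)
    (G : digraph T) (s t : T) (pl pr : seq T)
    (lambda : nat) (o : lambda.-tuple (element T)) :
  outerplanar_st D G s t pl pr ->
  polygon_decomposition D G o ->
  exists (Popt : {set T * T}) (D' : drawing R T),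
    [/\ crossing_optimal D G s t Popt,
        crossing_minimal D G Popt D',
        forall e, e \in arcs G -> (#|crossing_arcs D' Popt e| <= 2)%N
      & forall (i : 'I_lambda) (H : digraph T) (e : T * T),
          tnth o i = inl H -> upper_limiting D s pl pr H e ->
          (#|crossing_arcs D' Popt e| <= 1)%N /\
          forall f, f \in crossing_arcs D' Popt e ->
            f.2 \in prefix_verts o i /\ f.1 \notin prefix_verts o i].
Proof.
move=> op dec; have [n vn opt] := optimal_order_exists op.
exists (new_arcs G n), (straight R G (s :: pl) n); split.
- exact: (optimal_crossings op vn opt).
- by have [] := straight_minimal op vn.
- by move=> e; exact: (crossing_arcs_le2 op vn opt).
- by move=> i H e; exact: (limiting_crossing op vn opt dec).
Qed.
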